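(* Let $I$ be a compact Hausdorff space, $m$ a Borel measure with $m(I)=1$, and $\mathcal{P}$ a good grid on $I$; endow $I$ with the metric $\rho(x,y)=\inf\{|Q|:\ Q\in\bigcup_k\mathcal{P}^k,\ x,y\in Q\}$. Then for every $p\in[1,\infty)$ and $q\in[1,\infty]$ there is $s_0\in(0,1/p]$ such that for every $0<s<s_0$ the following holds: the Gu–Taibleson recalibrated martingale Besov space $B_{GT}(s,p,q)$ does not depend on the recalibration $\mathcal{G}$ of $\mathcal{P}$ used to define it, and it coincides with the Besov space of the homogeneous space $(I,\rho,m)$: $$B_{GT}(s,p,q)=\mathcal{B}^s_{p,q}(\mathcal{G})=\mathbb{B}^s_{p,q}=B_{HLY}(s,p,q).$$
   Context: Write $|S|=m(S)$. A good grid on $(I,\mathbb{A},m)$ ($\mathbb{A}$ the Borel sets) is a sequence $\mathcal{P}=(\mathcal{P}^k)_{k\ge0}$ of finite families of measurable sets with positive measure such that: (i) every $\mathcal{P}^k$ is a partition of $I$ up to sets of zero measure, and every element of $\mathcal{P}^{k+1}$ is contained in an element of $\mathcal{P}^k$; (ii) $\bigcup_k\mathcal{P}^k$ generates $\mathbb{A}$; (iii) there are $\lambda,\hat\lambda\in(0,1)$ with $\hat\lambda\le|Q|/|P|\le\lambda$ whenever $Q\subset P$, $Q\in\mathcal{P}^{k+1}$, $P\in\mathcal{P}^k$. After discarding a null set if necessary, every $\mathcal{P}^k$ is a genuine partition with $\mathcal{P}^0=\{I\}$, $\rho$ is an (ultra)metric, and $\frac1Cr\le m(B_\rho(x,r))\le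 Cr$ for all $x$ and small $r>0$. For this space the Macías–Segovia quasi-metric $\beta(x,y)=\inf\{m(B):B\text{ a }\rho\text{-ball containing }x,y\}$ equals $\rho$. Recalibration: a good grid $\mathcal{G}$ with $\bigcup_k\mathcal{G}^k\subset\bigcup_k\mathcal{P}^k$ such that, with $\ell_k=\max_{P\in\mathcal{G}^k}|P|$, $m_k=\min_{P\in\mathcal{G}^k}|P|$, we have $\ell_{k+1}<\ell_k$ and there are $\theta_1,\theta_2,\delta\in(0,1)$ with $\theta_1\le\ell_{k+1}/\ell_k\le\theta_2$ and $1\le\ell_k/m_k\le1/\delta$ for every $k$. $B_{GT}(s,p,q)$: for $f\in L^1$ let $f_k(x)=\frac1{|Q|}\int_Qf\,dm$ for $x\in Q\in\mathcal{G}^k$, $k\ge0$, $f_{-1}=0$, $d_kf=f_k-f_{k-1}$; $B_{GT}(s,p,q)$ is the space of $f\in L^1$ with $\big(\sum_{k\ge0}(\ell_k^{-s}|d_kf|_{L^p})^q\big)^{1/q}<\infty$ (supremum if $q=\infty$). Grid Besov space: for a good grid $\mathcal{W}$ let $e_Q=|Q|^{s-1/p}1_Q$ for $Q\in\bigcup_k\mathcal{W}^k$. $\mathcal{B}^s_{p,q}(\mathcal{W})$ is the space of $f\in L^p$ that can be written as $f=\sum_{k\ge0}\sum_{Q\in\mathcal{W}^k}s_Qe_Q$ with $s_Q\in\mathbb{C}$, $\sum_k|\sum_{Q\in\mathcal{W}^k}s_Qe_Q|_{L^p}<\infty$, and $\big(\sum_k(\sum_{Q\in\mathcal{W}^k}|s_Q|^p)^{q/p}\big)^{1/q}<\infty$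 (supremum if $q=\infty$). Adapted grid: a good grid $\mathcal{W}$ is $\rho$-adapted with exponent $\eta$ if there are constants $\eta,c_1,c_2,c_3,c_4>0$, $\lambda_*\in(0,1)$ such that for every $k\ge1$, $Q\in\mathcal{W}^k$ there is $z_Q\in Q$ with $B_\rho(z_Q,c_1\lambda_*^k)\subset Q$, $\operatorname{diam}_\rho Q\le c_2\lambda_*^k$, and $m\{x\in Q:\rho(x,I\setminus Q)\le c_3t\lambda_*^k\}\le c_4t^\eta m(Q)$ for all $t>0$. $\mathbb{B}^s_{p,q}$ denotes $\mathcal{B}^s_{p,q}(\mathcal{W})$ for any $\rho$-adapted good grid $\mathcal{W}$ with exponent $\eta>sp$ (the space does not depend on the choice). $B_{HLY}(s,p,q)$ (atomic description of the Han–Lu–Yang Besov space of $(I,\rho,m)$): fix a $\rho$-adapted good grid $\mathcal{W}$ with exponent $\eta>sp$, its points $z_Q$ (any $z_Q\in Q$ for $Q\in\mathcal{W}^0$) and constants, take $\gamma=1$, and let $C_\rho\ge 1$ be a quasi-triangle constant of $\rho$. A block associated to $Q\in\mathcal{W}^k$ is a function $a_Q:I\to\mathbb{C}$ with $\operatorname{supp}a_Q\subset B_\rho(z_Q,3C_\rho c_2\lambda_*^k)$, $|a_Q|_\infty\le|Q|^{s-1/p}$, $|a_Q(x)-a_Q(y)|\le|Q|^{s-1/p-1}\rho(x,y)$. $B_{HLY}(s,p,q)$ is the set of $f\in L^p$ of the form $f=\sum_k\sum_{Q\in\mathcal{W}^k}c_Qa_Q$ with blocks $a_Q$, $\sum_k|\sum_{Q\in\mathcal{W}^k}c_Qa_Q|_{L^p}<\infty$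 and $\big(\sum_k(\sum_{Q\in\mathcal{W}^k}|c_Q|^p)^{q/p}\big)^{1/q}<\infty$. *)

(* Defs.v *)
From HB Require Import structures.
From mathcomp Require Import all_boot all_order all_algebra.
From mathcomp Require Import all_classical all_reals all_analysis.
From mathcomp Require Import complex.

Set Implicit Arguments.
Unset Strict Implicit.
Unset Printing Implicit Defensive.

Import Order.TTheory GRing.Theory Num.Theory.
Import numFieldTopology.Exports.
Local Open Scope classical_set_scope.
Local Open Scope ring_scope.
Local Open Scope complex_scope.

Notation borelType I := (g_sigma_algebraType (@open I)).

Section Grids.
Context d (T : measurableType d) (R : realType).
Variable m : {measure set T -> \bar R}.

Definition vol (Q : set T) : R := fine (m Q).

Definition cells (P : nat -> set (set T)) : set (set T) := \bigcup_k P k.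

(* X is the ambient space, carrying the trace of the sigma-algebra of T; the
   grids of the whole space are those with X = setT. *)
Record good_grid (X : set T) (P : nat -> set (set T)) : Prop := GoodGrid {
  grid_finite : forall k, finite_set (P k) ;
  grid_measurable : forall k Q, P k Q -> measurable Q ;
  grid_sub : forall k Q, P k Q -> Q `<=` X ;
  grid_pos : forall k Q, P k Q -> (0 < m Q)%E ;
  grid_cover : forall k, m (X `\` \bigcup_(Q in P k) Q) = 0%E ;
  grid_disjoint : forall k Q Q', P k Q -> P k Q' -> Q <> Q' ->
    m (Q `&` Q') = 0%E ;
  grid_nested : forall k Q, P k.+1 Q -> exists2 Q', P k Q' & Q `<=` Q' ;
  grid_generates : <<s X, cells P >> = [set A | measurable A /\ A `<=` X] ;
  grid_ratio : exists lam' lam : R, [/\ 0 < lam' < 1, 0 < lam < 1 &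
    forall k Q Q', P k.+1 Q -> P k Q' -> Q `<=` Q' ->
      lam' <= vol Q / vol Q' <= lam]
}.

(* The null set to be discarded from the space is the complement of the
   following set, which is the largest one on which every level of P is a
   genuine partition. *)
Definition regular_points (P : nat -> set (set T)) : set T :=
  [set x | forall k, exists! Q, P k Q /\ Q x].

Definition trace_grid (X : set T) (P : nat -> set (set T))
    : nat -> set (set T) :=
  fun k => [set Q `&` X | Q in P k].

(* Extended-real valued: it is +oo when no cell of P contains both points,
   which cannot occur for x, y in regular_points P if P 0 has one element. *)
Definition grid_dist (P : nat -> set (set T)) (x y : T) : \bar R :=
  ereal_inf [set m Q | Q in [set Q | [/\ cells P Q, Q x & Q y]]].

Definition maxvol (G : nat -> set (set T)) (k : nat) : R :=
  sup [set vol Q | Q in G k].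
Definition minvol (G : nat -> set (set T)) (k : nat) : R :=
  inf [set vol Q | Q in G k].

Definition recalibration (X : set T) (P G : nat -> set (set T)) : Prop :=
  [/\ good_grid X G,
      cells G `<=` cells P,
      forall k, maxvol G k.+1 < maxvol G k &
      exists th1 th2 dl : R,
        [/\ 0 < th1 < 1, 0 < th2 < 1, 0 < dl < 1 &
          forall k, th1 <= maxvol G k.+1 / maxvol G k <= th2 /\
                    1 <= maxvol G k / minvol G k <= dl^-1]].

(* Metric notions of the ambient space X with the distance rho. *)
Section Metric.
Variables (X : set T) (rho : T -> T -> \bar R).

Definition rball (x : T) (r : R) : set T :=
  [set y | X y /\ (rho x y < r%:E)%E].

Definition rdiam (A : set T) : \bar R :=
  ereal_sup [set rho x y | x in A & y in A].

Definition rdist (x : T) (A : set T) : \bar R :=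
  ereal_inf [set rho x y | y in A].

Definition quasi_triangle (C : R) : Prop :=
  forall x y z, X x -> X y -> X z ->
    (rho x y <= C%:E * (rho x z + rho z y))%E.

Record adapted_with (W : nat -> set (set T)) (z : set T -> T)
    (lam c1 c2 c3 c4 eta : R) : Prop := AdaptedWith {
  adapted_good : good_grid X W ;
  adapted_lam : 0 < lam < 1 ;
  adapted_constants : [/\ 0 < c1, 0 < c2, 0 < c3 & 0 < c4] ;
  adapted_eta : 0 < eta ;
  adapted_center : forall k Q, W k Q -> Q (z Q) ;
  adapted_inner : forall k Q, (0 < k)%N -> W k Q ->
    rball (z Q) (c1 * lam ^+ k) `<=` Q ;
  adapted_outer : forall k Q, (0 < k)%N -> W k Q ->
    (rdiam Q <= (c2 * lam ^+ k)%:E)%E ;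
  adapted_layer : forall k Q (t : R), (0 < k)%N -> W k Q -> 0 < t ->
    (m [set x | Q x /\ (rdist x (X `\` Q) <= (c3 * t * lam ^+ k)%:E)%E]
      <= (c4 * t `^ eta)%:E * m Q)%E
}.

Definition adapted (W : nat -> set (set T)) (eta : R) : Prop :=
  exists z lam c1 c2 c3 c4, adapted_with W z lam c1 c2 c3 c4 eta.

End Metric.
End Grids.

(* Spaces of functions are saturated sets of measurable representatives, so
   that equality of sets is equality of spaces of classes modulo m. *)
Section Spaces.
Context d (T : measurableType d) (R : realType).
Variable m : {measure set T -> \bar R}.
Implicit Types (f : T -> R[i]) (W G : nat -> set (set T)).

Definition modulus (w : R[i]) : R := Normc.normc w.

Definition Lpnorm (p : R) f : \bar R :=
  Lnorm m p%:E (fun x => (modulus (f x))%:E).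

Definition inLp (p : R) f : Prop :=
  [/\ measurable_fun setT (fun x => complex.Re (f x)),
      measurable_fun setT (fun x => complex.Im (f x)) &
      (Lpnorm p f < +oo)%E].

Definition lqnorm (q : \bar R) (u : nat -> \bar R) : \bar R :=
  Lnorm counting q u.

Definition level W (c : set T -> R[i]) (b : set T -> T -> R[i]) (k : nat)
    : T -> R[i] :=
  fun x => \sum_(Q \in W k) c Q * b Q x.

(* f is the sum of the series of the level k functions, which is absolutely
   convergent in L^p, and the coefficients are in l^q(l^p). *)
Definition expands W (p : R) (q : \bar R)
    (c : set T -> R[i]) (b : set T -> T -> R[i]) f : Prop :=
  [/\ inLp p f,
      (\sum_(0 <= k <oo) Lpnorm p (level W c b k) < +oo)%E,
      Lpnorm p (fun x => f x - \sum_(k < n) level W c b k x)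
        @[n --> \oo] --> (0 : \bar R)%E &
      (lqnorm q (fun k =>
         ((\sum_(Q \in W k) modulus (c Q) `^ p) `^ p^-1)%:E) < +oo)%E].

Definition atom (s p : R) (Q : set T) : T -> R[i] :=
  fun x => (vol m Q `^ (s - p^-1) * \1_Q x)%:C.

Definition grid_besov W (s p : R) (q : \bar R) : set (T -> R[i]) :=
  [set f | exists c, expands W p q c (atom s p) f].

Definition mean f (Q : set T) : R[i] :=
  ((\int[m]_(x in Q) complex.Re (f x)) / vol m Q)%R +i*
  ((\int[m]_(x in Q) complex.Im (f x)) / vol m Q)%R.

(* The value at x is mean f Q for the cell Q of G k containing x. *)
Definition martingale G f (k : nat) : T -> R[i] :=
  fun x => \sum_(Q \in G k) mean f Q * (\1_Q x)%:C.

Definition mdiff G f (k : nat) : T -> R[i] :=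
  fun x => martingale G f k x - (if k is j.+1 then martingale G f j x else 0).

Definition gt_besov G (s p : R) (q : \bar R) : set (T -> R[i]) :=
  [set f | inLp 1 f /\
    (lqnorm q (fun k => ((maxvol m G k `^ (- s))%:E
                         * Lpnorm p (mdiff G f k))%E) < +oo)%E].

(* Balls are subsets of X, so a block vanishes off X. The support needs no
   closure: rho is an ultrametric, whose balls are closed. *)
Definition block (X : set T) (rho : T -> T -> \bar R) (s p r : R)
    (Q : set T) (z : T) (a : T -> R[i]) : Prop :=
  [/\ forall x, a x <> 0 -> rball X rho z r x,
      forall x, X x -> modulus (a x) <= vol m Q `^ (s - p^-1) &
      forall x y, X x -> X y ->
        ((modulus (a x - a y))%:E
          <= (vol m Q `^ (s - p^-1 - 1))%:E * rho x y)%E].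

Definition hly_besov (X : set T) (rho : T -> T -> \bar R) W (z : set T -> T)
    (lam c2 Crho s p : R) (q : \bar R) : set (T -> R[i]) :=
  [set f | exists c a,
    (forall k Q, W k Q ->
      block X rho s p (3 * Crho * c2 * lam ^+ k) Q (z Q) (a Q)) /\
    expands W p q c a f].

End Spaces.

(* Main.v *)
Require Import Defs.
From HB Require Import structures.
From mathcomp Require Import all_boot all_order all_algebra.
From mathcomp Require Import finmap all_classical all_reals all_analysis.
From mathcomp Require Import complex measurable_realfun ess_sup_inf realfun.
From mathcomp Require Import ring lra.

Set Implicit Arguments.
Unset Strict Implicit.
Unset Printing Implicit Defensive.

Import Order.TTheory GRing.Theory Num.Theory.
Import numFieldTopology.Exports.
Local Open Scope classical_set_scope.
Local Open Scope ring_scope.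

(** The distance [rho] is an ultrametric whose balls are cells of the grid.
    The Gu-Taibleson norm measures the increments [d_k f] of the martingale
    of [f] along [G] at the scales [l_k].

    If [f] is a sum of molecules (atoms of an adapted grid, or blocks), then a
    molecule of scale [b] contributes to [d_k f] at most
    [min ((b / l_k)^s) ((l_k / b)^e)] times its coefficient, up to a constant:
    the first bound is the boundedness of conditional expectations, the
    second one comes from the layer condition, with [e = eta / p - s], or from
    the Lipschitz bound, with [e = 1 - s].  The kernel has bounded row and
    column sums, so it acts on l^q.

    Conversely, [d_k f] is constant on the balls of radius comparable to
    [l_k].  Grouping the increments according to the scales of another grid
    therefore writes [f] with the atoms of that grid, or with indicators of
    balls, which are blocks since points inside and outside of a ball of
    radius [r] are at distance at least [r].  The coefficients are controlled
    by the same kernel.  All spaces thus coincide with [gt_besov m G s p q]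
    for any one recalibration [G], for every [s < 1 / p]. *)

(** * Sequence spaces and geometric kernels *)

Section Sequences.
Context (R : realType).

(** The grids are not equally exact. [P], once traced on the regular points, and hence every
    recalibration consist of genuine partitions, so that cells are nested or disjoint and balls are
    cells; an adapted grid is a partition modulo null sets only, and its level 0 satisfies no metric
    condition. Level 0 is therefore controlled through finiteness and level 1 on one side, and
    receives zero coefficients on the other. A function of [gt_besov] is only assumed to lie in L^1.
    As [s > 0], the L^p norms of its increments are summable, and absolute convergence together with
    a pi-lambda argument replaces the martingale convergence theorem. The bound [s < 1 / p <= 1]
    enters for blocks: it makes [1 - s] positive and fixes the sign of the exponents of volumes. For
    atoms the gain comes from [eta > s * p]. Real and imaginary parts are estimated separately,
    whence constants such as 2, 4 and 8; only finiteness of norms is compared, so none of them has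
    to be sharp. Existence is settled by stopping the refinement of [P] at prescribed volumes, which
    gives one grid that is both a recalibration and adapted. *)

Lemma powR_le1 (x r : R) : 0 <= x <= 1 -> 0 <= r -> x `^ r <= 1.
Proof.
move=> /andP[x0 x1] r0; have -> : 1 = 1 `^ r :> R by rewrite powR1.
by rewrite ge0_ler_powR ?nnegrE.
Qed.

Lemma powR_lt1 (x r : R) : 0 <= x < 1 -> 0 < r -> x `^ r < 1.
Proof.
move=> /andP[x0 x1] r0; have -> : 1 = 1 `^ r :> R by rewrite powR1.
by rewrite gt0_ltr_powR ?nnegrE.
Qed.

Lemma finite_lower_bound (I : eqType) (D : set I) (v : I -> R) :
  finite_set D -> (forall i, D i -> 0 < v i) ->
  exists2 mu : R, 0 < mu & forall i, D i -> mu <= v i.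
Proof.
move=> /finite_seqP[l ->]; elim: l => [|i l IH] vpos; first by exists 1.
have [|mu mu0 muP] := IH.
  by move=> j jl; apply: vpos; rewrite /= in_cons; apply/orP; right.
exists (Num.min mu (v i)); first by rewrite lt_min mu0 vpos//= mem_head.
move=> j /=; rewrite in_cons => /orP[/eqP->|jl]; first by rewrite ge_min lexx
  orbT.
by rewrite ge_min muP.
Qed.

Lemma powRV (x r : R) : 0 <= x -> x^-1 `^ r = (x `^ r)^-1.
Proof. by move=> x0; rewrite -powR_inv1// -powRrM mulN1r powRN. Qed.

Lemma divr_itv01 (a b : R) : 0 < a -> a <= b -> 0 <= a / b <= 1.
Proof.
move=> a0 ab; have b0 := lt_le_trans a0 ab.
by rewrite ler_pdivrMr// mul1r ab andbT divr_ge0// ltW.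
Qed.

Lemma nneseries_le_ub (u : nat -> \bar R) (A : \bar R) :
  (forall n, 0 <= u n)%E -> (forall n, \sum_(0 <= k < n) u k <= A)%E ->
  (\sum_(0 <= k <oo) u k <= A)%E.
Proof.
move=> u0 uA; apply: lime_le; first exact: is_cvg_nneseries.
by apply: nearW => n; exact: uA.
Qed.

Lemma nneseries_ge_term (u : nat -> \bar R) k :
  (forall n, 0 <= u n)%E -> (u k <= \sum_(0 <= j <oo) u j)%E.
Proof.
move=> u0; apply: le_trans (nneseries_lim_ge k.+1 _) => //.
by rewrite big_nat_recr//= leeDr// sume_ge0.
Qed.

Lemma lqnormP (r : R) (u : nat -> \bar R) : 0 < r -> (forall k, 0 <= u k)%E ->
  (lqnorm r%:E u < +oo)%E <-> (\sum_(0 <= k <oo) u k `^ r < +oo)%E.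
Proof.
move=> r0 u0; rewrite /lqnorm Lnorm_counting//.
rewrite (eq_eseriesr (g := fun k => (u k `^ r)%E)); last first.
  by move=> k _; rewrite gee0_abs.
split; last exact: poweR_lty.
by apply: lty_poweRy; rewrite gt_eqF// invr_gt0.
Qed.

(** Singletons have counting measure 1, so an essential supremum for the counting measure bounds
    every term. *)
Lemma lqnormyP (u : nat -> \bar R) : (forall k, 0 <= u k)%E ->
  (lqnorm +oo%E u < +oo)%E <-> exists C : R, forall k, (u k <= C%:E)%E.
Proof.
move=> u0; rewrite /lqnorm unlock.
(* The unlocked sup norm is the essential supremum only under the test that the whole space has
   positive measure. *)
have c0 : (0 < @counting nat R [set: nat])%E.
  rewrite /counting; case: ifPn => // /asboolP fin.
  by have := infinite_nat => /(_ fin).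
rewrite c0; split.
  move=> h.
  have h0 : (0 <= ess_sup_inf.ess_sup (@counting nat R) (abse \o u))%E.
    by apply: ess_sup_inf.ess_sup_gee; [exact: c0|apply: aeW => k /=; exact:
      abse_ge0].
  exists (fine (ess_sup_inf.ess_sup (@counting nat R) (abse \o u))) => k.
  rewrite fineK ?ge0_fin_numE//.
  have [N [mN N0 NP]] := ess_sup_inf.ess_sup_ge (@counting nat R) (abse \o u).
  have := NP k; rewrite /= gee0_abs//; move=> H.
  rewrite leNgt; apply/negP => lt.
  have {}H : N k by apply: H; apply/negP; rewrite -ltNge.
  have : (@counting nat R [set k] <= @counting nat R N)%E.
    by apply: le_measure; rewrite ?inE// => ? ->.
  by rewrite N0 /counting asboolT//= fset_set1 /= cardfs1 lee_fin ler10.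
move=> [C uC]; apply: le_lt_trans (ltry C).
by apply/ess_sup_inf.ess_supP; apply: aeW => k /=; rewrite gee0_abs.
Qed.

(** l^q embeds in l^oo. The bound also makes the terms real numbers, which allows passing from
    extended reals to reals by [fine]. *)
Lemma lqnorm_bounded (q : \bar R) (u : nat -> \bar R) : (1 <= q)%E ->
  (forall k, 0 <= u k)%E -> (lqnorm q u < +oo)%E ->
  exists C : R, forall k, (u k <= C%:E)%E.
Proof.
case: q => [r||//] q1 u0; last by move/lqnormyP; exact.
have r0 : 0 < r by rewrite (lt_le_trans ltr01).
move/(lqnormP r0 u0) => h.
have h0 : (0 <= \sum_(0 <= k <oo) u k `^ r)%E.
  by apply: nneseries_ge0 => k _ _; exact: poweR_ge0.
exists (fine (\sum_(0 <= k <oo) u k `^ r)%E `^ r^-1) => k.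
rewrite -poweR_EFin fineK ?ge0_fin_numE//.
rewrite -[leLHS]poweRe1// -(mulfV (lt0r_neq0 r0)) poweRrM.
apply: gt0_ler_poweR; rewrite ?invr_ge0 ?(ltW r0)// ?in_itv/= ?leey ?andbT//.
  exact: poweR_ge0.
by apply: (@nneseries_ge_term (fun k => u k `^ r)%E) => n; exact: poweR_ge0.
Qed.

(* The kernel is the square of [K], so one factor bounds the supremum of the
   terms by an l^r sum and the other makes the sum over [j] finite. *)
Lemma schur_test (K : nat -> nat -> R) (A : R) (q : \bar R)
    (u v : nat -> \bar R) : (1 <= q)%E ->
  (forall k j, 0 <= K k j <= 1) ->
  (forall k, \sum_(0 <= j <oo) (K k j)%:E <= A%:E)%E ->
  (forall j, \sum_(0 <= k <oo) (K k j)%:E <= A%:E)%E ->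
  (forall k, 0 <= u k)%E -> (forall k, 0 <= v k)%E ->
  (forall k, v k <= \sum_(0 <= j <oo) (K k j ^+ 2)%:E * u j)%E ->
  (lqnorm q u < +oo)%E -> (lqnorm q v < +oo)%E.
Proof.
move=> q1 K01 Kr Kc u0 v0 vu uq.
have K0 k j : 0 <= K k j by case/andP: (K01 k j).
have K1 k j : K k j <= 1 by case/andP: (K01 k j).
have A0 : 0 <= A.
  by rewrite -lee_fin; apply: le_trans (Kr 0%N); apply: nneseries_ge0 => *;
    rewrite lee_fin.
have [C uC] := lqnorm_bounded q1 u0 uq.
pose x j := fine (u j).
have ux j : u j = (x j)%:E.
  by rewrite /x fineK// ge0_fin_numE// (le_lt_trans (uC j)) ?ltry.
have x0 j : 0 <= x j by rewrite -lee_fin -ux.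
have sup_bound k (t : R) : 0 <= t -> (forall j, K k j * x j <= t) ->
    (v k <= (A * t)%:E)%E.
  move=> t0 Kt; apply: (le_trans (vu k)).
  apply: (@le_trans _ _ (\sum_(0 <= j <oo) t%:E * (K k j)%:E)%E).
    apply: lee_nneseries => j _ => [_|].
      by rewrite mule_ge0// lee_fin exprn_ge0.
    rewrite ux -!EFinM lee_fin expr2 -mulrA mulrC ler_wpM2r//.
  rewrite nneseriesZl//.
    by rewrite EFinM muleC lee_wpmul2r// lee_fin.
  by move=> j _; rewrite lee_fin.
case: q q1 uq => [r||//] q1 uq; last first.
  apply/lqnormyP => //; exists (A * C) => k; apply: sup_bound => [|j].
    by rewrite -lee_fin; apply: le_trans (uC 0).
  rewrite -[leRHS]mul1r ler_pM//.
  by rewrite -lee_fin -ux.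
have r1 : 1 <= r by [].
have r0 : 0 < r by rewrite (lt_le_trans ltr01).
have /(lqnormP r0 u0) {}uq := uq; apply/(lqnormP r0 v0).
pose M k := (\sum_(0 <= j <oo) (K k j * x j `^ r)%:E)%E.
have M0 k : (0 <= M k)%E.
  by apply: nneseries_ge0 => j _ _; rewrite lee_fin mulr_ge0 ?powR_ge0.
have Moo k : (M k < +oo)%E.
  apply: le_lt_trans uq; apply: lee_nneseries => j _ => [_|].
    by rewrite lee_fin mulr_ge0 ?powR_ge0.
  by rewrite ux poweR_EFin lee_fin -[leRHS]mul1r ler_wpM2r// powR_ge0.
have vM k : (v k `^ r <= (A `^ r)%:E * M k)%E.
  have Mfin : M k = (fine (M k))%:E by rewrite fineK// ge0_fin_numE.
  have fM0 : 0 <= fine (M k) by rewrite fine_ge0.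
  (* The choice [t ^ r = M k] works because [K <= 1 <= r] gives [K ^ r <= K], so that
     [(K k j * x j) ^ r] is at most a single term of [M k]. *)
  have := sup_bound k (fine (M k) `^ r^-1) (powR_ge0 _ _).
  move=> H; have {}H : (v k <= (A * fine (M k) `^ r^-1)%:E)%E.
    apply: H => j.
    rewrite -[leLHS]powRr1 ?mulr_ge0// -[X in _ `^ X](mulfV (lt0r_neq0 r0)).
    rewrite powRrM ge0_ler_powR ?nnegrE ?powR_ge0 ?invr_ge0 ?(ltW r0)//.
    rewrite -lee_fin -Mfin.
    apply: le_trans (nneseries_ge_term j _); last first.
      by move=> n; rewrite lee_fin mulr_ge0 ?powR_ge0.
    rewrite lee_fin powRM// ler_wpM2r ?powR_ge0//.
    have [->|Kn0] := eqVneq (K k j) 0; first by rewrite powR0// gt_eqF.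
    by apply: ge1r_powR => //; rewrite lt0r Kn0 K0 K1.
  apply: (@le_trans _ _ (((A * fine (M k) `^ r^-1)%:E) `^ r)%E).
    apply: gt0_ler_poweR => //; rewrite ?(ltW r0)// ?in_itv/= ?leey ?andbT//.
    by rewrite lee_fin mulr_ge0 ?powR_ge0.
  rewrite poweR_EFin powRM ?powR_ge0// -powRrM mulVf ?gt_eqF// powRr1//.
  by rewrite EFinM -Mfin.
apply: (@le_lt_trans _ _ (\sum_(0 <= k <oo) (A `^ r)%:E * M k)%E).
  by apply: lee_nneseries => k _; rewrite ?poweR_ge0.
rewrite nneseriesZl; last by move=> k _.
apply: lte_mul_pinfty; rewrite ?lee_fin ?powR_ge0//.
(* Summing over [k] first leaves the column sums of [K], bounded by [A]. *)
rewrite nneseries_interchange; last first.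
  by move=> k j; rewrite lee_fin mulr_ge0 ?powR_ge0.
apply: (@le_lt_trans _ _ (\sum_(0 <= j <oo) A%:E * u j `^ r)%E).
  apply: lee_nneseries => j _ => [_|].
    by apply: nneseries_ge0 => k _ _; rewrite lee_fin mulr_ge0 ?powR_ge0.
  under eq_eseriesr do rewrite mulrC EFinM.
  rewrite nneseriesZl; last by move=> k _; rewrite lee_fin.
  by rewrite ux poweR_EFin muleC lee_wpmul2r// lee_fin powR_ge0.
rewrite nneseriesZl; last by move=> k _; exact: poweR_ge0.
by apply: lte_mul_pinfty => //; rewrite lee_fin.
Qed.

(** For positive exponents the minimum picks the factor whose base is at most 1. The kernel thus
    decays like a power of the ratio of the two scales on either side of the diagonal, without a
    case distinction in its definition. *)
Definition kern (s e a b : R) : R := Num.min ((b / a) `^ s) ((a / b) `^ e).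

Lemma kernC s e a b : kern s e a b = kern e s b a.
Proof. by rewrite /kern minC. Qed.

Lemma kern_ge0 s e a b : 0 <= kern s e a b.
Proof. by rewrite /kern le_min !powR_ge0. Qed.

Lemma kern_le1 s e a b : 0 < s -> 0 < e -> 0 < a -> 0 < b -> kern s e a b <= 1.
Proof.
move=> s0 e0 a0 b0; rewrite /kern ge_min.
have [ab|/ltW ba] := leP a b.
  rewrite [X in _ || X](_ : _ = true) ?orbT//.
  by rewrite powR_le1 ?(ltW e0)// divr_itv01.
rewrite [X in X || _](_ : _ = true)//.
by rewrite powR_le1 ?(ltW s0)// divr_itv01.
Qed.

(** Halving the exponents keeps the geometric decay and yields the square that [schur_test] asks
    for. *)
Lemma kern_sqr s e a b : 0 < s -> 0 < e -> 0 < a -> 0 < b ->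
  kern s e a b = kern (s / 2) (e / 2) a b ^+ 2.
Proof.
move=> s0 e0 a0 b0.
have h (z t : R) : 0 < t -> z `^ t = (z `^ (t / 2)) ^+ 2.
  by move=> t0; rewrite -powR_mulrn ?powR_ge0// -powRrM divfK// pnatr_eq0.
rewrite /kern (h _ s)// (h _ e)//.
set x := _ `^ _; set y := _ `^ _.
have [x0 y0] : 0 <= x /\ 0 <= y by rewrite !powR_ge0.
have [xy|/ltW yx] := leP x y.
  by rewrite min_l// ler_sqr.
by rewrite min_r// ler_sqr.
Qed.

(* Telescoping: the terms with [u j <= a] are dominated by the decrements of
   [min 1 (u j / a)^s], the others by the increments of
   [min th^-e (a / u j)^e]. *)
Lemma kern_series (u : nat -> R) (th s e : R) : 0 < th < 1 -> 0 < s -> 0 < e ->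
  (forall j, 0 < u j) -> (forall j, u j.+1 <= th * u j) ->
  exists A : R, forall a, 0 < a ->
    (\sum_(0 <= j <oo) (kern s e a (u j))%:E <= A%:E)%E.
Proof.
move=> /andP[th0 th1] s0 e0 u0 uth.
pose y1 := th `^ s; pose y2 := th `^ e.
have y1p : 0 < y1 by exact: powR_gt0.
have y2p : 0 < y2 by exact: powR_gt0.
have y11 : y1 < 1 by rewrite powR_lt1// (ltW th0).
have y21 : y2 < 1 by rewrite powR_lt1// (ltW th0).
pose C1 := (1 - y1)^-1; pose C2 := (y2^-1 - 1)^-1.
have C10 : 0 < C1 by rewrite invr_gt0 subr_gt0.
have C20 : 0 < C2 by rewrite invr_gt0 subr_gt0 invf_gt1.
(* The two telescoping sums have totals at most 1 and [y2^-1]; [C1] and [C2] convert a term of the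
   series into a decrement or an increment. *)
exists (C1 + C2 * y2^-1) => a a0.
apply: nneseries_le_ub => [j|n]; first by rewrite lee_fin kern_ge0.
pose w j := (u j / a) `^ s; pose y j := (a / u j) `^ e.
(* The cap of [phi] exceeds 1 so that the last index with [u j > a], after which [y] may be larger
   than 1, still gives an increment of at least [(y2^-1 - 1) * y j]. *)
pose psi j := Num.min 1 (w j); pose phi j := Num.min y2^-1 (y j).
have w0 j : 0 <= w j by exact: powR_ge0.
have y0 j : 0 <= y j by exact: powR_ge0.
have th0' := ltW th0; have s0' := ltW s0; have e0' := ltW e0.
have q0 j : 0 <= u j / a by rewrite divr_ge0 ?(ltW (u0 j)) ?(ltW a0).
have r0 j : 0 <= a / u j by rewrite divr_ge0 ?(ltW (u0 j)) ?(ltW a0).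
have wS j : w j.+1 <= y1 * w j.
  rewrite /w /y1 -powRM// ge0_ler_powR ?nnegrE ?(mulr_ge0 th0' (q0 _))//.
  by rewrite mulrA ler_wpM2r// invr_ge0 (ltW a0).
have yS j : y j <= y2 * y j.+1.
  rewrite /y /y2 -powRM// ge0_ler_powR ?nnegrE ?(mulr_ge0 th0' (r0 _))//.
  rewrite mulrCA ler_wpM2l ?(ltW a0)// ler_pdivlMr//.
  by rewrite mulrC ler_pdivrMr.
have key j : kern s e a (u j) <= C1 * (psi j - psi j.+1) + C2 * (phi j.+1 - phi
  j).
  have d1 : 0 <= psi j - psi j.+1.
    rewrite subr_ge0 /psi le_min ge_min lexx/= ge_min (le_trans (wS j)) ?orbT//.
    by rewrite -[leRHS]mul1r ler_wpM2r// ltW.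
  have d2 : 0 <= phi j.+1 - phi j.
    rewrite subr_ge0 /phi le_min ge_min lexx/= ge_min (le_trans (yS j)) ?orbT//.
    by rewrite -[leRHS]mul1r ler_wpM2r// ltW.
  have [ua|au] := leP (u j) a.
    apply: (@le_trans _ _ (C1 * (psi j - psi j.+1))); last first.
      by rewrite lerDl mulr_ge0// ltW.
    apply: (@le_trans _ _ (w j)); first by rewrite /kern ge_min lexx.
    have w1 : w j <= 1.
      by rewrite powR_le1 ?(ltW s0)// divr_itv01.
    rewrite /C1 mulrC ler_pdivlMr ?subr_gt0// /psi (min_r w1).
    rewrite mulrBr mulr1 lerB// ge_min; apply/orP; right.
    by rewrite mulrC.
  apply: (@le_trans _ _ (C2 * (phi j.+1 - phi j))); last first.
    by rewrite lerDr mulr_ge0// ltW.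
  apply: (@le_trans _ _ (y j)); first by rewrite /kern ge_min lexx orbT.
  have y1' : y j <= 1.
    by rewrite powR_le1 ?(ltW e0)// divr_itv01// ltW.
  have yy : y j <= y2^-1 by rewrite (le_trans y1')// ltW// invf_gt1.
  rewrite /C2 mulrC ler_pdivlMr ?subr_gt0 ?invf_gt1// /phi (min_r yy).
  rewrite mulrBr mulr1 lerB// le_min -[leRHS]mul1r ler_wpM2r ?invr_ge0 ?(ltW
    y2p)//=.
  by rewrite ler_pdivrMr// mulrC.
rewrite sumEFin lee_fin (le_trans (ler_sum _ (fun j _ => key j)))//.
rewrite big_split/= -!mulr_sumr.
have -> : \sum_(0 <= i < n) (psi i - psi i.+1) = psi 0%N - psi n.
  by rewrite -[RHS]opprB -(telescope_sumr psi)// -sumrN; apply: eq_bigr => i _;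
    rewrite opprB.
rewrite telescope_sumr// lerD//.
  rewrite -[leRHS]mulr1 ler_wpM2l ?(ltW C10)// lerBlDr (@le_trans _ _ 1)//.
    by rewrite /psi ge_min lexx.
  by rewrite lerDl /psi le_min ler01 w0.
rewrite ler_wpM2l ?(ltW C20)// lerBlDr (@le_trans _ _ y2^-1)//.
  by rewrite /phi ge_min lexx.
by rewrite lerDl /phi le_min y0 invr_ge0 ltW.
Qed.

Lemma lqnormZ_lty (q : \bar R) (C : R) (u : nat -> \bar R) : (1 <= q)%E ->
  0 <= C -> (forall k, 0 <= u k)%E -> (lqnorm q u < +oo)%E ->
  (lqnorm q (fun k => C%:E * u k) < +oo)%E.
Proof.
move=> q1 C0 u0; have Cu0 k : (0 <= C%:E * u k)%E by rewrite mule_ge0.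
case: q q1 => [r||//] q1; last first.
  move=> /(lqnormyP u0)[A uA]; apply/(lqnormyP Cu0); exists (C * A) => k.
  by rewrite EFinM lee_wpmul2l.
have r0 : 0 < r by rewrite (lt_le_trans ltr01).
move=> /(lqnormP r0 u0) uoo; apply/(lqnormP r0 Cu0).
under eq_eseriesr do rewrite poweRM// poweR_EFin.
rewrite nneseriesZl; last by move=> k _; exact: poweR_ge0.
by apply: lte_mul_pinfty; rewrite ?lee_fin ?powR_ge0.
Qed.

(** Rows are summed along the scale [b] and columns along the scale [a], the two roles being
    exchanged by [kernC]; the constant [C] is absorbed in [u]. *)
Lemma kern_lq (a b : nat -> R) (tha thb s e C : R) (q : \bar R)
    (u v : nat -> \bar R) : (1 <= q)%E -> 0 < s -> 0 < e -> 0 <= C ->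
  0 < tha < 1 -> (forall k, 0 < a k) -> (forall k, a k.+1 <= tha * a k) ->
  0 < thb < 1 -> (forall j, 0 < b j) -> (forall j, b j.+1 <= thb * b j) ->
  (forall k, 0 <= u k)%E -> (forall k, 0 <= v k)%E ->
  (forall k, v k <= \sum_(0 <= j <oo) (C * kern s e (a k) (b j))%:E * u j)%E ->
  (lqnorm q u < +oo)%E -> (lqnorm q v < +oo)%E.
Proof.
move=> q1 s0 e0 C0 tha01 a0 aS thb01 b0 bS u0 v0 vu uq.
have s20 : 0 < s / 2 by rewrite divr_gt0.
have e20 : 0 < e / 2 by rewrite divr_gt0.
have [A1 A1P] := kern_series thb01 s20 e20 b0 bS.
have [A2 A2P] := kern_series tha01 e20 s20 a0 aS.
apply: (@schur_test (fun k j => kern (s / 2) (e / 2) (a k) (b j))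
  (Num.max A1 A2) q (fun k => C%:E * u k)%E) => //.
- by move=> k j; rewrite kern_ge0 kern_le1.
- by move=> k; apply: le_trans (A1P _ (a0 k)) _; rewrite lee_fin le_max lexx.
- move=> j; under eq_eseriesr do rewrite kernC.
  by apply: le_trans (A2P _ (b0 j)) _; rewrite lee_fin le_max lexx orbT.
- by move=> k; rewrite mule_ge0.
- move=> k; under eq_eseriesr do rewrite -kern_sqr// muleA -EFinM (mulrC _ C).
  exact: vu.
- exact: lqnormZ_lty.
Qed.

End Sequences.

(** * Complex-valued functions in L^p *)

Section Modulus.
Context (R : realType).
Implicit Types z w : R[i].

Lemma modulus_ge0 z : 0 <= modulus z.
Proof. by case: z => a b; exact: sqrtr_ge0. Qed.

Lemma modulus0 : modulus (0 : R[i]) = 0.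
Proof. exact: Normc.normc0. Qed.

Lemma modulus_eq0 z : modulus z = 0 -> z = 0.
Proof. exact: Normc.eq0_normc. Qed.

Lemma modulusM z w : modulus (z * w) = modulus z * modulus w.
Proof. exact: Normc.normcM. Qed.

Lemma modulusD z w : modulus (z + w) <= modulus z + modulus w.
Proof. exact: le_normcD. Qed.

Lemma modulusN z : modulus (- z) = modulus z.
Proof. exact: normcN. Qed.

Lemma modulus_real (x : R) : modulus (x%:C)%C = `|x|.
Proof. by rewrite /modulus /Normc.normc /= expr0n addr0 sqrtr_sqr. Qed.

Lemma Re_le_modulus z : `|complex.Re z| <= modulus z.
Proof.
case: z => a b /=; rewrite /modulus /Normc.normc -sqrtr_sqr ler_wsqrtr//.
by rewrite lerDl sqr_ge0.
Qed.

Lemma Im_le_modulus z : `|complex.Im z| <= modulus z.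
Proof.
case: z => a b /=; rewrite /modulus /Normc.normc -sqrtr_sqr ler_wsqrtr//.
by rewrite lerDr sqr_ge0.
Qed.

Lemma modulus_le z : modulus z <= `|complex.Re z| + `|complex.Im z|.
Proof.
case: z => a b /=; rewrite /modulus /Normc.normc.
rewrite -[leRHS]ger0_norm ?addr_ge0// -sqrtr_sqr ler_wsqrtr// sqrrD !real_normK
  ?num_real//.
by rewrite lerD2r lerDl mulrn_wge0 ?mulr_ge0.
Qed.

Lemma modulus_sum (I : Type) (s : seq I) (F : I -> R[i]) :
  modulus (\sum_(i <- s) F i) <= \sum_(i <- s) modulus (F i).
Proof.
elim: s => [|i s IH]; first by rewrite !big_nil modulus0.
by rewrite !big_cons (le_trans (modulusD _ _))// lerD2l.
Qed.

Lemma complex_eqP z w :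
  complex.Re z = complex.Re w -> complex.Im z = complex.Im w -> z = w.
Proof. by case: z w => a b [c e] /= -> ->. Qed.

Lemma ReD z w : complex.Re (z + w) = complex.Re z + complex.Re w.
Proof. by case: z w => a b []. Qed.
Lemma ImD z w : complex.Im (z + w) = complex.Im z + complex.Im w.
Proof. by case: z w => a b []. Qed.
Lemma ReB z w : complex.Re (z - w) = complex.Re z - complex.Re w.
Proof. by case: z w => a b []. Qed.
Lemma ImB z w : complex.Im (z - w) = complex.Im z - complex.Im w.
Proof. by case: z w => a b []. Qed.
Lemma ReM z w : complex.Re (z * w) =
  complex.Re z * complex.Re w - complex.Im z * complex.Im w.
Proof. by case: z w => a b []. Qed.
Lemma ImM z w : complex.Im (z * w) =
  complex.Re z * complex.Im w + complex.Im z * complex.Re w.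
Proof. by case: z w => a b []. Qed.

(* Convexity would give the constant [N^(p-1)], which is not needed. *)
Lemma powR_sum_overlap (I : Type) (s : seq I) (a : I -> R) (e : I -> bool)
    (N p : R) : 0 < p -> (forall i, 0 <= a i) -> (forall i, ~~ e i -> a i = 0)
      ->
  \sum_(i <- s) (e i)%:R <= N ->
  (\sum_(i <- s) a i) `^ p <= N `^ p * \sum_(i <- s) a i `^ p.
Proof.
move=> p0 a0 ae eN.
have N0 : 0 <= N by rewrite (le_trans _ eN)// sumr_ge0.
pose S := \sum_(i <- s) a i `^ p.
have S0 : 0 <= S by rewrite sumr_ge0// => i _; exact: powR_ge0.
(* Each [a i] is at most [S ^ (1/p)], and [e] counts the terms that can be nonzero. *)
have : \sum_(i <- s) a i <= N * S `^ p^-1.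
  apply: (@le_trans _ _ (\sum_(i <- s) (e i)%:R * S `^ p^-1)); last first.
    by rewrite -mulr_suml ler_wpM2r ?powR_ge0.
  have ap : forall i, a i = (a i `^ p) `^ p^-1.
    by move=> i; rewrite -powRrM mulfV ?gt_eqF// powRr1.
  rewrite /S; clear S S0 eN; elim: s => [|i s IH]; first by rewrite !big_nil.
  rewrite !big_cons; apply: lerD.
    case: (boolP (e i)) => ei; last by rewrite ae// mul0r.
    rewrite mul1r {1}ap ge0_ler_powR ?invr_ge0 ?(ltW p0) ?nnegrE ?powR_ge0//.
      by rewrite addr_ge0 ?powR_ge0// sumr_ge0// => j _; exact: powR_ge0.
    by rewrite lerDl sumr_ge0// => j _; exact: powR_ge0.
  apply: (le_trans IH); apply: ler_sum => j _; rewrite ler_wpM2l//.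
  have h0 : 0 <= \sum_(j0 <- s) a j0 `^ p.
    by rewrite sumr_ge0// => k _; exact: powR_ge0.
  rewrite ge0_ler_powR ?invr_ge0 ?(ltW p0) ?nnegrE ?addr_ge0 ?powR_ge0//.
  by rewrite lerDr powR_ge0.
move=> /(ge0_ler_powR (ltW p0)).
rewrite !nnegrE => /(_ (sumr_ge0 _ (fun i _ => a0 i)) (mulr_ge0 N0 (powR_ge0 _
  _))).
by rewrite powRM ?powR_ge0// -powRrM mulVf ?gt_eqF// powRr1.
Qed.

End Modulus.

(** * The L^p norm: Minkowski inequalities and finite overlap *)

Section Lp.
Context d (T : measurableType d) (R : realType).
Variable m : {measure set T -> \bar R}.
Implicit Types (f g h : T -> R[i]).

Definition cmeas f : Prop :=
  measurable_fun setT (fun x => complex.Re (f x)) /\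
  measurable_fun setT (fun x => complex.Im (f x)).

Lemma measurable_modulus f : cmeas f ->
  measurable_fun setT (fun x => modulus (f x)).
Proof.
move=> [mR mI].
have -> : (fun x => modulus (f x)) =
    (fun x => Num.sqrt (complex.Re (f x) ^+ 2 + complex.Im (f x) ^+ 2)).
  by apply/funext => x; case: (f x).
apply: (@measurableT_comp _ _ _ _ _ _ (@Num.sqrt R)) => //.
  by apply: continuous_measurable_fun; exact: sqrt_continuous.
by apply: measurable_funD; exact: measurable_funX.
Qed.

Lemma measurable_modulusp p f : cmeas f ->
  measurable_fun setT (fun x => (modulus (f x) `^ p)%:E).
Proof.
move=> cf; apply/measurable_EFinP.
apply: (@measurableT_comp _ _ _ _ _ _ (@powR R ^~ p)) => //.
exact: measurable_modulus.
Qed.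

Lemma cmeasD f g : cmeas f -> cmeas g -> cmeas (fun x => f x + g x).
Proof.
move=> [f1 f2] [g1 g2]; split.
  by under eq_fun do rewrite ReD; exact: measurable_funD.
by under eq_fun do rewrite ImD; exact: measurable_funD.
Qed.

Lemma cmeasB f g : cmeas f -> cmeas g -> cmeas (fun x => f x - g x).
Proof.
move=> [f1 f2] [g1 g2]; split.
  by under eq_fun do rewrite ReB; exact: measurable_funB.
by under eq_fun do rewrite ImB; exact: measurable_funB.
Qed.

Lemma cmeasM f g : cmeas f -> cmeas g -> cmeas (fun x => f x * g x).
Proof.
move=> [f1 f2] [g1 g2]; split.
  under eq_fun do rewrite ReM.
  by apply: measurable_funB; exact: measurable_funM.
under eq_fun do rewrite ImM.
by apply: measurable_funD; exact: measurable_funM.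
Qed.

Lemma cmeas_cst (z : R[i]) : cmeas (fun=> z).
Proof. by split; exact: measurable_cst. Qed.

Lemma cmeas_real (u : T -> R) : measurable_fun setT u ->
  cmeas (fun x => (u x)%:C%C).
Proof. by move=> mu; split => //=; exact: measurable_cst. Qed.

Lemma cmeas_sum (I : Type) (s : seq I) (F : I -> T -> R[i]) :
  (forall i, cmeas (F i)) -> cmeas (fun x => \sum_(i <- s) F i x).
Proof.
move=> mF; elim: s => [|i s IH].
  by under eq_fun do rewrite big_nil; exact: cmeas_cst.
by under eq_fun do rewrite big_cons; exact: cmeasD.
Qed.

Lemma Lpnorm_ge0 p f : (0 <= Lpnorm m p f)%E.
Proof. exact: Lnorm_ge0. Qed.
Hint Resolve Lpnorm_ge0 : core.

Lemma Lpnorm_powE p f : p != 0 ->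
  (Lpnorm m p f `^ p = \int[m]_x (modulus (f x) `^ p)%:E)%E.
Proof.
move=> p0; rewrite /Lpnorm (poweR_Lnorm _ _ p0); apply: eq_integral => x _.
by rewrite abse_EFin poweR_EFin ger0_norm ?modulus_ge0.
Qed.

Lemma lee_poweR (p : R) (a b : \bar R) : 0 < p ->
  (0 <= a)%E -> (0 <= b)%E -> (a `^ p <= b `^ p)%E = (a <= b)%E.
Proof.
move=> p0 a0 b0; apply/idP/idP => [|ab]; last first.
  by apply: gt0_ler_poweR; rewrite ?(ltW p0)// in_itv/= leey andbT.
move=> H; rewrite -[a]poweRe1// -[b]poweRe1// -(mulfV (lt0r_neq0 p0)) !poweRrM.
apply: gt0_ler_poweR => //; rewrite ?in_itv/= ?leey ?andbT ?poweR_ge0//.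
by rewrite invr_ge0 ltW.
Qed.

Lemma Lpnorm_le p f g : 0 < p -> cmeas f -> cmeas g ->
  {ae m, forall x, modulus (f x) <= modulus (g x)} ->
  (Lpnorm m p f <= Lpnorm m p g)%E.
Proof.
move=> p0 cf cg fg; have pn0 := lt0r_neq0 p0.
rewrite -(lee_poweR p0)// (Lpnorm_powE f pn0) (Lpnorm_powE g pn0).
apply: ae_ge0_le_integral => //; try exact: measurable_modulusp.
- by move=> x _; rewrite lee_fin powR_ge0.
- by move=> x _; rewrite lee_fin powR_ge0.
apply: filterS fg => x fg _.
by rewrite lee_fin ge0_ler_powR ?nnegrE ?modulus_ge0 ?(ltW p0).
Qed.

Lemma Lpnorm_eq p f g : 0 < p -> cmeas f -> cmeas g ->
  {ae m, forall x, f x = g x} -> Lpnorm m p f = Lpnorm m p g.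
Proof.
move=> p0 cf cg fg; apply/eqP; rewrite eq_le !Lpnorm_le//.
  by apply: filterS fg => x ->.
by apply: filterS fg => x ->.
Qed.

Lemma Lpnorm_triangle p f g : 1 <= p -> cmeas f -> cmeas g ->
  (Lpnorm m p (fun x => (f x + g x)%R) <= Lpnorm m p f + Lpnorm m p g)%E.
Proof.
move=> p1 cf cg; have p0 : 0 < p by rewrite (lt_le_trans ltr01).
have mf := measurable_modulus cf; have mg := measurable_modulus cg.
apply: le_trans (minkowski_EFin m mf mg p1).
have pn0 := lt0r_neq0 p0.
rewrite -(lee_poweR p0) ?Lnorm_ge0// (Lpnorm_powE _ pn0) (poweR_Lnorm _ _ pn0).
apply: ge0_le_integral => //.
- by move=> x _; rewrite lee_fin powR_ge0.
- by apply: measurable_modulusp; exact: cmeasD.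
- under eq_fun do rewrite abse_EFin poweR_EFin.
  apply/measurable_EFinP.
  apply: (@measurableT_comp _ _ _ _ _ _ (@powR R ^~ p)) => //.
  by apply: measurableT_comp => //; exact: measurable_funD.
- move=> x _; rewrite abse_EFin poweR_EFin lee_fin /=.
  rewrite ger0_norm ?addr_ge0 ?modulus_ge0//.
  by rewrite ge0_ler_powR ?nnegrE ?addr_ge0 ?modulus_ge0 ?modulusD ?(ltW p0).
Qed.

Lemma Lpnorm0 p : 0 < p -> Lpnorm m p (fun=> 0) = 0%E.
Proof.
move=> p0; rewrite /Lpnorm.
by under eq_Lnorm do rewrite modulus0; rewrite (@Lnorm0 _ _ _ m p%:E)// eqe
  gt_eqF.
Qed.

Lemma LpnormN p f : Lpnorm m p (fun x => - f x) = Lpnorm m p f.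
Proof. by apply: eq_Lnorm => x; rewrite modulusN. Qed.

Lemma Lpnorm_triangleB p f g : 1 <= p -> cmeas f -> cmeas g ->
  (Lpnorm m p (fun x => (f x - g x)%R) <= Lpnorm m p f + Lpnorm m p g)%E.
Proof.
move=> p1 cf cg; rewrite -[X in (_ + X)%E]LpnormN; apply: Lpnorm_triangle => //.
have := cmeasB (cmeas_cst 0) cg.
by under eq_fun do rewrite sub0r.
Qed.

Lemma LpnormZ p (z : R[i]) f : 0 < p -> cmeas f ->
  Lpnorm m p (fun x => z * f x) = ((modulus z)%:E * Lpnorm m p f)%E.
Proof.
move=> p0 cf; have pn0 : p != 0 by rewrite gt_eqF.
have z0 := modulus_ge0 z.
suff : (Lpnorm m p (fun x => (z * f x)%R) `^ p =
        ((modulus z)%:E * Lpnorm m p f) `^ p)%E.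
  move=> H; have zf0 : (0 <= (modulus z)%:E * Lpnorm m p f)%E.
    by rewrite mule_ge0 ?lee_fin.
  by apply/eqP; rewrite eq_le -(lee_poweR p0)// H lexx/= -(lee_poweR p0)// H.
rewrite poweRM// (Lpnorm_powE _ pn0) (Lpnorm_powE f pn0) poweR_EFin
  -ge0_integralZl_EFin//.
- by apply: eq_integral => x _; rewrite modulusM powRM ?modulus_ge0// EFinM.
- by move=> x _; rewrite lee_fin powR_ge0.
- exact: measurable_modulusp.
- exact: powR_ge0.
Qed.

Lemma Lpnorm_sum p (I : Type) (s : seq I) (F : I -> T -> R[i]) : 1 <= p ->
  (forall i, cmeas (F i)) ->
  (Lpnorm m p (fun x => (\sum_(i <- s) F i x)%R) <=
   \sum_(i <- s) Lpnorm m p (F i))%E.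
Proof.
move=> p1 cF; have p0 : 0 < p by rewrite (lt_le_trans ltr01).
elim: s => [|i s IH].
  by rewrite big_nil; under eq_fun do rewrite big_nil; rewrite Lpnorm0.
rewrite big_cons; under eq_fun do rewrite big_cons.
apply: le_trans (Lpnorm_triangle p1 (cF i) (cmeas_sum s cF)) _.
exact: leeD.
Qed.

(** Countable Minkowski inequality under an a.e. pointwise domination: the partial sums of the
    moduli are bounded in L^p by the finite triangle inequality, and monotone convergence applies to
    their p-th powers. *)
Lemma Lpnorm_series p f (h : nat -> T -> R[i]) : 1 <= p -> cmeas f ->
  (forall k, cmeas (h k)) ->
  {ae m, forall x, ((modulus (f x))%:E <=
                    \sum_(0 <= k <oo) (modulus (h k x))%:E)%E} ->
  (Lpnorm m p f <= \sum_(0 <= k <oo) Lpnorm m p (h k))%E.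
Proof.
move=> p1 cf ch fh; have p0 : 0 < p by rewrite (lt_le_trans ltr01).
pose S n x := \sum_(0 <= k < n) modulus (h k x).
have S0 n x : 0 <= S n x by rewrite sumr_ge0// => k _; exact: modulus_ge0.
have SS x : {homo S^~ x : n k / (n <= k)%N >-> n <= k}.
  move=> n k nk; rewrite /S [leRHS](big_cat_nat (n := n))//= lerDl sumr_ge0//
    => i _.
  exact: modulus_ge0.
have cS n : cmeas (fun x => (S n x)%:C%C).
  apply: cmeas_real; apply: measurable_sum => k; exact: measurable_modulus.
set B := (\sum_(0 <= k <oo) _)%E.
have B0 : (0 <= B)%E by apply: nneseries_ge0.
have SB n : (Lpnorm m p (fun x => (S n x)%:C%C) <= B)%E.
  apply: (@le_trans _ _ (\sum_(0 <= k < n) Lpnorm m p (h k))%E); last first.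
    exact: nneseries_lim_ge.
  apply: le_trans (_ : (Lpnorm m p (fun x => \sum_(0 <= k < n) (modulus (h k
    x))%:C%C)%R <= _)%E); last first.
    apply: le_trans (Lpnorm_sum _ _ _) _ => //.
      by move=> k; apply: cmeas_real; exact: measurable_modulus.
    apply: lee_sum => k _; apply: Lpnorm_le => //.
      by apply: cmeas_real; exact: measurable_modulus.
    by apply: aeW => x; rewrite modulus_real ger0_norm ?modulus_ge0.
  by under eq_fun do rewrite /S rmorph_sum.
have pn0 := lt0r_neq0 p0.
rewrite -(lee_poweR p0)// (Lpnorm_powE f pn0).
pose g n x := (S n x `^ p)%:E.
have mg n : measurable_fun setT (g n).
  rewrite [g n](_ : _ = fun x => (modulus (S n x)%:C%C `^ p)%:E).
    exact: measurable_modulusp.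
  by apply/funext => x; rewrite modulus_real ger0_norm.
have g0 n x : setT x -> (0 <= g n x)%E by rewrite lee_fin powR_ge0.
have gS x : setT x -> {homo g^~ x : n k / (n <= k)%N >-> (n <= k)%E}.
  by move=> _ n k nk; rewrite lee_fin ge0_ler_powR ?nnegrE ?(ltW p0)// SS.
apply: (@le_trans _ _ (\int[m]_x limn (g^~ x))%E).
  apply: ae_ge0_le_integral => //.
  - by move=> x _; rewrite lee_fin powR_ge0.
  - exact: measurable_modulusp.
  - by move=> x _; apply: lime_ge; [exact: ereal_nondecreasing_is_cvgn (gS x
    I)|apply: nearW => n; exact: g0].
  - by apply: (emeasurable_fun_cvg g) => // x _; exact:
    ereal_nondecreasing_is_cvgn (gS x I).
  apply: filterS fh => x + _.
  have gl n : (g n x <= limn (g^~ x))%E.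
    rewrite (cvg_lim _ (ereal_nondecreasing_cvgn (gS x I)))//.
    by apply: ereal_sup_ubound; exists n.
  have L0 : (0 <= limn (g^~ x))%E by apply: le_trans (gl 0%N); exact: g0.
  move=> H; have : ((modulus (f x))%:E <= limn (g^~ x) `^ p^-1)%E.
    apply: (le_trans H); apply: nneseries_le_ub => [n|n]; first by rewrite
      lee_fin modulus_ge0.
    rewrite sumEFin -[leLHS]poweRe1; last by rewrite lee_fin; exact: S0.
    rewrite -(mulfV (lt0r_neq0 p0)) poweRrM.
    rewrite lee_poweR ?invr_gt0 ?poweR_ge0//.
    by rewrite poweR_EFin; exact: gl.
  by rewrite -(lee_poweR p0) ?lee_fin ?modulus_ge0 ?poweR_ge0// -poweRrM mulVf
    ?gt_eqF// poweRe1.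
rewrite monotone_convergence//.
apply: lime_le.
  apply: ereal_nondecreasing_is_cvgn => n k nk; apply: ge0_le_integral => // x
    xT.
    exact: g0.
  exact: gS.
apply: nearW => n; apply: le_trans (_ : (Lpnorm m p (fun x => (S n x)%:C%C) `^
  p <= _)%E).
  rewrite (Lpnorm_powE _ pn0); under [leRHS]eq_integral do rewrite modulus_real
    ger0_norm//.
  by [].
by rewrite lee_poweR.
Qed.

(** At almost every point at most [N] terms are nonzero, so the p-th power of the sum is controlled
    by the sum of the p-th powers, and the latter is integrated term by term. This replaces
    disjointness of supports, which blocks of one level need not have. *)
Lemma Lpnorm_overlap p (I : Type) (s : seq I) (c : I -> R[i])
    (F : I -> T -> R[i]) (e : I -> T -> bool) (N M : R) : 0 < p -> 0 <= M ->
  (forall i, cmeas (F i)) -> (forall i, (Lpnorm m p (F i) <= M%:E)%E) ->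
  {ae m, forall x, (forall i, ~~ e i x -> F i x = 0) /\
                   \sum_(i <- s) (e i x)%:R <= N} ->
  0 <= N ->
  (Lpnorm m p (fun x => (\sum_(i <- s) c i * F i x)%R) <=
   (N * M * (\sum_(i <- s) modulus (c i) `^ p) `^ p^-1)%:E)%E.
Proof.
move=> p0 M0 cF FM ov N0; have pn0 := lt0r_neq0 p0.
have cZ i : cmeas (fun x => c i * F i x) by apply: cmeasM => //; exact:
  cmeas_cst.
have S0 : 0 <= \sum_(i <- s) modulus (c i) `^ p.
  by rewrite sumr_ge0// => i _; exact: powR_ge0.
rewrite -(lee_poweR p0) ?lee_fin ?mulr_ge0 ?powR_ge0// (Lpnorm_powE _ pn0).
rewrite poweR_EFin powRM ?mulr_ge0 ?powR_ge0// -powRrM mulVf ?gt_eqF// powRr1//.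
apply: (@le_trans _ _ (\int[m]_x ((N `^ p)%:E * \sum_(i <- s) (modulus (c i * F
  i x) `^ p)%:E))%E).
  apply: ae_ge0_le_integral => //.
  - by move=> x _; rewrite lee_fin powR_ge0.
  - by apply: measurable_modulusp; exact: cmeas_sum.
  - by move=> x _; rewrite sumEFin -EFinM lee_fin mulr_ge0 ?powR_ge0//
    sumr_ge0// => i _; exact: powR_ge0.
  - apply: emeasurable_funM; first exact: measurable_cst.
    by apply: emeasurable_sum => i; exact: measurable_modulusp.
  apply: filterS ov => x [Fe eN] _.
  rewrite sumEFin -EFinM lee_fin.
  apply: le_trans (powR_sum_overlap (e := e^~ x) p0 _ _ eN).
  - by rewrite ge0_ler_powR ?nnegrE ?(ltW p0) ?modulus_ge0 ?modulus_sum
    ?sumr_ge0// => i _; exact: modulus_ge0.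
  - by move=> i; exact: modulus_ge0.
  - by move=> i /Fe ->; rewrite mulr0 modulus0.
rewrite ge0_integralZl_EFin ?powR_ge0//; last 2 first.
- by move=> x _; rewrite sume_ge0// => i _; rewrite lee_fin powR_ge0.
- by apply: emeasurable_sum => i; exact: measurable_modulusp.
rewrite powRM// -mulrA EFinM lee_wpmul2l ?lee_fin ?powR_ge0//.
rewrite ge0_integral_sum//; last 2 first.
- by move=> i; exact: measurable_modulusp.
- by move=> i x _; rewrite lee_fin powR_ge0.
rewrite mulr_sumr -sumEFin; apply: lee_sum => i _.
rewrite -(Lpnorm_powE _ pn0) LpnormZ// poweRM ?lee_fin ?modulus_ge0//.
rewrite poweR_EFin EFinM muleC lee_wpmul2r ?lee_fin ?powR_ge0//.
by rewrite -poweR_EFin lee_poweR ?lee_fin.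
Qed.

(** Sets outside the level carry no information; the functions attached to them are replaced by
    0. *)
Lemma Lpnorm_overlap_in p (I : eqType) (s : seq I) (c : I -> R[i])
    (F : I -> T -> R[i]) (e : I -> T -> bool) (N M : R) : 0 < p -> 0 <= M ->
  (forall i, i \in s -> cmeas (F i)) ->
  (forall i, i \in s -> (Lpnorm m p (F i) <= M%:E)%E) ->
  {ae m, forall x, (forall i, i \in s -> ~~ e i x -> F i x = 0) /\
                   \sum_(i <- s) (e i x)%:R <= N} ->
  0 <= N ->
  (Lpnorm m p (fun x => (\sum_(i <- s) c i * F i x)%R) <=
   (N * M * (\sum_(i <- s) modulus (c i) `^ p) `^ p^-1)%:E)%E.
Proof.
move=> p0 M0 cF FM ov N0.
pose F' i := if i \in s then F i else (fun=> 0).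
rewrite (_ : (fun x => _) = (fun x => \sum_(i <- s) c i * F' i x)); last first.
  by apply/funext => x; apply: eq_big_seq => i si; rewrite /F' si.
apply: (@Lpnorm_overlap p _ s c F' e N M) => //.
- by move=> i; rewrite /F'; case: ifPn => [/cF//|_]; exact: cmeas_cst.
- by move=> i; rewrite /F'; case: ifPn => [/FM//|_]; rewrite Lpnorm0// lee_fin.
- apply: filterS ov => x [Fe eN]; split=> // i ei; rewrite /F'.
  by case: ifPn => // si; exact: Fe.
Qed.

End Lp.

(** * Grids and their metric *)

Section Volumes.
Context d (T : measurableType d) (R : realType).
Variable m : {measure set T -> \bar R}.
Hypothesis m1 : m setT = 1%E.

Lemma volE Q : measurable Q -> m Q = (vol m Q)%:E.
Proof.
move=> mQ; rewrite /vol fineK// ge0_fin_numE//.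
apply: le_lt_trans (ltry 1); rewrite -m1; apply: le_measure; rewrite ?inE//.
Qed.

Lemma vol_ge0 Q : 0 <= vol m Q.
Proof. by rewrite /vol fine_ge0. Qed.

Lemma vol_le Q Q' : measurable Q -> measurable Q' -> Q `<=` Q' ->
  vol m Q <= vol m Q'.
Proof.
by move=> mQ mQ' QQ'; rewrite -lee_fin -!volE//; apply: le_measure; rewrite
  ?inE.
Qed.

Lemma vol_le1 Q : measurable Q -> vol m Q <= 1.
Proof. by move=> mQ; rewrite -lee_fin -volE// -m1; apply: le_measure; rewrite
  ?inE. Qed.

Lemma vol_gt0 Q : measurable Q -> (0 < m Q)%E -> 0 < vol m Q.
Proof. by move=> mQ; rewrite volE. Qed.

End Volumes.

Section PartitionGrid.
Context d (T : measurableType d) (R : realType).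
Variable m : {measure set T -> \bar R}.
Hypothesis m1 : m setT = 1%E.
Variable X : set T.

(** Unlike in [good_grid], covering and disjointness hold at every point of [X]. The trace of [P]
    and its recalibrations satisfy this; adapted grids are not assumed to, and are treated through
    [regular_points]. *)
Record partition_grid (P : nat -> set (set T)) : Prop := PartitionGrid {
  pg_finite : forall k, finite_set (P k) ;
  pg_meas : forall k Q, P k Q -> measurable Q ;
  pg_sub : forall k Q, P k Q -> Q `<=` X ;
  pg_pos : forall k Q, P k Q -> (0 < m Q)%E ;
  pg_cover : forall k x, X x -> exists2 Q, P k Q & Q x ;
  pg_disj : forall k Q Q' x, P k Q -> P k Q' -> Q x -> Q' x -> Q = Q' ;
  pg_nested : forall k Q, P k.+1 Q -> exists2 Q', P k Q' & Q `<=` Q'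
}.

Variable P : nat -> set (set T).
Hypothesis pgP : partition_grid P.

Lemma pg_vol_gt0 k Q : P k Q -> 0 < vol m Q.
Proof. by move=> PQ; apply: vol_gt0 => //; [exact: pg_meas PQ|exact: pg_pos
  PQ]. Qed.

Lemma pg_ancestor k n C' : P (n + k)%N C' -> exists2 C, P k C & C' `<=` C.
Proof.
elim: n C' => [|n IH] C'; first by exists C'.
rewrite addSn => /(pg_nested pgP)[C1 /IH[C PC C1C] CC1]; exists C => //.
exact: subset_trans C1C.
Qed.

Lemma pg_level_sub k k' C C' x : P k C -> P k' C' -> C x -> C' x -> (k <= k')%N
  ->
  C' `<=` C.
Proof.
move=> PC PC' Cx C'x kk'; move: PC'; rewrite -(subnK kk') => /pg_ancestor[D PD
  C'D].
by rewrite (pg_disj pgP PC PD Cx (C'D _ C'x)).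
Qed.

Lemma cells_meas C : cells P C -> measurable C.
Proof. by move=> [k _ PC]; exact: pg_meas PC. Qed.

Lemma cells_vol_gt0 C : cells P C -> 0 < vol m C.
Proof. by move=> [k _ /pg_vol_gt0]. Qed.

Lemma cells_sub C : cells P C -> C `<=` X.
Proof. by move=> [k _ PC]; exact: pg_sub PC. Qed.

Lemma cells_nonempty C : cells P C -> exists x, C x.
Proof.
move=> cC; apply/set0P/eqP => C0; have := cells_vol_gt0 cC.
by rewrite C0 /vol measure0 ltxx.
Qed.

Lemma cells_nested C C' x : cells P C -> cells P C' -> C x -> C' x ->
  C `<=` C' \/ C' `<=` C.
Proof.
move=> [k _ PC] [k' _ PC'] Cx C'x; have [kk'|/ltnW k'k] := leqP k k'.
  by right; exact: pg_level_sub PC PC' Cx C'x kk'.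
by left; exact: pg_level_sub PC' PC C'x Cx k'k.
Qed.

Lemma pg_meas_space : measurable X.
Proof.
have -> : X = \bigcup_(Q in P 0%N) Q.
  apply/seteqP; split=> [x /(pg_cover pgP 0%N)[Q PQ Qx]|x [Q PQ Qx]].
    by exists Q.
  exact: pg_sub PQ _ Qx.
apply: fin_bigcup_measurable; first exact: pg_finite.
by move=> Q PQ; exact: pg_meas PQ.
Qed.

Section Ratio.
Variables lam' lam : R.
Hypothesis lam'01 : 0 < lam' < 1.
Hypothesis lam01 : 0 < lam < 1.
Hypothesis ratio : forall k Q Q', P k.+1 Q -> P k Q' -> Q `<=` Q' ->
      lam' <= vol m Q / vol m Q' <= lam.

Let lam0 : 0 < lam. Proof. by case/andP: lam01. Qed.
Let lam1 : lam < 1. Proof. by case/andP: lam01. Qed.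
Let lam'0 : 0 < lam'. Proof. by case/andP: lam'01. Qed.
Let lam'1 : lam' < 1. Proof. by case/andP: lam'01. Qed.

Lemma pg_child k Q Q' : P k.+1 Q -> P k Q' -> Q `<=` Q' ->
  lam' * vol m Q' <= vol m Q <= lam * vol m Q'.
Proof.
move=> PQ PQ' QQ'; have v0 := pg_vol_gt0 PQ'.
by have := ratio PQ PQ' QQ'; rewrite ler_pdivlMr// ler_pdivrMr.
Qed.

Lemma pg_vol_lt k k' C C' : P k C -> P k' C' -> C' `<=` C -> (k < k')%N ->
  vol m C' < vol m C.
Proof.
move=> PC PC' C'C kk'.
have [x C'x] : exists x, C' x by apply: cells_nonempty; exists k'.
case: k' kk' PC' => // k' kk' PC'.
have [D PD C'D] := pg_nested pgP PC'.
have DC : D `<=` C by exact: pg_level_sub PC PD (C'C _ C'x) (C'D _ C'x) kk'.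
have /andP[_ h] := pg_child PC' PD C'D.
apply: (le_lt_trans h); apply: (@lt_le_trans _ _ (vol m D)).
  by rewrite gtr_pMl// (pg_vol_gt0 PD).
by apply: vol_le => //; [exact: pg_meas PD|exact: pg_meas PC].
Qed.

(** Volume strictly decreases from a cell to a deeper one inside it, so for two cells that meet,
    comparing volumes decides the direction of the inclusion. This turns bounds on [rho], which is
    defined by volumes, into statements about cells. *)
Lemma cells_vol_sub C C' x : cells P C -> cells P C' -> C x -> C' x ->
  vol m C <= vol m C' -> C `<=` C'.
Proof.
move=> [k _ PC] [k' _ PC'] Cx C'x v; have [k'k|kk'] := leqP k' k.
  exact: pg_level_sub PC' PC C'x Cx k'k.
have C'C := pg_level_sub PC PC' Cx C'x (ltnW kk').
by have := pg_vol_lt PC PC' C'C kk'; rewrite ltNge v.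
Qed.

Lemma pg_vol_exp k C : P k C -> vol m C <= lam ^+ k.
Proof.
elim: k C => [|k IH] C PC; first by rewrite expr0 vol_le1//; exact: pg_meas PC.
have [D PD CD] := pg_nested pgP PC.
have /andP[_ h] := pg_child PC PD CD.
by rewrite (le_trans h)// exprS ler_wpM2l ?(ltW lam0)// IH.
Qed.

Lemma exp_lt (r : R) : 0 < r -> exists n, lam ^+ n < r.
Proof.
move=> r0; have := @cvg_expr R lam; rewrite ger0_norm ?(ltW lam0)// => /(_
  lam1).
move=> /cvgrPdist_lt/(_ _ r0)[N _ /(_ N (leqnn N))] /=.
rewrite sub0r normrN ger0_norm ?exprn_ge0 ?(ltW lam0)// => h.
by exists N.
Qed.

Lemma small_cell x (r : R) : X x -> 0 < r ->
  exists C, [/\ cells P C, C x & vol m C < r].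
Proof.
move=> Xx /exp_lt[n nr]; have [C PC Cx] := pg_cover pgP n Xx.
by exists C; split=> //; [exists n|apply: le_lt_trans nr; exact: pg_vol_exp].
Qed.

Notation rho := (grid_dist m P).

Lemma rho_ltP x y (r : R) : (rho x y < r%:E)%E <->
  exists C, [/\ cells P C, C x, C y & vol m C < r].
Proof.
split.
  move=> /ereal_inf_lt[_ [C [cC Cx Cy] <-]].
  by rewrite (volE m1 (cells_meas cC)) lte_fin => h; exists C.
move=> [C [cC Cx Cy h]]; apply: (@le_lt_trans _ _ (m C)).
  by apply: ereal_inf_lbound; exists C.
by rewrite (volE m1 (cells_meas cC)) lte_fin.
Qed.

Lemma rho_le x y C : cells P C -> C x -> C y -> (rho x y <= (vol m C)%:E)%E.
Proof.
move=> cC Cx Cy; rewrite -(volE m1 (cells_meas cC)).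
by apply: ereal_inf_lbound; exists C.
Qed.

Lemma rho_ge0 x y : (0 <= rho x y)%E.
Proof. by apply: le_ereal_inf_tmp => _ [C [cC _ _] <-]. Qed.

(* A cell containing [x] and [y] is not contained in [S], hence contains it. *)
Lemma rho_sep S x y : cells P S -> S x -> ~ S y -> ((vol m S)%:E <= rho x y)%E.
Proof.
move=> cS Sx Sy; apply: le_ereal_inf_tmp => _ [C [cC Cx Cy] <-].
rewrite (volE m1 (cells_meas cC)) lee_fin leNgt; apply/negP => h.
by apply: Sy; exact: (cells_vol_sub cC cS Cx Sx (ltW h)).
Qed.

(** Ultrametric inequality: two cells through [y] are nested, and the larger one contains all three
    points. *)
Lemma rball_trans x y z (r : R) : rball X rho x r y -> rball X rho y r z ->
  rball X rho x r z.
Proof.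
move=> [Xy /rho_ltP[C [cC Cx Cy vC]]] [Xz /rho_ltP[D [cD Dy Dz vD]]].
split=> //; apply/rho_ltP; have [CD|DC] := cells_nested cC cD Cy Dy.
  by exists D; split=> //; exact: CD.
by exists C; split=> //; exact: DC.
Qed.

Lemma rball_sym x y (r : R) : X x -> rball X rho x r y -> rball X rho y r x.
Proof.
by move=> Xx [Xy /rho_ltP[C [cC Cx Cy vC]]]; split=> //; apply/rho_ltP; exists
  C.
Qed.

Lemma rball_eq x y (r : R) : X x -> rball X rho x r y ->
  rball X rho y r = rball X rho x r.
Proof.
move=> Xx xy; apply/seteqP; split=> z; first exact: rball_trans.
by apply: rball_trans; exact: rball_sym.
Qed.

Lemma rball_refl x (r : R) : X x -> 0 < r -> rball X rho x r x.
Proof.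
move=> Xx /(small_cell Xx)[C [cC Cx vC]]; split=> //.
by apply/rho_ltP; exists C.
Qed.

(** The ball is the cell of least level through [x] whose volume is below [r]. Its parent has volume
    at least [r], which the ratio condition turns into a lower bound, unless the cell has level 0
    and hence no parent. *)
Lemma rball_cell x (r : R) : X x -> 0 < r ->
  exists C, [/\ cells P C, rball X rho x r = C, C x, vol m C < r &
    P 0%N C \/ lam' * r <= vol m C].
Proof.
move=> Xx r0.
pose has n := `[< exists C, [/\ P n C, C x & vol m C < r] >].
have ex : exists n, has n.
  have [C [[n _ PC] Cx vC]] := small_cell Xx r0.
  by exists n; apply/asboolP; exists C.
case: (ex_minnP ex) => n /asboolP[C [PC Cx vC]] nmin.
have cC : cells P C by exists n.
exists C; split=> //.
  apply/seteqP; split=> [y [Xy /rho_ltP[D [[k _ PD] Dx Dy vD]]]|y Cy].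
    have nk : (n <= k)%N by apply: nmin; apply/asboolP; exists D.
    exact: pg_level_sub PC PD Cx Dx nk _ Dy.
  by split; [exact: cells_sub cC _ Cy|apply/rho_ltP; exists C].
case: n PC nmin cC => [|n] PC nmin cC; [by left|right].
have [D PD CD] := pg_nested pgP PC.
have /andP[h _] := pg_child PC PD CD; apply: le_trans h.
rewrite ler_wpM2l ?(ltW lam'0)// leNgt; apply/negP => vD.
suff /nmin : has n by rewrite ltnn.
by apply/asboolP; exists D; split=> //; exact: CD.
Qed.

Lemma rball_meas x (r : R) : X x -> 0 < r -> measurable (rball X rho x r).
Proof. by move=> Xx /(rball_cell Xx)[C [cC -> _ _ _]]; exact: cells_meas. Qed.

Lemma rball_vol_le x (r : R) : X x -> 0 < r -> vol m (rball X rho x r) <= r.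
Proof. by move=> Xx /(rball_cell Xx)[C [_ -> _ /ltW]]. Qed.

(** Balls stop growing at a cell of level 0, whence the cap [b] on the radius and the constant
    [mu / b], where [mu] bounds the volumes of level 0 from below. *)
Lemma rball_vol_ge (b : R) : 0 < b -> exists2 c : R, 0 < c &
  forall x r, X x -> 0 < r <= b -> c * r <= vol m (rball X rho x r).
Proof.
move=> b0.
have [mu mu0 muP] : exists2 mu : R, 0 < mu & forall C, P 0%N C -> mu <= vol m C.
  apply: finite_lower_bound; first exact: (pg_finite pgP).
  by move=> C; exact: pg_vol_gt0.
exists (Num.min lam' (mu / b)); first by rewrite lt_min lam'0 divr_gt0.
move=> x r Xx /andP[r0 rb]; have [C [cC -> Cx vC [PC|h]]] := rball_cell Xx r0.
  apply: le_trans (muP _ PC).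
  rewrite -[leRHS](divfK (lt0r_neq0 b0)) ler_pM ?(ltW r0)//.
    by rewrite le_min (ltW lam'0) divr_ge0 ?ltW.
  by rewrite ge_min lexx orbT.
by apply: le_trans h; rewrite ler_wpM2r ?(ltW r0)// ge_min lexx.
Qed.

(** The infimum need not be attained, so the distance is tested with every positive margin [e]. Each
    test involves only countably many cells, which is what makes layers measurable. *)
Lemma rdist_leP x (A : set T) (t : R) : (rdist rho x A <= t%:E)%E <->
  forall e, 0 < e -> exists C, [/\ cells P C, C x, vol m C < t + e & C `&` A
    !=set0].
Proof.
split=> [h e e0|h].
  have : (rdist rho x A < (t + e)%:E)%E by apply: (le_lt_trans h); rewrite
    lte_fin ltrDl.
  move=> /ereal_inf_lt[_ [y Ay <-]] /rho_ltP[C [cC Cx Cy vC]].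
  by exists C; split=> //; exists y.
apply/lee_addgt0Pr => e e0; have [C [cC Cx vC [y [Cy Ay]]]] := h _ e0.
apply: (@le_trans _ _ (rho x y)); first by apply: ereal_inf_lbound; exists y.
by apply: ltW; rewrite -EFinD; apply/rho_ltP; exists C.
Qed.

(** Margins [1 / n.+1] suffice in [rdist_leP], and the layer becomes the trace on [Q] of a countable
    intersection of countable unions of cells. *)
Lemma layer_meas (Q A : set T) (t : R) : measurable Q ->
  measurable [set x | Q x /\ (rdist rho x A <= t%:E)%E].
Proof.
move=> mQ.
rewrite [X in measurable X](_ : _ = Q `&` \bigcap_n
  \bigcup_k \bigcup_(C in [set C | [/\ P k C, vol m C < t + n.+1%:R^-1 &
                                   C `&` A !=set0]]) C).
  apply: measurableI => //; apply: bigcap_measurable => [|n _]; first by exists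
    0%N.
  apply: bigcupT_measurable => k; apply: fin_bigcup_measurable.
    by apply: sub_finite_set (pg_finite pgP k) => C [].
  by move=> C [PC _ _]; exact: pg_meas PC.
apply/seteqP; split=> x [Qx].
  move=> /rdist_leP h; split=> // n _.
  have [|C [[k _ PC] Cx vC CA]] := h (n.+1%:R^-1); first by rewrite invr_gt0.
  by exists k => //; exists C.
move=> h; split=> //; apply/rdist_leP => e e0.
have [n ne] : exists n, n.+1%:R^-1 < e.
  exists (Num.truncn e^-1); rewrite -[ltRHS]invrK ltf_pV2 ?posrE ?invr_gt0//.
  by rewrite truncnS_gt.
have [k _ [C [PC vC CA] Cx]] := h n I; exists C; split=> //; first by exists k.
by apply: (lt_trans vC); rewrite ltrD2l.
Qed.

End Ratio.
End PartitionGrid.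

(** * Null sets and recalibrations *)

Section Regular.
Context d (T : measurableType d) (R : realType).
Variable m : {measure set T -> \bar R}.

Lemma fin_bigcup_negligible (I : choiceType) (D : set I) (F : I -> set T) :
  finite_set D -> (forall i, D i -> m.-negligible (F i)) ->
  m.-negligible (\bigcup_(i in D) F i).
Proof.
move=> /finite_seqP[s ->]; elim: s => [|i s IH] sF.
  by apply: negligibleS (negligible_set0 m) => x [].
apply: (@negligibleS _ _ _ _ (F i `|` \bigcup_(j in [set` s]) F j)).
  move=> x [j /=]; rewrite in_cons => /orP[/eqP ->|js] Fx; first by left.
  by right; exists j.
apply: negligibleU; first by apply: sF; rewrite /= mem_head.
by apply: IH => j js; apply: sF; rewrite /= in_cons; apply/orP; right.
Qed.

Variables (W : nat -> set (set T)).

Let bad k := ~` (\bigcup_(Q in W k) Q) `|`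
  \bigcup_(Q in W k) \bigcup_(Q' in [set Q' | W k Q' /\ Q <> Q']) (Q `&` Q').

Lemma not_regularE : ~` regular_points W = \bigcup_k bad k.
Proof.
apply/seteqP; split=> x.
  move=> /existsNP[k nk]; exists k => //.
  have [[Q [WQ Qx]]|nex] := pselect (exists Q, W k Q /\ Q x); last first.
    by left => -[Q WQ Qx]; apply: nex; exists Q.
  right; exists Q => //; apply: contrapT => H; apply: nk; exists Q; split=> //.
  move=> Q' [WQ' Q'x]; apply: contrapT => QQ'; apply: H.
  by exists Q'.
move=> [k _ [nc|[Q WQ [Q' [WQ' QQ'] [Qx Q'x]]]]] /(_ k)[Q0 [[WQ0 Q0x] uniq]].
  by apply: nc; exists Q0.
by apply: QQ'; rewrite -(uniq Q)// -(uniq Q').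
Qed.

Hypothesis finW : forall k, finite_set (W k).
Hypothesis measW : forall k Q, W k Q -> measurable Q.

Let finW' k Q : finite_set [set Q' | W k Q' /\ Q <> Q'].
Proof. by apply: sub_finite_set (finW k) => Q' []. Qed.

Lemma regular_meas : measurable (regular_points W).
Proof.
rewrite -[regular_points W]setCK not_regularE; apply: measurableC.
apply: bigcupT_measurable => k; apply: measurableU.
  apply: measurableC; apply: fin_bigcup_measurable; first exact: finW.
  by move=> Q; exact: measW.
apply: fin_bigcup_measurable; first exact: finW.
move=> Q WQ; apply: fin_bigcup_measurable; first exact: finW'.
by move=> Q' [WQ' _]; apply: measurableI; [exact: measW WQ|exact: measW WQ'].
Qed.

Lemma regular_negligible (X : set T) : m.-negligible (~` X) ->
  (forall k, m.-negligible (X `\` \bigcup_(Q in W k) Q)) ->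
  (forall k Q Q', W k Q -> W k Q' -> Q <> Q' -> m (Q `&` Q') = 0%E) ->
  m.-negligible (~` regular_points W).
Proof.
move=> nX cov dis; rewrite not_regularE; apply: negligible_bigcup => k.
apply: negligibleU.
  apply: (@negligibleS _ _ _ _ (~` X `|` (X `\` \bigcup_(Q in W k) Q))).
    by move=> x nx; have [Xx|nXx] := pselect (X x); [right|left].
  exact: negligibleU.
apply: fin_bigcup_negligible; first exact: finW.
move=> Q WQ; apply: fin_bigcup_negligible; first exact: finW'.
move=> Q' [WQ' QQ']; apply/negligibleP; first last.
  exact: dis WQ WQ' QQ'.
by apply: measurableI; [exact: measW WQ|exact: measW WQ'].
Qed.

Lemma regular_sum (V : nmodType) (k : nat) (x : T) (Q : set T)
    (F : set T -> V) : regular_points W x -> W k Q -> Q x ->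
  (forall Q', W k Q' -> ~ Q' x -> F Q' = 0) ->
  \sum_(Q' <- fset_set (W k)) F Q' = F Q.
Proof.
move=> /(_ k)[Q0 [_ uniq]] WQ Qx F0.
have Qs : Q \in fset_set (W k) by rewrite in_fset_set//; exact/mem_set.
rewrite (bigD1_seq Q Qs (finmap.fset_uniq _))/=.
rewrite big_seq_cond big1 ?addr0// => Q' /andP[].
rewrite in_fset_set// => /set_mem WQ' QQ'; apply: F0 => // Q'x.
by move/eqP: QQ'; apply; rewrite -(uniq Q)// -(uniq Q').
Qed.

Hypothesis regW : m.-negligible (~` regular_points W).

Lemma regular_ae : {ae m, forall x, regular_points W x}.
Proof. by []. Qed.

(** The two integrands are compared at regular points only: elsewhere cells of level [k] may overlap
    or leave a gap. *)
Lemma ae_partition_integral k (g : T -> \bar R) : measurable_fun setT g ->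
  (forall x, 0 <= g x)%E ->
  (\int[m]_x g x = \sum_(Q <- fset_set (W k)) \int[m]_(x in Q) g x)%E.
Proof.
move=> mg g0.
pose W' Q := if Q \in fset_set (W k) then Q else set0.
have mW' Q : measurable (W' Q).
  rewrite /W'; case: ifPn => //; rewrite in_fset_set// => /set_mem; exact:
    measW.
transitivity (\sum_(Q <- fset_set (W k)) \int[m]_x (g \_ (W' Q)) x)%E; last
  first.
  by apply: eq_big_seq => Q QW; rewrite [RHS]integral_mkcond /W' QW.
rewrite -ge0_integral_sum//; last 2 first.
- move=> Q; apply/(measurable_restrictT _ _).1 => //; exact: measurable_funTS.
- by move=> Q x _; rewrite patchE; case: ifP.
apply: ae_eq_integral => //.
  apply: emeasurable_sum => Q.
  apply/(measurable_restrictT _ _).1 => //; exact: measurable_funTS.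
apply: filterS regular_ae => x rx _.
have [Q [[WQ Qx] _]] := rx k.
rewrite (regular_sum (Q := Q) rx)//.
  by rewrite patchE /W' in_fset_set// (mem_set WQ) (mem_set Qx).
move=> Q' WQ' Q'x; rewrite patchE ifF//; apply/negbTE/negP => /set_mem.
by rewrite /W' in_fset_set// (mem_set WQ').
Qed.

End Regular.

(** * Good grids: trace on the regular points, and subgrids *)

Section GoodGrids.
Context d (T : measurableType d) (R : realType).
Variable m : {measure set T -> \bar R}.
Hypothesis m1 : m setT = 1%E.

Lemma good_grid_ratio_lt (X : set T) W k n Q : good_grid m X W ->
  W (n.+1 + k)%N Q -> exists C, [/\ W k C, Q `<=` C & vol m Q < vol m C].
Proof.
move=> gW; have [lam' [lam [_ /andP[_ lam1] ratio]]] := grid_ratio gW.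
have step j D : W j.+1 D -> exists C, [/\ W j C, D `<=` C & vol m D < vol m C].
  move=> WD; have [C WC DC] := grid_nested gW WD; exists C; split=> //.
  have C0 : 0 < vol m C.
    exact: (vol_gt0 m1 (grid_measurable gW WC) (grid_pos gW WC)).
  have /andP[_] := ratio _ _ _ WD WC DC; rewrite ler_pdivrMr// => /le_lt_trans;
    apply.
  by rewrite gtr_pMl.
elim: n Q => [|n IH] Q; first exact: step.
rewrite addSn => /step[D [/IH[C [WC DC v]] QD v']]; exists C; split=> //.
  exact: subset_trans DC.
exact: lt_trans v.
Qed.

(** An ancestor of [Q] at a smaller level has strictly larger volume, so it differs from [Q], yet it
    meets [Q] in a set of positive measure. Coefficients and atoms are indexed by cells alone, and
    this makes the level a function of the cell. *)
Lemma good_grid_level (X : set T) W k k' Q : good_grid m X W ->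
  W k Q -> W k' Q -> k = k'.
Proof.
move=> gW; wlog kk' : k k' / (k <= k')%N => [H|].
  by have [/H//|/ltnW/H H' WQ WQ'] := leqP k k'; apply/esym/H'.
move=> WQ WQ'; move: kk'; rewrite leq_eqVlt => /orP[/eqP//|kk'].
have : W ((k' - k.+1).+1 + k)%N Q by rewrite addSnnS subnK.
move=> /(good_grid_ratio_lt gW)[C [WC QC v]].
have [QeC|QnC] := pselect (Q = C); first by rewrite QeC ltxx in v.
have := grid_disjoint gW WQ WC QnC; rewrite setIidl// => mQ0.
by have := grid_pos gW WQ; rewrite mQ0 ltxx.
Qed.

Lemma good_grid_regular (X : set T) W : good_grid m X W ->
  m.-negligible (~` X) -> measurable X -> m.-negligible (~` regular_points W).
Proof.
move=> gW nX mX.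
apply: (regular_negligible (grid_finite gW) _ nX).
- by move=> k Q; exact: (grid_measurable gW).
- move=> k; apply/negligibleP; last exact: (grid_cover gW).
  apply: measurableD => //; apply: fin_bigcup_measurable.
    exact: (grid_finite gW).
  by move=> Q; exact: (grid_measurable gW).
- by move=> k Q Q'; exact: (grid_disjoint gW).
Qed.

Section Trace.
Variable P0 : nat -> set (set T).
Hypothesis g0 : good_grid m setT P0.
Let X := regular_points P0.
Let P := trace_grid X P0.

Lemma trace_space_meas : measurable X.
Proof.
by apply: regular_meas; [exact: (grid_finite g0)|move=> k Q; exact:
  (grid_measurable g0)].
Qed.

Lemma trace_space_negligible : m.-negligible (~` X).
Proof.
by apply: good_grid_regular g0 _ _ => //; rewrite setCT; exact: negligible_set0.
Qed.

Lemma trace_measure Q : measurable Q -> m (Q `&` X) = m Q.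
Proof.
move=> mQ; have mX := trace_space_meas.
rewrite [in RHS](_ : Q = (Q `&` X) `|` (Q `&` ~` X)); last first.
  by rewrite -setIUr setUv setIT.
rewrite measureU//; last 3 first.
- exact: measurableI.
- by apply: measurableI => //; exact: measurableC.
- by rewrite setIACA setICr setI0.
rewrite [X in (_ + X)%E](_ : _ = 0%E) ?adde0//.
apply/negligibleP; first by apply: measurableI => //; exact: measurableC.
by apply: negligibleS trace_space_negligible; exact: subIsetr.
Qed.

Lemma trace_partition : partition_grid m X P.
Proof.
split=> [k|k _ [Q PQ <-]|k _ [Q PQ <-]|k _ [Q PQ <-]|k x Xx|k _ _ x [Q PQ <-]
  [Q' PQ' <-]|k _ [Q PQ <-]].
- by apply: finite_image; exact: (grid_finite g0).
- by apply: measurableI; [exact: (grid_measurable g0 PQ)|exact: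
  trace_space_meas].
- exact: subIsetr.
- by rewrite trace_measure; [exact: (grid_pos g0 PQ)|exact: (grid_measurable g0
  PQ)].
- have [Q [[PQ Qx] _]] := Xx k; exists (Q `&` X) => //; exists Q => //.
- move=> [Qx Xx] [Q'x _]; have [Q0 [_ uniq]] := Xx k.
  by rewrite -(uniq Q)// -(uniq Q').
- have [Q' PQ' QQ'] := grid_nested g0 PQ; exists (Q' `&` X); first by exists Q'.
  exact: setSI.
Qed.

(** An inclusion of traces is not an inclusion of cells. But the parent of [Q] shares a regular
    point with [Q'], hence equals [Q'], and the ratio of the original cells applies since traces
    have the same measure. *)
Lemma trace_ratio : exists lam' lam : R, [/\ 0 < lam' < 1, 0 < lam < 1 &
  forall k Q Q', P k.+1 Q -> P k Q' -> Q `<=` Q' ->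
    lam' <= vol m Q / vol m Q' <= lam].
Proof.
have [lam' [lam [h' h ratio]]] := grid_ratio g0; exists lam', lam; split=> //.
move=> k Q1 Q1'; rewrite /P => PQ1 PQ1'.
have [x Q1x] : exists x, Q1 x.
  by apply: (cells_nonempty m1 trace_partition); exists k.+1.
move: PQ1 PQ1' Q1x => [Q PQ <-] [Q' PQ' <-] [Qx Xx] QQ'.
have [D PD QD] := grid_nested g0 PQ.
have [Q'x _] : (Q' `&` X) x by exact: QQ'.
have Q'D : Q' = D.
  by have [Q0 [_ uniq]] := Xx k; rewrite -(uniq Q')// -(uniq D)//; split=> //;
    exact: QD.
rewrite /vol !trace_measure; last 2 first.
- exact: (grid_measurable g0 PQ').
- exact: (grid_measurable g0 PQ).
by apply: ratio PQ PQ' _; rewrite Q'D.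
Qed.

(** The sets whose intersection with [X] is generated by the traces form a sigma-algebra that
    contains the cells of [P0]. *)
Lemma trace_generates : <<s X, cells P >> = [set A | measurable A /\ A `<=` X].
Proof.
have mX := trace_space_meas.
apply/seteqP; split.
  apply: smallest_sub.
    split=> [|A [mA AX]|A mA].
    - by split=> //; exact: sub0set.
    - by split; [exact: measurableD|exact: subDsetl].
    - split; first by apply: bigcupT_measurable => n; case: (mA n).
      by apply: bigcup_sub => n _; case: (mA n).
  move=> _ [k _ [Q PQ <-]]; split; last exact: subIsetr.
  by apply: measurableI => //; exact: (grid_measurable g0 PQ).
move=> A [mA AX].
have : <<s setT, cells P0 >> A by rewrite (grid_generates g0).
suff : <<s setT, cells P0 >> `<=` [set B | <<s X, cells P >> (B `&` X)].
  by move=> /[apply] /=; rewrite setIidl.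
apply: smallest_sub.
  split=> [|B /= HB|B /= HB].
  - by rewrite /= set0I; exact: sigma_algebra0.
  - rewrite [X in <<s _, _>> X](_ : _ = X `\` (B `&` X)); first exact:
    sigma_algebraCD.
    apply/seteqP; split=> x.
      by move=> [[_ nB] Xx]; split=> // -[].
    by move=> [Xx nBX]; split=> //; split=> // Bx; apply: nBX.
  - by rewrite setI_bigcupl; exact: sigma_algebra_bigcup.
move=> Q [k _ PQ] /=; apply: sub_sigma_algebra; exists k => //.
by exists Q.
Qed.

End Trace.

Section Recalibration.
Variables (X : set T) (P : nat -> set (set T)).
Hypothesis pgP : partition_grid m X P.
Variables lam' lam : R.
Hypothesis lam'01 : 0 < lam' < 1.
Hypothesis lam01 : 0 < lam < 1.
Hypothesis ratio : forall k Q Q', P k.+1 Q -> P k Q' -> Q `<=` Q' ->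
      lam' <= vol m Q / vol m Q' <= lam.

(** A point missed by level [k] of [G] lies in a cell of [P] smaller than every cell of that level.
    This cell meets none of them: contained in one, it would cover the point; containing one, it
    would be too large. It would thus be a null set, against positivity. Likewise, distinct cells of
    one level that meet would be nested with null intersection. *)
Lemma subgrid_partition G : good_grid m X G -> cells G `<=` cells P ->
  partition_grid m X G.
Proof.
move=> gG GP; split.
- exact: (grid_finite gG).
- by move=> k Q; exact: (grid_measurable gG).
- by move=> k Q; exact: (grid_sub gG).
- by move=> k Q; exact: (grid_pos gG).
- move=> k x Xx; apply: contrapT => nex.
  have [mu mu0 muG] : exists2 mu : R, 0 < mu & forall S, G k S -> mu <= vol m S.
    apply: finite_lower_bound; first exact: (grid_finite gG).
    by move=> S GS; apply: (cells_vol_gt0 m1 pgP); apply: GP; exists k.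
  have [C [cC Cx vC]] := small_cell m1 pgP lam01 ratio Xx mu0.
  have : (m C <= m (X `\` \bigcup_(Q in G k) Q))%E.
    apply: le_measure; rewrite ?inE.
    - exact: (cells_meas pgP cC).
    - apply: measurableD; first exact: (pg_meas_space pgP).
      apply: fin_bigcup_measurable; first exact: (grid_finite gG).
      by move=> Q; exact: (grid_measurable gG).
    move=> y Cy; split; first exact: (cells_sub pgP cC).
    move=> [S GS Sy]; have cS : cells P S by apply: GP; exists k.
    have [CS|SC] := cells_nested pgP cC cS Cy Sy.
      by apply: nex; exists S => //; exact: CS.
    have := vol_le m1 (cells_meas pgP cS) (cells_meas pgP cC) SC.
    by rewrite leNgt (lt_le_trans vC (muG _ GS)).
  rewrite (grid_cover gG) leNgt (volE m1 (cells_meas pgP cC)) lte_fin.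
  by rewrite (cells_vol_gt0 m1 pgP cC).
- move=> k S S' x GS GS' Sx S'x; apply: contrapT => SS'.
  have := grid_disjoint gG GS GS' SS'.
  have cS : cells P S by apply: GP; exists k.
  have cS' : cells P S' by apply: GP; exists k.
  have [h|h] := cells_nested pgP cS cS' Sx S'x.
    by rewrite setIidl// => m0; have := grid_pos gG GS; rewrite m0 ltxx.
  by rewrite setIidr// => m0; have := grid_pos gG GS'; rewrite m0 ltxx.
- by move=> k Q; exact: (grid_nested gG).
Qed.

End Recalibration.
End GoodGrids.

(** * Means *)

Section Means.
Context d (T : measurableType d) (R : realType).
Variable m : {measure set T -> \bar R}.
Hypothesis m1 : m setT = 1%E.
Implicit Types (f g : T -> R[i]) (S : set T) (p : R).

Definition cintegrable f : Prop :=
  m.-integrable setT (EFin \o (fun x => complex.Re (f x))) /\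
  m.-integrable setT (EFin \o (fun x => complex.Im (f x))).

Lemma cintegrable_cmeas f : cintegrable f -> cmeas f.
Proof.
by move=> [/measurable_int/measurable_EFinP ? /measurable_int/measurable_EFinP
  ?].
Qed.

Lemma modulus_le_powR (x p : R) : 1 <= p -> 0 <= x -> x <= 1 + x `^ p.
Proof.
move=> p1 x0; have [x1|/ltW x1] := leP x 1.
  by rewrite (le_trans x1)// lerDl powR_ge0.
by rewrite (le_trans (le1r_powR x1 p1))// lerDr.
Qed.

Lemma Lp_modulus_lty p f : 1 <= p -> cmeas f -> (Lpnorm m p f < +oo)%E ->
  (\int[m]_x (modulus (f x))%:E < +oo)%E.
Proof.
move=> p1 cf fp; have p0 : 0 < p by rewrite (lt_le_trans ltr01).
apply: (@le_lt_trans _ _ (\int[m]_x (1%:E + (modulus (f x) `^ p)%:E))%E).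
  apply: ge0_le_integral => //.
  - by move=> x _; rewrite lee_fin modulus_ge0.
  - by apply/measurable_EFinP; exact: measurable_modulus.
  - by apply: emeasurable_funD => //; exact: measurable_modulusp.
  - by move=> x _; rewrite -EFinD lee_fin modulus_le_powR ?modulus_ge0.
rewrite ge0_integralD//; last 2 first.
- by move=> x _; rewrite lee_fin powR_ge0.
- exact: measurable_modulusp.
rewrite integral_cst// mul1e m1 lte_add_pinfty ?ltry//.
by rewrite -(Lpnorm_powE m f (lt0r_neq0 p0)) poweR_lty.
Qed.

Lemma modulus_cintegrable f : cmeas f -> (\int[m]_x (modulus (f x))%:E < +oo)%E
  ->
  cintegrable f.
Proof.
move=> cf fi; have [f1 f2] := cf.
split; apply/integrableP; split; try exact/measurable_EFinP.
  apply: le_lt_trans fi; apply: ge0_le_integral => //.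
  - by apply: measurableT_comp => //; exact/measurable_EFinP.
  - by apply/measurable_EFinP; exact: measurable_modulus.
  - by move=> x _; rewrite lee_fin Re_le_modulus.
apply: le_lt_trans fi; apply: ge0_le_integral => //.
- by apply: measurableT_comp => //; exact/measurable_EFinP.
- by apply/measurable_EFinP; exact: measurable_modulus.
- by move=> x _; rewrite lee_fin Im_le_modulus.
Qed.

Lemma Lp_cintegrable p f : 1 <= p -> cmeas f -> (Lpnorm m p f < +oo)%E ->
  cintegrable f.
Proof.
by move=> p1 cf fp; apply: modulus_cintegrable => //; exact: Lp_modulus_lty fp.
Qed.

Lemma inLp_cintegrable p f : 1 <= p -> inLp m p f -> cintegrable f.
Proof. by move=> p1 [f1 f2 fp]; apply: Lp_cintegrable fp. Qed.

Lemma inLp_inL1 p f : 1 <= p -> inLp m p f -> inLp m 1 f.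
Proof.
move=> p1 [f1 f2 fp]; split=> //.
apply: (@lty_poweRy _ _ 1); rewrite ?oner_neq0//.
rewrite (Lpnorm_powE m f (oner_neq0 _)).
under eq_integral do rewrite powRr1 ?modulus_ge0//.
exact: Lp_modulus_lty fp.
Qed.

Lemma cintegrableD f g : cintegrable f -> cintegrable g ->
  cintegrable (fun x => f x + g x).
Proof.
move=> [f1 f2] [g1 g2]; split.
  rewrite (_ : _ \o _ = (EFin \o (fun x => complex.Re (f x))) \+ (EFin \o (fun
    x => complex.Re (g x))))%E.
    exact: integrableD.
  by apply/funext => x /=; rewrite ReD.
rewrite (_ : _ \o _ = (EFin \o (fun x => complex.Im (f x))) \+ (EFin \o (fun x
  => complex.Im (g x))))%E.
  exact: integrableD.
by apply/funext => x /=; rewrite ImD.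
Qed.

Lemma integrable_lin (u v : T -> R) (a b : R) :
  m.-integrable setT (EFin \o u) -> m.-integrable setT (EFin \o v) ->
  m.-integrable setT (EFin \o (fun x => a * u x + b * v x)).
Proof.
move=> iu iv; rewrite (_ : _ \o _ = (fun x => a%:E * (EFin \o u) x) \+ (fun x
  => b%:E * (EFin \o v) x))%E.
  by apply: integrableD => //; exact: integrableZl.
by [].
Qed.

Lemma cintegrableZ (z : R[i]) f : cintegrable f -> cintegrable (fun x => z * f
  x).
Proof.
move=> [f1 f2]; split.
  rewrite [X in EFin \o X](_ : _ = fun x => complex.Re z * complex.Re (f x) +
    (- complex.Im z) * complex.Im (f x)).
    exact: integrable_lin.
  by apply/funext => x /=; rewrite ReM mulNr.
rewrite [X in EFin \o X](_ : _ = fun x => complex.Re z * complex.Im (f x) +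
  complex.Im z * complex.Re (f x)).
  exact: integrable_lin.
by apply/funext => x /=; rewrite ImM.
Qed.

Lemma cintegrableB f g : cintegrable f -> cintegrable g ->
  cintegrable (fun x => f x - g x).
Proof.
move=> cf cg; have := cintegrableD cf (cintegrableZ (-1) cg).
by under eq_fun do rewrite mulN1r.
Qed.

Lemma cintegrable_cst (z : R[i]) : cintegrable (fun=> z).
Proof.
have h (a : R) : m.-integrable setT (EFin \o (fun=> a)).
  apply/integrableP; split; first exact: measurable_cst.
  apply: (@le_lt_trans _ _ (\int[m]_x cst `|a|%:E x)%E); first exact: le_refl.
  by rewrite integral_cst// m1 mule1 ltry.
by split; exact: h.
Qed.

Lemma cintegrable_sum (I : Type) (s : seq I) (F : I -> T -> R[i]) :
  (forall i, cintegrable (F i)) -> cintegrable (fun x => \sum_(i <- s) F i x).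
Proof.
move=> iF; elim: s => [|i s IH].
  by under eq_fun do rewrite big_nil; exact: cintegrable_cst.
by under eq_fun do rewrite big_cons; exact: cintegrableD.
Qed.

Lemma integrable_sub (u : T -> R) S : measurable S ->
  m.-integrable setT (EFin \o u) -> m.-integrable S (EFin \o u).
Proof. by move=> mS; apply: integrableS => //. Qed.

Lemma meanD f g S : measurable S -> cintegrable f -> cintegrable g ->
  mean m (fun x => f x + g x) S = mean m f S + mean m g S.
Proof.
move=> mS [f1 f2] [g1 g2]; apply: complex_eqP; rewrite ?ReD ?ImD/= -mulrDl.
  rewrite -RintegralD//; try exact: integrable_sub.
  by congr (_ / _); apply: eq_Rintegral => x _; rewrite ReD.
rewrite -RintegralD//; try exact: integrable_sub.
by congr (_ / _); apply: eq_Rintegral => x _; rewrite ImD.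
Qed.

Lemma Rintegral_lin (u v : T -> R) (a b : R) S : measurable S ->
  m.-integrable setT (EFin \o u) -> m.-integrable setT (EFin \o v) ->
  (\int[m]_(x in S) (a * u x + b * v x) =
   a * \int[m]_(x in S) u x + b * \int[m]_(x in S) v x)%R.
Proof.
move=> mS iu iv; rewrite RintegralD//; last 2 first.
- by apply: integrableS (integrableZl _ _ iu) => //.
- by apply: integrableS (integrableZl _ _ iv) => //.
by rewrite !RintegralZl//; exact: integrable_sub.
Qed.

Lemma meanZ (z : R[i]) f S : measurable S -> cintegrable f ->
  mean m (fun x => z * f x) S = z * mean m f S.
Proof.
move=> mS [f1 f2]; apply: complex_eqP; rewrite ?ReM ?ImM/= !mulrA -?mulrBl
  -?mulrDl.
  congr (_ / _).
  rewrite -[RHS]/(_ - _) -mulNr -Rintegral_lin//.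
  by apply: eq_Rintegral => x _; rewrite ReM mulNr.
congr (_ / _).
rewrite -Rintegral_lin//.
by apply: eq_Rintegral => x _; rewrite ImM.
Qed.

Lemma meanB f g S : measurable S -> cintegrable f -> cintegrable g ->
  mean m (fun x => f x - g x) S = mean m f S - mean m g S.
Proof.
move=> mS cf cg; rewrite -[X in _ + X]mulN1r -meanZ// -meanD//.
  by congr mean; apply/funext => x; rewrite mulN1r.
exact: cintegrableZ.
Qed.

Lemma eq_mean f g S : (forall x, S x -> f x = g x) -> mean m f S = mean m g S.
Proof.
move=> fg; rewrite /mean.
have -> : \int[m]_(x in S) complex.Re (f x) = \int[m]_(x in S) complex.Re (g x).
  by apply: eq_Rintegral => x /set_mem Sx; rewrite fg.
have -> // : \int[m]_(x in S) complex.Im (f x) = \int[m]_(x in S) complex.Im (g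
  x).
by apply: eq_Rintegral => x /set_mem Sx; rewrite fg.
Qed.

Lemma mean_cst (z : R[i]) f S : measurable S -> 0 < vol m S ->
  (forall x, S x -> f x = z) -> mean m f S = z.
Proof.
move=> mS S0 fz; rewrite (@eq_mean f (fun=> z))//.
by apply: complex_eqP; rewrite /= Rintegral_cst// mulfK ?gt_eqF.
Qed.

(** The real and imaginary parts of the mean are each at most the mean of the modulus, whence the
    factor 2. *)
Lemma le_modulus_mean f S : measurable S -> 0 < vol m S -> cintegrable f ->
  ((modulus (mean m f S))%:E <=
    (2 / vol m S)%:E * \int[m]_(x in S) (modulus (f x))%:E)%E.
Proof.
move=> mS S0 cf; have [f1 f2] := cf; have cm := cintegrable_cmeas cf.
have mm : measurable_fun setT (fun x => modulus (f x)) by exact: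
  measurable_modulus.
have part (u : T -> R) : m.-integrable setT (EFin \o u) ->
    (forall x, `|u x| <= modulus (f x)) ->
    ((`|(\int[m]_(x in S) u x) / vol m S|)%:E <=
     (vol m S)^-1%:E * \int[m]_(x in S) (modulus (f x))%:E)%E.
  move=> iu um; rewrite normrM [X in _ * X]ger0_norm ?invr_ge0 ?(ltW S0)//
    mulrC EFinM.
  rewrite lee_wpmul2l ?lee_fin ?invr_ge0 ?(ltW S0)//.
  rewrite EFin_normr_Rintegral//; last exact: integrable_sub.
  apply: le_trans (le_abse_integral _ _ _) _ => //.
    by apply: measurable_funTS; exact: measurable_int iu.
  apply: ge0_le_integral => //.
  - by apply: measurable_funTS; apply: measurableT_comp => //; exact:
    measurable_int iu.
  - by apply: measurable_funTS; exact/measurable_EFinP.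
  - by move=> x _; rewrite abse_EFin lee_fin.
apply: (@le_trans _ _ (`|complex.Re (mean m f S)|%:E + `|complex.Im (mean m f
  S)|%:E)%E).
  by rewrite -EFinD lee_fin modulus_le.
rewrite (_ : 2 / vol m S = (vol m S)^-1 + (vol m S)^-1); last first.
  by rewrite mulrDl mul1r.
rewrite EFinD ge0_muleDl ?lee_fin ?invr_ge0 ?(ltW S0)//.
apply: leeD; apply: part => //.
- by move=> x; exact: Re_le_modulus.
- by move=> x; exact: Im_le_modulus.
Qed.

(* Jensen's inequality up to a constant, from
   [a <= t + t^(1-p) a^p] optimised in [t]. *)
Lemma modulus_mean_powR p f S : 1 <= p -> measurable S -> 0 < vol m S ->
  cintegrable f ->
  ((modulus (mean m f S) `^ p * vol m S)%:E <=
   (4 `^ p)%:E * \int[m]_(x in S) (modulus (f x) `^ p)%:E)%E.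
Proof.
move=> p1 mS S0 cf; have p0 : 0 < p by rewrite (lt_le_trans ltr01).
have cm := cintegrable_cmeas cf.
have mm : measurable_fun setT (fun x => modulus (f x)) by exact:
  measurable_modulus.
have mmp := measurable_modulusp p cm.
set J := (\int[m]_(x in S) (modulus (f x) `^ p)%:E)%E.
have J0 : (0 <= J)%E by apply: integral_ge0 => x _; rewrite lee_fin powR_ge0.
have [->|Joo] := eqVneq J +oo%E.
  by rewrite gt0_muley ?leey// lte_fin powR_gt0.
have Jfin : J = (fine J)%:E by rewrite fineK// ge0_fin_numE// ltey.
set j := fine J in Jfin.
have j0 : 0 <= j by rewrite -lee_fin -Jfin.
(* The modulus is bounded by [t + t^(1-p) |f|^p]; with the factor 2 of [le_modulus_mean], each of
   the two parts contributes at most [2 * t]. *)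
have ineq (t : R) : 0 < t -> j <= t `^ p * vol m S -> modulus (mean m f S) <= 4
  * t.
  move=> t0 jt; rewrite -lee_fin.
  apply: le_trans (le_modulus_mean mS S0 cf) _.
  apply: (@le_trans _ _ ((2 / vol m S)%:E * \int[m]_(x in S) (t%:E + (t `^ (1 -
    p))%:E * (modulus (f x) `^ p)%:E))%E).
    rewrite lee_wpmul2l ?lee_fin ?divr_ge0 ?(ltW S0)//.
    apply: ge0_le_integral => //.
    - by move=> x _; rewrite lee_fin modulus_ge0.
    - by apply: measurable_funTS; exact/measurable_EFinP.
    - apply: measurable_funTS; apply: emeasurable_funD => //.
      by apply: emeasurable_funM.
    - move=> x _; rewrite -EFinM -EFinD lee_fin.
      have [mt|tm] := leP (modulus (f x)) t.
        by rewrite (le_trans mt)// lerDl mulr_ge0 ?powR_ge0.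
      have m0 : 0 < modulus (f x) by exact: lt_trans tm.
      apply: (@le_trans _ _ (t `^ (1 - p) * modulus (f x) `^ p)); last first.
        by rewrite lerDr ltW.
      rewrite -[leLHS]powRr1 ?(ltW m0)// -[X in _ `^ X](subrK p).
      rewrite powRD; last by rewrite (gt_eqF m0) implybT.
      rewrite ler_wpM2r ?powR_ge0// -[1 - p]opprB !powRN lef_pV2 ?posrE
        ?powR_gt0//.
      by rewrite ge0_ler_powR ?subr_ge0 ?nnegrE ?(ltW t0) ?(ltW m0) ?(ltW tm).
  have h1 x : S x -> (0 <= t%:E)%E by rewrite lee_fin ltW.
  have h2 x : S x -> (0 <= (t `^ (1 - p))%:E * (modulus (f x) `^ p)%:E)%E.
    by rewrite -EFinM lee_fin mulr_ge0 ?powR_ge0.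
  have h3 : measurable_fun S (fun x => (t `^ (1 - p))%:E * (modulus (f x) `^
    p)%:E)%E.
    by apply: measurable_funTS; apply: emeasurable_funM.
  rewrite ge0_integralD// integral_cst// ge0_integralZl_EFin ?powR_ge0//; last
    2 first.
  - by move=> x _; rewrite lee_fin powR_ge0.
  - exact: measurable_funTS.
  rewrite -/J Jfin (volE m1 mS).
  rewrite -(EFinM t) -(EFinM (t `^ (1 - p))) -EFinD -EFinM lee_fin.
  rewrite mulrAC ler_pdivrMr// -mulrA mulrDr.
  rewrite (_ : 4 * (t * vol m S) = 2 * (t * vol m S) + 2 * (t * vol m S)); last
    by ring.
  rewrite lerD2l ler_wpM2l//.
  apply: (@le_trans _ _ (t `^ (1 - p) * (t `^ p * vol m S))).
    by rewrite ler_wpM2l ?powR_ge0.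
  rewrite mulrA -powRD ?subrK ?powRr1 ?(ltW t0)//.
  by rewrite (gt_eqF t0) implybT.
have jv0 : 0 <= j / vol m S by rewrite divr_ge0 ?(ltW S0).
have main : modulus (mean m f S) <= 4 * (j / vol m S) `^ p^-1.
  (* The optimal [t] vanishes when [j = 0], so a margin is added to keep it positive. *)
  apply/ler_addgt0Pr => e e0.
  have e4 : 0 < e / 4 by rewrite divr_gt0.
  have := ineq ((j / vol m S) `^ p^-1 + e / 4).
  rewrite mulrDr mulrCA divff ?mulr1 ?pnatr_eq0//; apply.
    by rewrite ltr_wpDl ?powR_ge0.
  rewrite -ler_pdivrMr//.
  apply: (@le_trans _ _ (((j / vol m S) `^ p^-1) `^ p)).
    by rewrite -powRrM mulVf ?gt_eqF// powRr1.
  by rewrite ge0_ler_powR ?(ltW p0) ?nnegrE ?addr_ge0 ?powR_ge0 ?(ltW e4)//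
    lerDl ltW.
rewrite Jfin -EFinM lee_fin -ler_pdivlMr//.
apply: (@le_trans _ _ ((4 * (j / vol m S) `^ p^-1) `^ p)).
  by rewrite ge0_ler_powR ?(ltW p0) ?nnegrE ?modulus_ge0 ?mulr_ge0 ?powR_ge0.
by rewrite powRM ?powR_ge0// -powRrM mulVf ?gt_eqF// powRr1// mulrA.
Qed.

Lemma mean_dist (w : R[i]) (L : R) f S : measurable S -> 0 < vol m S ->
  cintegrable f -> (forall x, S x -> modulus (f x - w) <= L) ->
  modulus (mean m f S - w) <= 2 * L.
Proof.
move=> mS S0 cf fL.
have cw : cintegrable (fun=> w) by exact: cintegrable_cst.
have -> : mean m f S - w = mean m (fun x => f x - w) S.
  by rewrite meanB// (mean_cst (z := w) (f := fun=> w)).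
have cfw : cintegrable (fun x => f x - w) by exact: cintegrableB.
rewrite -lee_fin; apply: le_trans (le_modulus_mean mS S0 cfw) _.
apply: (@le_trans _ _ ((2 / vol m S)%:E * \int[m]_(x in S) (cst L%:E x))%E).
  rewrite lee_wpmul2l ?lee_fin ?divr_ge0 ?(ltW S0)//.
  apply: ge0_le_integral => //.
  - by move=> x _; rewrite lee_fin modulus_ge0.
  - apply: measurable_funTS; apply/measurable_EFinP; apply: measurable_modulus.
    exact: cintegrable_cmeas.
rewrite integral_cst// (volE m1 mS) -!EFinM lee_fin.
by rewrite mulrAC -mulrA mulfK ?gt_eqF.
Qed.

End Means.

(** * The martingale of a grid *)

Section Martingale.
Context d (T : measurableType d) (R : realType).
Variable m : {measure set T -> \bar R}.
Hypothesis m1 : m setT = 1%E.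
Variables (X : set T) (G : nat -> set (set T)).
Hypothesis nX : m.-negligible (~` X).
Hypothesis pgG : partition_grid m X G.
Implicit Types (f g h : T -> R[i]) (S : set T) (p : R).

Notation mart f k := (martingale m G f k).

Lemma pg_regular x : X x -> regular_points G x.
Proof.
move=> Xx k; have [S GS Sx] := pg_cover pgG k Xx; exists S; split=> //.
by move=> S' [GS' S'x]; exact: (pg_disj pgG GS GS' Sx S'x).
Qed.

Lemma pg_regular_negligible : m.-negligible (~` regular_points G).
Proof. by apply: negligibleS nX; apply: subsetC => x; exact: pg_regular. Qed.

Lemma pg_ae : {ae m, forall x, X x}.
Proof. exact: nX. Qed.

Lemma martingaleE f k x :
  mart f k x = \sum_(S <- fset_set (G k)) mean m f S * (\1_S x)%:C%C.
Proof. by rewrite /martingale fsbig_finite//; exact: (pg_finite pgG). Qed.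

Lemma mart_cell f k S x : G k S -> S x -> mart f k x = mean m f S.
Proof.
move=> GS Sx; rewrite martingaleE.
rewrite (regular_sum (pg_finite pgG) (pg_regular (pg_sub pgG GS Sx)) GS Sx).
  by rewrite indicE mem_set// mulr1.
by move=> S' GS' S'x; rewrite indicE memNset// mulr0.
Qed.

Lemma mart_out f k x : ~ X x -> mart f k x = 0.
Proof.
move=> nXx; rewrite martingaleE big_seq big1// => S.
rewrite in_fset_set; last exact: (pg_finite pgG).
by move=> /set_mem GS; rewrite indicE memNset ?mulr0// => /(pg_sub pgG GS).
Qed.

Lemma cmeas_mart f k : cmeas (mart f k).
Proof.
rewrite (_ : mart f k = fun x => \sum_(S <- fset_set (G k))
   mean m f S * (\1_(if S \in fset_set (G k) then S else set0) x)%:C%C).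
  apply: cmeas_sum => S; apply: cmeasM; first exact: cmeas_cst.
  apply: cmeas_real; apply: measurable_indic; case: ifPn => //.
  rewrite in_fset_set; last exact: (pg_finite pgG).
  by move=> /set_mem; exact: (pg_meas pgG).
apply/funext => x; rewrite martingaleE; apply: eq_big_seq => S SG.
by rewrite SG.
Qed.

Lemma martD f g k : cintegrable m f -> cintegrable m g ->
  mart (fun x => f x + g x) k = (fun x => mart f k x + mart g k x).
Proof.
move=> cf cg; apply/funext => x; have [Xx|nXx] := pselect (X x).
  have [S GS Sx] := pg_cover pgG k Xx; rewrite !(mart_cell _ GS Sx) meanD//.
  exact: (pg_meas pgG GS).
by rewrite !mart_out// addr0.
Qed.

Lemma martZ z f k : cintegrable m f ->
  mart (fun x => z * f x) k = (fun x => z * mart f k x).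
Proof.
move=> cf; apply/funext => x; have [Xx|nXx] := pselect (X x).
  have [S GS Sx] := pg_cover pgG k Xx; rewrite !(mart_cell _ GS Sx) meanZ//.
  exact: (pg_meas pgG GS).
by rewrite !mart_out// mulr0.
Qed.

Lemma mart_cst0 k : mart (fun=> 0) k = (fun=> 0).
Proof.
apply/funext => x; have [Xx|nXx] := pselect (X x); last by rewrite mart_out.
have [S GS Sx] := pg_cover pgG k Xx; rewrite (mart_cell _ GS Sx).
apply: mean_cst => //; first exact: (pg_meas pgG GS).
exact: (pg_vol_gt0 m1 pgG GS).
Qed.

Lemma mart_fix f k x : (forall S y z, G k S -> S y -> S z -> f y = f z) ->
  X x -> mart f k x = f x.
Proof.
move=> fc Xx; have [S GS Sx] := pg_cover pgG k Xx; rewrite (mart_cell _ GS Sx).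
apply: mean_cst => //; first exact: (pg_meas pgG GS).
  exact: (pg_vol_gt0 m1 pgG GS).
by move=> y Sy; exact: fc GS Sy Sx.
Qed.

(** [modulus_mean_powR] on each cell, summed over the level; the constant 4 is inherited from
    there. *)
Lemma mart_Lp p f k : 1 <= p -> cintegrable m f ->
  (Lpnorm m p (mart f k) <= 4%:E * Lpnorm m p f)%E.
Proof.
move=> p1 cf; have p0 : 0 < p by rewrite (lt_le_trans ltr01).
have pn0 := lt0r_neq0 p0.
have Lf0 := Lpnorm_ge0 m p f.
rewrite -(lee_poweR p0) ?Lpnorm_ge0 ?mule_ge0//.
rewrite (Lpnorm_powE m _ pn0) poweRM// poweR_EFin (Lpnorm_powE m f pn0).
have int g : cmeas g -> (\int[m]_x (modulus (g x) `^ p)%:E =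
    \sum_(S <- fset_set (G k)) \int[m]_(x in S) (modulus (g x) `^ p)%:E)%E.
  move=> cg; apply: (ae_partition_integral (pg_finite pgG) _
    pg_regular_negligible).
  - by move=> j S; exact: (pg_meas pgG).
  - exact: measurable_modulusp.
  - by move=> x; rewrite lee_fin powR_ge0.
rewrite (int _ (cmeas_mart f k)) (int _ (cintegrable_cmeas cf)).
rewrite ge0_sume_distrr; last first.
  by move=> S _; apply: integral_ge0 => x _; rewrite lee_fin powR_ge0.
rewrite big_seq [leRHS]big_seq; apply: lee_sum => S.
rewrite in_fset_set; last exact: (pg_finite pgG).
move=> /set_mem GS; have mS := pg_meas pgG GS.
apply: le_trans (modulus_mean_powR m1 p1 mS (pg_vol_gt0 m1 pgG GS) cf).
rewrite (_ : (\int[m]_(x in S) _)%E =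
             \int[m]_(x in S) cst (modulus (mean m f S) `^ p)%:E x)%E.
  by rewrite integral_cst// (volE m1 mS) EFinM.
by apply: eq_integral => x /set_mem Sx; rewrite (mart_cell _ GS Sx).
Qed.

Notation dif f k := (mdiff m G f k).

Lemma cmeas_mdiff f k : cmeas (dif f k).
Proof.
apply: cmeasB; first exact: cmeas_mart.
by case: k => [|k]; [exact: cmeas_cst|exact: cmeas_mart].
Qed.

Lemma mdiffD f g k : cintegrable m f -> cintegrable m g ->
  dif (fun x => f x + g x) k = (fun x => dif f k x + dif g k x).
Proof.
move=> cf cg; apply/funext => x; rewrite /mdiff; case: k => [|k].
  by rewrite martD// !subr0.
by rewrite !martD// opprD addrACA.
Qed.

Lemma mdiffZ z f k : cintegrable m f ->
  dif (fun x => z * f x) k = (fun x => z * dif f k x).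
Proof.
move=> cf; apply/funext => x; rewrite /mdiff; case: k => [|k].
  by rewrite martZ// !subr0.
by rewrite !martZ// mulrBr.
Qed.

Lemma mdiff_big (I : Type) (s : seq I) (F : I -> T -> R[i]) k :
  (forall i, cintegrable m (F i)) ->
  dif (fun x => \sum_(i <- s) F i x) k = (fun x => \sum_(i <- s) dif (F i) k x).
Proof.
move=> cF; elim: s => [|i s IH].
  apply/funext => x; rewrite big_nil; under eq_fun do rewrite big_nil.
  by rewrite /mdiff; case: k => [|k]; rewrite !mart_cst0 subr0.
apply/funext => x; under eq_fun do rewrite big_cons.
rewrite mdiffD//; last exact: cintegrable_sum.
by rewrite IH big_cons.
Qed.

Lemma mdiff_Lp p f k : 1 <= p -> cintegrable m f ->
  (Lpnorm m p (dif f k) <= 8%:E * Lpnorm m p f)%E.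
Proof.
move=> p1 cf; have p0 : 0 < p by rewrite (lt_le_trans ltr01).
have Lf0 := Lpnorm_ge0 m p f.
apply: (@le_trans _ _ (4%:E * Lpnorm m p f + 4%:E * Lpnorm m p f)%E); last
  first.
  by rewrite -ge0_muleDl// -EFinD -natrD.
case: k => [|k].
  rewrite [X in Lpnorm _ _ X](_ : _ = mart f 0%N).
    by apply: le_trans (mart_Lp 0 p1 cf) _; rewrite leeDl// mule_ge0.
  by apply/funext => x; rewrite /mdiff subr0.
apply: le_trans (Lpnorm_triangleB m p1 (cmeas_mart f k.+1) (cmeas_mart f k)) _.
by apply: leeD; exact: mart_Lp.
Qed.

Lemma sum_mdiff f n x : \sum_(j < n.+1) dif f j x = mart f n x.
Proof.
elim: n => [|n IH]; first by rewrite big_ord_recr big_ord0/= add0r /mdiff subr0.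
by rewrite big_ord_recr IH/= /mdiff addrC subrK.
Qed.

Lemma mdiff_cell f k S x y : G k S -> S x -> S y -> dif f k x = dif f k y.
Proof.
move=> GS Sx Sy; rewrite /mdiff !(mart_cell _ GS Sx) (mart_cell _ GS Sy).
case: k GS => [//|k] GS; have [S' GS' SS'] := pg_nested pgG GS.
by rewrite (mart_cell _ GS' (SS' _ Sx)) (mart_cell _ GS' (SS' _ Sy)).
Qed.

(** Such a function is also constant on the cells of level [k.+1], hence equals its conditional
    expectations at both levels. This discards the interior part of an atom. *)
Lemma mdiff_saturated f k x : (forall S y z, G k S -> S y -> S z -> f y = f z)
  ->
  X x -> dif f k.+1 x = 0.
Proof.
move=> fc Xx; rewrite /mdiff (mart_fix fc Xx) mart_fix ?subrr//.
move=> S y z GS Sy Sz; have [S' GS' SS'] := pg_nested pgG GS.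
by apply: fc GS' _ _; exact: SS'.
Qed.

(** Both means are taken over subsets of [S], so each lies within [2 * L] of the value [f x]. With
    [L = 0] the lemma localises increments: they vanish at [x] if [f] vanishes on the whole cell
    [S]. *)
Lemma mdiff_osc f k S x (L : R) : cintegrable m f -> G k S -> S x ->
  (forall y z, S y -> S z -> modulus (f y - f z) <= L) ->
  modulus (dif f k.+1 x) <= 4 * L.
Proof.
move=> cf GS Sx fL; have Xx := pg_sub pgG GS Sx.
have [S' GS' S'x] := pg_cover pgG k.+1 Xx.
have S'S : S' `<=` S := pg_level_sub pgG GS GS' Sx S'x (leqnSn k).
rewrite /mdiff (mart_cell _ GS Sx) (mart_cell _ GS' S'x).
rewrite (_ : mean m f S' - _ = (mean m f S' - f x) - (mean m f S - f x)); last
  first.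
  by rewrite opprB addrA subrK.
apply: le_trans (modulusD _ _) _; rewrite modulusN.
rewrite (_ : 4 * L = 2 * L + 2 * L); last by ring.
apply: lerD; apply: mean_dist => //.
- exact: (pg_meas pgG GS').
- exact: (pg_vol_gt0 m1 pgG GS').
- by move=> y S'y; apply: fL => //; exact: S'S.
- exact: (pg_meas pgG GS).
- exact: (pg_vol_gt0 m1 pgG GS).
- by move=> y Sy; exact: fL.
Qed.

End Martingale.

(** * From molecular expansions to martingale differences *)

Section Molecules.
Context d (T : measurableType d) (R : realType).
Variable m : {measure set T -> \bar R}.
Hypothesis m1 : m setT = 1%E.
Variables (X : set T) (G : nat -> set (set T)).
Hypothesis nX : m.-negligible (~` X).
Hypothesis pgG : partition_grid m X G.
Variables (th1 th2 : R) (ell : nat -> R).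
Hypotheses (th1_gt0 : 0 < th1) (th201 : 0 < th2 < 1).
Hypothesis ell_gt0 : forall k, 0 < ell k.
Hypothesis ellS : forall k, th1 * ell k <= ell k.+1 <= th2 * ell k.
Variables (W : nat -> set (set T)) (th : R) (beta : nat -> R).
Hypothesis finW : forall k, finite_set (W k).
Hypothesis th01 : 0 < th < 1.
Hypothesis beta_gt0 : forall k, 0 < beta k.
Hypothesis betaS : forall k, beta k.+1 <= th * beta k.
Variables (p s e : R) (q : \bar R).
Hypotheses (p1 : 1 <= p) (q1 : (1 <= q)%E) (s0 : 0 < s) (e0 : 0 < e).
Variables (b : set T -> T -> R[i]) (B : set T -> set T) (C N cc : R).
Hypotheses (C0 : 0 <= C) (N0 : 0 <= N) (cc0 : 0 < cc).
Hypothesis b_meas : forall j Q, W j Q -> cmeas (b Q).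
Hypothesis b_norm : forall j Q, W j Q ->
  (Lpnorm m p (b Q) <= (C * beta j `^ s)%:E)%E.
(** The increment of level [k.+1] depends on the variation of the molecule inside cells of level
    [k], hence the scale [ell k]. After division by [ell k ^ s] there remains the gain
    [(ell k / beta j) ^ e]. *)
Hypothesis b_diff : forall j k Q, W j Q -> ell k <= cc * beta j ->
  (Lpnorm m p (mdiff m G (b Q) k.+1) <=
   (C * beta j `^ s * (ell k / beta j) `^ (s + e))%:E)%E.
Hypothesis B_overlap : forall j x, X x ->
  \sum_(Q <- fset_set (W j)) (`[< B Q x >])%:R <= N.
Hypothesis b_supp : forall j Q x, W j Q -> X x -> ~ B Q x -> b Q x = 0.
Hypothesis B_saturated : forall j k Q S, W j Q -> ell k <= cc * beta j ->
  G k S -> (exists x, S x /\ B Q x) -> S `<=` B Q.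

Let p0 : 0 < p. Proof. by rewrite (lt_le_trans ltr01). Qed.

Section Level.
Variables (c : set T -> R[i]) (j : nat).
Let g := level W c b j.
Let sig := (\sum_(Q <- fset_set (W j)) modulus (c Q) `^ p) `^ p^-1.

Let gE : g = fun x => \sum_(Q <- fset_set (W j)) c Q * b Q x.
Proof. by apply/funext => x; rewrite /g /level fsbig_finite. Qed.

Let inW Q : Q \in fset_set (W j) -> W j Q.
Proof. by rewrite in_fset_set// => /set_mem. Qed.

Lemma level_norm : (Lpnorm m p g <= (N * (C * beta j `^ s) * sig)%:E)%E.
Proof.
rewrite gE; apply: (@Lpnorm_overlap_in _ _ _ m p _ _ _ _ (fun Q x => `[< B Q x
  >])) => //.
- by rewrite mulr_ge0 ?powR_ge0.
- by move=> Q /inW; exact: b_meas.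
- by move=> Q /inW; exact: b_norm.
apply: filterS (pg_ae nX) => x Xx; split; last exact: B_overlap.
by move=> Q /inW WQ /asboolPn; exact: b_supp WQ Xx.
Qed.

Lemma level_cmeas : cmeas g.
Proof.
rewrite gE (_ : (fun x => _) = fun x =>
    \sum_(Q <- fset_set (W j)) c Q * (if Q \in fset_set (W j) then b Q else
      fun=> 0) x); last first.
  by apply/funext => x; apply: eq_big_seq => Q ->.
apply: cmeas_sum => Q; apply: cmeasM; first exact: cmeas_cst.
by case: ifPn => [/inW/b_meas//|_]; exact: cmeas_cst.
Qed.

Lemma level_cintegrable : cintegrable m g.
Proof.
apply: (Lp_cintegrable m1 p1 level_cmeas).
exact: le_lt_trans level_norm (ltry _).
Qed.

Let b_cintegrable Q : W j Q -> cintegrable m (b Q).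
Proof.
move=> WQ; apply: (Lp_cintegrable m1 p1 (b_meas WQ)).
exact: le_lt_trans (b_norm WQ) (ltry _).
Qed.

Lemma level_mdiff_small k : ell k <= cc * beta j ->
  (Lpnorm m p (mdiff m G g k.+1) <=
   (N * (C * beta j `^ s * (ell k / beta j) `^ (s + e)) * sig)%:E)%E.
Proof.
move=> kj.
pose b' Q := if Q \in fset_set (W j) then b Q else (fun=> 0).
have b'i Q : cintegrable m (b' Q).
  rewrite /b'; case: ifPn => [/inW|_]; first exact: b_cintegrable.
  exact: cintegrable_cst.
rewrite (_ : g = fun x => \sum_(Q <- fset_set (W j)) c Q * b' Q x); last first.
  by rewrite gE; apply/funext => x; apply: eq_big_seq => Q QW; rewrite /b' QW.
rewrite (mdiff_big m1 pgG); last by move=> Q; exact: cintegrableZ.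
under eq_fun do under eq_bigr do rewrite (mdiffZ pgG)//.
apply: (@Lpnorm_overlap_in _ _ _ m p _ _ _ _ (fun Q x => `[< B Q x >])) => //.
- by rewrite !mulr_ge0 ?powR_ge0.
- by move=> Q _; exact: (cmeas_mdiff pgG).
- by move=> Q QW; rewrite /b' QW; apply: b_diff => //; exact: inW.
apply: filterS (pg_ae nX) => x Xx; split; last exact: B_overlap.
(* By saturation the whole cell of level [k] through a point off [B Q] misses [B Q], so the molecule
   vanishes on it, and so does its increment. *)
move=> Q QW /asboolPn nB; rewrite /b' QW.
have [S GS Sx] := pg_cover pgG k Xx.
have b0 y : S y -> b Q y = 0.
  move=> Sy; apply: (b_supp (inW QW)); first exact: (pg_sub pgG GS Sy).
  by move=> By; apply: nB; apply: (B_saturated (inW QW) kj GS) => //; exists y.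
apply: modulus_eq0; apply/eqP; rewrite eq_le modulus_ge0 andbT.
rewrite -[leRHS](mulr0 4); apply: (mdiff_osc m1 pgG _ GS Sx).
  exact: b_cintegrable (inW QW).
by move=> y z Sy Sz; rewrite !b0// subrr modulus0.
Qed.

End Level.

Lemma beta_le0 j : beta j <= beta 0%N.
Proof.
elim: j => [//|j IH]; apply: le_trans IH; apply: le_trans (betaS j) _.
by case/andP: th01 => _ th1'; rewrite ger_pMl ?ltW.
Qed.

Lemma level_mdiff : exists2 D : R, 0 <= D & forall c j k,
  (Lpnorm m p (mdiff m G (level W c b j) k) <=
   (ell k `^ s * (D * kern s e (ell k) (beta j)) *
    (\sum_(Q <- fset_set (W j)) modulus (c Q) `^ p) `^ p^-1)%:E)%E.
Proof.
pose a := s + e.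
have a0 : 0 < a by rewrite addr_gt0.
(* The entries serve, in order: [D ^ a >= 1], the case [k = 0], the passage from [ell k'] to
   [ell k], and cells of [G] too coarse for [b_diff]. *)
pose D := Num.max 1 (Num.max (beta 0 / ell 0) (Num.max th1^-1 (cc * th1)^-1)).
have D1 : 1 <= D by rewrite /D le_max lexx.
have D0 : 0 < D by rewrite (lt_le_trans ltr01).
exists (8 * (N * C) * D `^ a); first by rewrite !mulr_ge0 ?powR_ge0.
move=> c j k; set sig := _ `^ p^-1.
have sig0 : 0 <= sig by exact: powR_ge0.
have NC0 : 0 <= N * C by rewrite mulr_ge0.
have [l0 bj0] := (ell_gt0 k, beta_gt0 j).
have lb0 : 0 < ell k / beta j by rewrite divr_gt0.
have D0' := ltW D0; have lb0' := ltW lb0; have a0' := ltW a0.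
have DL0 : 0 <= D * (ell k / beta j) by rewrite mulr_ge0.
have crude : (Lpnorm m p (mdiff m G (level W c b j) k) <=
    (8 * (N * C) * beta j `^ s * sig)%:E)%E.
  apply: le_trans (mdiff_Lp m1 nX pgG k p1 (level_cintegrable c j)) _.
  apply: (@le_trans _ _ (8%:E * (N * (C * beta j `^ s) * sig)%:E)%E).
    by rewrite lee_wpmul2l// level_norm.
  by rewrite -EFinM lee_fin !mulrA.
have fine_bd : (Lpnorm m p (mdiff m G (level W c b j) k) <=
    (8 * (N * C) * beta j `^ s * (D `^ a * (ell k / beta j) `^ a) * sig)%:E)%E.
  have large : beta j <= D * ell k -> (Lpnorm m p (mdiff m G (level W c b j) k)
    <=
    (8 * (N * C) * beta j `^ s * (D `^ a * (ell k / beta j) `^ a) * sig)%:E)%E.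
    move=> bD; apply: (le_trans crude); rewrite lee_fin ler_wpM2r//.
    rewrite ler_peMr ?mulr_ge0 ?powR_ge0// -powRM//.
    rewrite [leLHS](_ : 1 = 1 `^ a); last by rewrite powR1.
    rewrite ge0_ler_powR ?nnegrE//.
    by rewrite mulrA ler_pdivlMr// mul1r.
  have [k0|[k' kk']] : k = 0%N \/ exists k', k = k'.+1.
  - by case: (k) => [|k']; [left|right; exists k'].
  - apply: large; rewrite k0; apply: (le_trans (beta_le0 j)).
    by rewrite -ler_pdivrMr// /D !le_max lexx orbT.
  have lk' : ell k' <= th1^-1 * ell k.
    by rewrite -ler_pdivrMl ?invr_gt0// invrK kk'; case/andP: (ellS k').
  have [small|big] := leP (ell k') (cc * beta j); last first.
    apply: large; apply: (@le_trans _ _ ((cc * th1)^-1 * ell k)); last first.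
      by rewrite ler_wpM2r ?(ltW l0)// /D !le_max lexx !orbT.
    rewrite invfM -mulrA ler_pdivlMl//.
    by rewrite (le_trans (ltW big)).
  rewrite kk'; apply: le_trans (level_mdiff_small c small) _.
  rewrite lee_fin ler_wpM2r// -/a -kk'.
  apply: (@le_trans _ _ (N * (C * beta j `^ s * (D `^ a * (ell k / beta j) `^
    a)))).
    rewrite ler_wpM2l// ler_wpM2l ?mulr_ge0 ?powR_ge0//.
    have lk0 : 0 <= ell k' / beta j.
      by rewrite divr_ge0 ?(ltW (ell_gt0 _)) ?(ltW bj0).
    rewrite -powRM// ge0_ler_powR ?nnegrE//.
    rewrite mulrA ler_wpM2r ?invr_ge0 ?(ltW bj0)//.
    apply: (le_trans lk'); rewrite ler_wpM2r ?(ltW l0)//.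
    by rewrite /D !le_max lexx !orbT.
  rewrite !mulrA ler_wpM2r ?powR_ge0// ler_wpM2r ?powR_ge0// ler_wpM2r
    ?powR_ge0//.
  by rewrite -mulrA ler_peMl// ler1n.
have DA : 1 <= D `^ a.
  rewrite [leLHS](_ : 1 = 1 `^ a); last by rewrite powR1.
  by rewrite ge0_ler_powR ?nnegrE.
pose K := 8 * (N * C) * D `^ a.
have K0 : 0 <= K by rewrite !mulr_ge0 ?powR_ge0.
have ls0 := powR_ge0 (ell k) s.
apply: (@le_trans _ _ (K * Num.min (beta j `^ s)
    (beta j `^ s * (ell k / beta j) `^ a) * sig)%:E).
  have [le|lt] := leP (beta j `^ s) (beta j `^ s * (ell k / beta j) `^ a).
    apply: (le_trans crude); rewrite lee_fin ler_wpM2r// ler_wpM2r ?powR_ge0//.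
    by rewrite /K ler_peMr// mulr_ge0.
  apply: (le_trans fine_bd); rewrite lee_fin le_eqVlt; apply/orP; left.
  by apply/eqP; rewrite /K; ring.
rewrite lee_fin ler_wpM2r// [leRHS]mulrCA ler_wpM2l//.
rewrite /kern minr_pMr// le_eqVlt; apply/orP; left; apply/eqP; congr (Num.min _
  _).
  by rewrite -powRM ?divr_ge0 ?(ltW l0) ?(ltW bj0)// mulrCA mulfV ?gt_eqF//
    mulr1.
rewrite /a powRD ?(gt_eqF lb0) ?implybT// mulrA -powRM ?(ltW bj0)//.
by rewrite mulrCA mulfV ?gt_eqF// mulr1.
Qed.

(** On a partial sum the increments are bounded level by level; the remainder tends to 0 in L^p,
    where taking an increment is a bounded operation, so the estimate survives the limit and
    [kern_lq] applies. *)
Lemma molecules_gt c f : (forall k, ell k = maxvol m G k) ->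
  expands m W p q c b f -> gt_besov m G s p q f.
Proof.
move=> ellE [fLp _ flim cq]; split; first exact: inLp_inL1 fLp.
have cf := inLp_cintegrable m1 p1 fLp.
have [D D0 DP] := level_mdiff.
pose sig j := ((\sum_(Q <- fset_set (W j)) modulus (c Q) `^ p) `^ p^-1).
have sig0 j : (0 <= (sig j)%:E)%E by rewrite lee_fin powR_ge0.
have {}cq : (lqnorm q (EFin \o sig) < +oo)%E.
  apply: le_lt_trans cq; rewrite le_eqVlt; apply/orP; left; apply/eqP.
  by congr lqnorm; apply/funext => j; rewrite /= /sig fsbig_finite.
have th2_01 := th201.
apply: (kern_lq (a := ell) (b := beta) (tha := th2) (thb := th) (C := D)
   (u := EFin \o sig) q1 s0 e0) => //.
- by move=> k; case/andP: (ellS k).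
- by move=> k; rewrite mule_ge0 ?lee_fin ?powR_ge0 ?Lpnorm_ge0.
move=> k; rewrite -ellE.
pose Sm := (\sum_(0 <= j <oo) (D * kern s e (ell k) (beta j))%:E * (sig
  j)%:E)%E.
have t0 j : (0 <= (D * kern s e (ell k) (beta j))%:E * (sig j)%:E)%E.
  by rewrite mule_ge0// lee_fin mulr_ge0 ?kern_ge0.
have Sm0 : (0 <= Sm)%E by apply: nneseries_ge0.
rewrite powRN lee_pdivrMl ?powR_gt0// -/Sm.
have bound n : (Lpnorm m p (mdiff m G f k) <= (ell k `^ s)%:E * Sm +
    8%:E * Lpnorm m p (fun x => f x - \sum_(i < n) level W c b i x)%R)%E.
  set r := (fun x => _).
  have cg i : cintegrable m (level W c b i) by exact: level_cintegrable.
  have cS : cintegrable m (fun x => \sum_(i < n) level W c b i x).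
    exact: cintegrable_sum.
  have cr : cintegrable m r by exact: cintegrableB.
  rewrite [X in mdiff m G X k](_ : f = fun x => (\sum_(i < n) level W c b i x)
    + r x); last first.
    by apply/funext => x; rewrite /r addrC subrK.
  rewrite (mdiffD pgG)//; apply: le_trans (Lpnorm_triangle m p1 (cmeas_mdiff
    pgG _ _) (cmeas_mdiff pgG _ _)) _.
  apply: leeD; last exact: (mdiff_Lp m1 nX pgG).
  rewrite (mdiff_big m1 pgG)//.
  apply: le_trans (Lpnorm_sum _ _ _ _) _ => //.
    by move=> i; exact: (cmeas_mdiff pgG).
  apply: (@le_trans _ _ (\sum_(i < n) (ell k `^ s)%:E * ((D * kern s e (ell k)
    (beta i))%:E * (sig i)%:E))%E).
    by apply: lee_sum => i _; rewrite muleA -!EFinM; exact: DP.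
  rewrite -ge0_sume_distrr//.
  rewrite lee_wpmul2l ?lee_fin ?powR_ge0//.
  rewrite -(big_mkord xpredT (fun i => (D * kern s e (ell k) (beta i))%:E *
    (sig i)%:E)%E).
  exact: nneseries_lim_ge.
set A := ((ell k `^ s)%:E * Sm)%E in bound *.
have [->|Aoo] := eqVneq A +oo%E; first by rewrite leey.
have A0 : (0 <= A)%E by rewrite mule_ge0// lee_fin powR_ge0.
have lim : (A + 8%:E * Lpnorm m p (fun x => f x - \sum_(i < n) level W c b i
  x)%R)%E
    @[n --> \oo] --> (A + 8%:E * 0)%E.
  apply: cvgeD; first by rewrite mule0 fin_num_adde_defl.
    exact: cvg_cst.
  exact: cvgeZl.
rewrite mule0 adde0 in lim.
rewrite -(cvg_lim _ lim)//; apply: lime_ge; first by apply/cvg_ex; exists A.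
exact: nearW.
Qed.

End Molecules.

(** * Recovering a function from its martingale *)

Section Uniqueness.
Context d (T : measurableType d) (R : realType).
Variable m : {measure set T -> \bar R}.

(** Pi-lambda argument on the sets over which the positive and negative parts of [h] have the same
    integral; separating them keeps all integrals nonnegative under differences and increasing
    unions. The vanishing of the integral over [S] puts [X] in the lambda-system. *)
Lemma integral0_ae (X S : set T) (GG : set (set T)) (h : T -> \bar R) :
  <<s X, GG >> = [set A | measurable A /\ A `<=` X] -> setI_closed GG ->
  measurable X -> measurable S -> S `<=` X -> m.-integrable setT h ->
  (forall C, GG C -> \int[m]_(x in C `&` S) h x = 0)%E ->
  (\int[m]_(x in S) h x = 0)%E ->
  {ae m, forall x, S x -> h x = 0%E}.
Proof.
move=> gen GGI mX mS SX ih hC hS.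
have mh : measurable_fun setT h by exact: measurable_int ih.
have ihA A : measurable A -> m.-integrable A h.
  by move=> mA; apply: integrableS ih.
have [mhp mhn] : measurable_fun setT h^\+%E /\ measurable_fun setT h^\-%E.
  by split; [exact: measurable_funepos|exact: measurable_funeneg].
have fp A : measurable A -> (\int[m]_(x in A) h^\+ x)%E \is a fin_num.
  by move=> mA; apply: integrable_pos_fin_num (ihA _ mA).
have fn A : measurable A -> (\int[m]_(x in A) h^\- x)%E \is a fin_num.
  by move=> mA; apply: integrable_neg_fin_num (ihA _ mA).
have hpnP A : measurable A -> (\int[m]_(x in A) h x = 0)%E <->
    (\int[m]_(x in A) h^\+ x = \int[m]_(x in A) h^\- x)%E.
  move=> mA; rewrite integralE; split.
    by move/eqP; rewrite sube_eq ?add0e ?fp ?fn// ?fin_num_adde_defr ?fp// =>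
      /eqP.
  by move=> ->; rewrite subee// fn.
pose H := [set A | [/\ measurable A, A `<=` X &
   (\int[m]_(x in A `&` S) h^\+ x = \int[m]_(x in A `&` S) h^\- x)%E]].
have lH : lambda_system X H.
  split.
  - by move=> A [].
  - by split=> //; rewrite setIidr//; exact/hpnP.
  - move=> A B BA [mA AX eA] [mB BX eB]; split.
    + exact: measurableD.
    + by apply: subset_trans AX; exact: subDsetl.
    have dec g : measurable_fun setT g -> (forall x, 0 <= g x)%E ->
        (\int[m]_(x in A `&` S) g x = \int[m]_(x in B `&` S) g x +
         \int[m]_(x in (A `\` B) `&` S) g x)%E.
      move=> mg g0; rewrite -ge0_integral_setU//.
      - congr (integral _ _ _); rewrite -setIUl; congr (_ `&` _).
        by rewrite setDUK.
      - exact: measurableI.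
      - by apply: measurableI => //; exact: measurableD.
      - exact: measurable_funTS.
      - by apply/disj_setPS => x [[Bx _] [[_ nBx] _]].
    move: eA; rewrite (dec _ mhp)// (dec _ mhn)// eB => /eqP.
    have mBS : measurable (B `&` S) by exact: measurableI.
    have mABS : measurable ((A `\` B) `&` S).
      by apply: measurableI => //; exact: measurableD.
    rewrite -(fineK (fn _ mBS)) -(fineK (fn _ mABS)) -(fineK (fp _ mABS)).
    by rewrite -!EFinD eqe => /eqP/addrI ->.
  - move=> F Fnd HF; split.
    + by apply: bigcupT_measurable => n; case: (HF n).
    + by apply: bigcup_sub => n _; case: (HF n).
    rewrite setI_bigcupl.
    have nd : {homo (fun n => F n `&` S) : n k / (n <= k)%N >-> (n <= k)%O}.
      move=> n k nk; apply/subsetPset; apply: setSI; apply/subsetPset.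
      exact: Fnd.
    have mF n : measurable (F n `&` S) by case: (HF n) => mFn _ _; exact:
      measurableI.
    have lim g : measurable_fun setT g -> (forall x, 0 <= g x)%E ->
        (\int[m]_(x in F n `&` S) g x)%E @[n --> \oo] -->
        (\int[m]_(x in \bigcup_n (F n `&` S)) g x)%E.
      move=> mg g0; apply: (ge0_nondecreasing_set_cvg_integral nd) => // n.
      exact: measurable_funTS.
    have l1 := lim _ mhp (fun x => funepos_ge0 h x).
    have l2 := lim _ mhn (fun x => funeneg_ge0 h x).
    apply: (cvg_unique _ l1) => //.
    suff -> : (fun n => \int[m]_(x in F n `&` S) h^\+ x)%E =
      (fun n => \int[m]_(x in F n `&` S) h^\- x)%E by exact: l2.
    by apply/funext => n; case: (HF n).
have GGH : GG `<=` H.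
  move=> C GC; have : <<s X, GG >> C by exact: sub_sigma_algebra.
  rewrite gen => -[mC CX]; split=> //.
  by apply/hpnP; [exact: measurableI|exact: hC].
have XH : <<s X, GG >> `<=` H.
  by apply: (lambda_system_subset GGI lH GGH) => A; rewrite gen => -[].
apply: (@integral_ae_eq _ _ _ _ _ mS (cst 0%E)) => //.
  exact: ihA.
move=> E ES mE; rewrite integral0; apply/(hpnP E mE).
have [_ _] : H E by apply: XH; rewrite gen; split=> //; exact: subset_trans SX.
by rewrite setIidl.
Qed.

(* [f] is recovered from the absolutely convergent series of its increments
   because both have the same integrals over a generating family. *)
Lemma l1_series_ae (X : set T) (G : nat -> set (set T)) (a : nat -> T -> R)
    (f : T -> R) : partition_grid m X G ->
  <<s X, cells G >> = [set A | measurable A /\ A `<=` X] ->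
  m.-negligible (~` X) ->
  (forall k, measurable_fun setT (a k)) -> m.-integrable setT (EFin \o f) ->
  (\int[m]_x (\sum_(0 <= k <oo) `|a k x|%:E) < +oo)%E ->
  (forall k S n, G k S -> (k < n)%N ->
    \int[m]_(x in S) (\sum_(0 <= i < n) a i x) = \int[m]_(x in S) f x) ->
  {ae m, forall x, forall n,
    (`|f x - \sum_(0 <= i < n) a i x|%:E <= \sum_(n <= k <oo) `|a k x|%:E)%E}.
Proof.
move=> pgG gen nX ma intf aoo aS.
pose D x := (\sum_(0 <= k <oo) `|a k x|%:E)%E.
pose A n x := \sum_(0 <= i < n) a i x.
have mA n : measurable_fun setT (A n) by exact: measurable_sum.
have D0 x : (0 <= D x)%E by apply: nneseries_ge0 => k _ _; rewrite lee_fin.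
have AD n x : (`|A n x|%:E <= D x)%E.
  apply: (@le_trans _ _ (\sum_(0 <= i < n) `|a i x|%:E)%E).
    by rewrite sumEFin lee_fin; exact: ler_norm_sum.
  by apply: nneseries_lim_ge => k _; rewrite lee_fin.
have mD : measurable_fun setT D.
  apply: ge0_emeasurable_sum => [k x _ _|k _]; first by rewrite lee_fin.
  by apply/measurable_EFinP; apply: measurableT_comp.
have iD : m.-integrable setT D.
  apply/integrableP; split=> //.
  by under eq_integral do rewrite gee0_abs//.
(* The upper limit is measurable and defined everywhere; it is the sum of the series wherever [D] is
   finite. *)
pose F x := limn_esup (fun n => (A n x)%:E).
have mF : measurable_fun setT F.
  by apply: measurable_fun_limn_esup => n; exact/measurable_EFinP.
have cvgA x : D x \is a fin_num -> cvgn (fun n => A n x).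
  move=> Dfin; apply: (@normed_cvg _ R^o (fun k => a k x)).
  apply: nondecreasing_is_cvgn.
    by apply: nondecreasing_series => k _ _; exact: normr_ge0.
  exists (fine (D x)) => _ [n _ <-]; rewrite -lee_fin fineK//.
  rewrite /series/= -sumEFin; apply: nneseries_lim_ge => k _.
  by rewrite lee_fin.
have finD := integrable_ae measurableT iD.
have cvgF : {ae m, forall x, setT x -> (fun n => (A n x)%:E) @ \oo --> F x}.
  apply: filterS finD => x /(_ I)/cvgA cA _.
  have h : (fun n => (A n x)%:E) @ \oo --> (limn (fun n => A n x))%:E.
    by apply: cvg_EFin; [exact: nearW|exact: cA].
  by rewrite /F (cvg_limn_einf_sup h).2.
have dom S : measurable S -> m.-integrable S F /\
    (\int[m]_(x in S) (A n x)%:E)%E @[n --> \oo] --> (\int[m]_(x in S) F x)%E.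
  move=> mS; have [|||||iF _ lim] := @dominated_convergence _ T R m S mS
     (fun n x => (A n x)%:E) F D => //.
  - by move=> n; apply: measurable_funTS; exact/measurable_EFinP.
  - exact: measurable_funTS.
  - by apply: filterS cvgF => x + _; exact.
  - by apply: integrableS iD.
  - by apply: aeW => x n _; rewrite abse_EFin.
have [iF _] := dom _ measurableT.
have ih : m.-integrable setT (fun x => F x - (f x)%:E)%E by exact: integrableB.
have intA n S : measurable S -> (\int[m]_(x in S) (A n x)%:E)%E =
    (\int[m]_(x in S) A n x)%:E.
  move=> mS; rewrite /Rintegral fineK//; apply: integrable_fin_num => //.
  apply: (le_integrable mS _ _ (integrableS measurableT mS _ iD)) => //.
    by apply: measurable_funTS; exact/measurable_EFinP.
  by move=> x _; rewrite abse_EFin gee0_abs.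
have hS k S : G k S -> (\int[m]_(x in S) (F x - (f x)%:E) = 0)%E.
  move=> GS; have mS := pg_meas pgG GS; have [iFS lim] := dom _ mS.
  have ifS : m.-integrable S (EFin \o f) by apply: integrableS intf.
  rewrite integralB//; apply/eqP.
  have ffin : (\int[m]_(x in S) (EFin \o f) x)%E \is a fin_num.
    exact: integrable_fin_num.
  rewrite sube_eq ?add0e ?fin_num_adde_defl ?integrable_fin_num//.
  apply/eqP; apply: (cvg_unique _ lim) => //.
  apply: cvg_near_cst; exists k.+1 => // n /= kn.
  rewrite intA// (aS _ _ _ GS kn) /Rintegral fineK//.
have mX := pg_meas_space pgG.
have key S : G 0%N S -> {ae m, forall x, S x -> (F x - (f x)%:E = 0)%E}.
  (* Disjoint cells meet in the empty set, which has to be added for stability under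
     intersection. *)
  move=> GS; pose GG := cells G `|` [set set0].
  have sub1 : <<s X, GG >> `<=` [set A | measurable A /\ A `<=` X].
    rewrite -gen; apply: smallest_sub; first exact: smallest_sigma_algebra.
    move=> C [|->]; first exact: sub_sigma_algebra.
    exact: sigma_algebra0.
  have genG : <<s X, GG >> = [set A | measurable A /\ A `<=` X].
    apply/seteqP; split=> //; rewrite -gen.
    by apply: sub_sigma_algebra2 => C; left.
  have GGI : setI_closed GG.
    move=> C C' [cC|->]; last by rewrite set0I; right.
    move=> [cC'|->]; last by rewrite setI0; right.
    have [[x [Cx C'x]]|nex] := pselect (exists x, C x /\ C' x); last first.
      right; apply/seteqP; split=> // x [Cx C'x]; apply: nex; by exists x.
    have [h|h] := cells_nested pgG cC cC' Cx C'x.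
      by rewrite setIidl//; left.
    by rewrite setIidr//; left.
  apply: (integral0_ae genG GGI mX (pg_meas pgG GS) (pg_sub pgG GS) ih); last
    exact: hS GS.
  move=> C GC; have : GG (C `&` S) by apply: GGI => //; left; exists 0%N.
  move=> [[k _ GkC]|->]; first exact: hS GkC.
  by rewrite integral_set0.
have Ff : {ae m, forall x, X x -> F x = (f x)%:E}.
  have : m.-negligible (\bigcup_(S in G 0%N) [set x | ~ (S x -> (F x - (f x)%:E
    = 0)%E)]).
    apply: fin_bigcup_negligible; first exact: (pg_finite pgG).
    by move=> S GS; exact: key GS.
  apply: negligibleS => x /= nXF; apply: contrapT => H; apply: nXF => Xx.
  have [S GS Sx] := pg_cover pgG 0%N Xx.
  have : (F x - (f x)%:E = 0)%E.
    by apply: contrapT => nF; apply: H; exists S => //= h; apply: nF; exact: h.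
  by case: (F x) => [r||]//=; rewrite -EFinB => -[] /eqP; rewrite subr_eq0 =>
    /eqP ->.
have aeX : {ae m, forall x, X x} by exact: nX.
(* At almost every point the partial sums converge to [f x], so the error at rank [n] is a limit of
   moduli of finite sums, each bounded by the tail. *)
near=> x => n.
have Xx : X x by near: x.
have FX : F x = (f x)%:E by apply: (near Ff x) => //.
have Dfin : D x \is a fin_num by apply: (near finD x).
have cA := cvgA _ Dfin.
have Af : (fun k => A k x) @ \oo --> f x.
  have := near cvgF x; rewrite FX => /(_ _ I) h.
  have : (fun k => (A k x)%:E) @ \oo --> (f x)%:E by apply: h.
  by move/fine_cvgP => -[].
have tail0 : (0 <= \sum_(n <= k <oo) `|a k x|%:E)%E.
  by apply: nneseries_ge0 => k _ _; rewrite lee_fin.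
have tailD : (\sum_(n <= k <oo) `|a k x|%:E <= D x)%E.
  rewrite /D (nneseries_split 0 n) => [|k _]; last by rewrite lee_fin.
  by rewrite add0n leeDr// sume_ge0// => k _; rewrite lee_fin.
have tfin : (\sum_(n <= k <oo) `|a k x|%:E)%E \is a fin_num.
  rewrite ge0_fin_numE//; apply: le_lt_trans tailD _.
  by rewrite ltey_eq Dfin.
rewrite -(fineK tfin) lee_fin.
have lim : (fun k => `|A k x - A n x|) @ \oo --> `|f x - A n x|.
  by apply: cvg_norm; apply: cvgB => //; exact: cvg_cst.
rewrite -(cvg_lim _ lim)//; apply: limr_le; first by apply/cvg_ex; eexists;
  exact: lim.
exists n => // k /= nk.
rewrite -lee_fin fineK// /A -(subnKC nk) (big_cat_nat (n := n)) ?leq_addr//=.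
rewrite addrAC subrr add0r.
apply: (@le_trans _ _ (\sum_(n <= i < n + (k - n)) `|a i x|%:E)%E).
  by rewrite sumEFin lee_fin; exact: ler_norm_sum.
by apply: nneseries_lim_ge => i _; rewrite lee_fin.
Unshelve. all: by end_near.
Qed.

End Uniqueness.

(** * Convergence of the martingale series in L^p *)

Section Convergence.
Context d (T : measurableType d) (R : realType).
Variable m : {measure set T -> \bar R}.
Hypothesis m1 : m setT = 1%E.

(** [modulus_mean_powR] for the modulus of [h] on the whole space, whose volume is 1. *)
Lemma L1_le_Lp p (h : T -> R[i]) : 1 <= p -> cmeas h ->
  (\int[m]_x (modulus (h x))%:E <= 4%:E * Lpnorm m p h)%E.
Proof.
move=> p1 ch; have p0 : 0 < p by rewrite (lt_le_trans ltr01).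
have L0 := Lpnorm_ge0 m p h.
have [->|Loo] := eqVneq (Lpnorm m p h) +oo%E; first by rewrite gt0_muley ?leey.
have hoo : (\int[m]_x (modulus (h x))%:E < +oo)%E.
  by apply: (Lp_modulus_lty m1 p1 ch); rewrite ltey.
pose h' x : R[i] := (modulus (h x))%:C%C.
have ch' : cmeas h' by apply: cmeas_real; exact: measurable_modulus.
have mh' x : modulus (h' x) = modulus (h x).
  by rewrite /h' modulus_real ger0_norm ?modulus_ge0.
have ih' : cintegrable m h'.
  by apply: modulus_cintegrable => //; under eq_integral do rewrite mh'.
have volT : vol m setT = 1 by rewrite /vol m1.
have := modulus_mean_powR m1 p1 measurableT _ ih'.
rewrite volT mulr1 => /(_ ltr01); under eq_integral do rewrite mh'.
rewrite -(Lpnorm_powE m h (lt0r_neq0 p0)) -!poweR_EFin -poweRM ?lee_fin//.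
rewrite lee_poweR ?mule_ge0 ?lee_fin ?modulus_ge0//; apply: le_trans.
have -> : (\int[m]_x (modulus (h x))%:E = (\int[m]_x modulus (h x))%:E)%E.
  rewrite /Rintegral fineK// ge0_fin_numE//.
  by apply: integral_ge0 => x _; rewrite lee_fin modulus_ge0.
rewrite lee_fin; apply: le_trans (Re_le_modulus _).
by rewrite /mean/= volT divr1 ler_norm.
Qed.

Variables (X : set T) (G : nat -> set (set T)).
Hypothesis nX : m.-negligible (~` X).
Hypothesis pgG : partition_grid m X G.

Lemma partition_Rintegral (u : T -> R) S n : measurable S -> S `<=` X ->
  m.-integrable setT (EFin \o u) ->
  \int[m]_(x in S) u x = \sum_(S' <- fset_set (G n)) \int[m]_(x in S `&` S') u
    x.
Proof.
move=> mS SX iu; have fG := pg_finite pgG.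
have mu : measurable_fun setT u by apply/measurable_EFinP; exact:
  measurable_int iu.
pose A S' := if S' \in fset_set (G n) then S `&` S' else set0.
have mA S' : measurable (A S').
  rewrite /A; case: ifPn => //; rewrite in_fset_set// => /set_mem GS'.
  by apply: measurableI => //; exact: (pg_meas pgG GS').
have iuA B : measurable B -> m.-integrable setT (EFin \o (u \_ B)).
  move=> mB; have /(integrable_mkcond _ mB) : m.-integrable B (EFin \o u).
    by apply: integrableS iu.
  by rewrite restrict_EFin.
transitivity (\sum_(S' <- fset_set (G n)) \int[m]_x (u \_ (A S')) x); last
  first.
  by apply: eq_big_seq => S' GS'; rewrite [RHS]Rintegral_mkcond /A GS'.
have : forall s : seq (set T), \sum_(S' <- s) \int[m]_x (u \_ (A S')) x =
    \int[m]_x (\sum_(S' <- s) (u \_ (A S')) x) /\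
    m.-integrable setT (EFin \o (fun x => \sum_(S' <- s) (u \_ (A S')) x)).
  elim=> [|S' s [IH1 IH2]].
    rewrite big_nil; split.
      under eq_Rintegral do rewrite big_nil.
      by rewrite Rintegral_cst// mul0r.
    rewrite (_ : _ \o _ = cst 0%E); first exact: integrable0.
    by apply/funext => x /=; rewrite big_nil.
  rewrite big_cons IH1 -RintegralD//; last exact: iuA.
  split.
    by apply: eq_Rintegral => x _; rewrite big_cons.
  rewrite (_ : _ \o _ = (EFin \o (u \_ (A S'))) \+
     (EFin \o (fun x => (\sum_(S' <- s) (u \_ (A S')) x)%R)))%E.
    by apply: integrableD => //; exact: iuA.
  by apply/funext => x /=; rewrite big_cons.
move=> /(_ (fset_set (G n)))[-> ii]; rewrite Rintegral_mkcond.
congr fine; apply: ae_eq_integral => //.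
- exact: measurable_int (iuA _ mS).
- exact: measurable_int ii.
apply: filterS (pg_ae nX) => x Xx _ /=; congr EFin.
have [S' GS' S'x] := pg_cover pgG n Xx.
rewrite (regular_sum fG (pg_regular pgG Xx) GS' S'x).
  rewrite !patchE /A in_fset_set// (mem_set GS').
  by rewrite in_setI (mem_set S'x) andbT.
move=> S'' GS'' S''x; rewrite patchE /A in_fset_set// (mem_set GS'').
by rewrite in_setI (memNset S''x) andbF.
Qed.

(** Cells of level [n] are contained in [S] or disjoint from it, and replacing [f] by its mean on
    such a cell does not change the integral there. *)
Lemma mart_tower (f : T -> R[i]) k n S : cintegrable m f -> G k S -> (k <= n)%N
  ->
  \int[m]_(x in S) complex.Re (martingale m G f n x) = \int[m]_(x in S)
    complex.Re (f x) /\
  \int[m]_(x in S) complex.Im (martingale m G f n x) = \int[m]_(x in S)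
    complex.Im (f x).
Proof.
move=> cf GS kn; have [f1 f2] := cf; have fG := pg_finite pgG.
have [mS SX] := (pg_meas pgG GS, pg_sub pgG GS).
have [g1 g2] : cintegrable m (martingale m G f n).
  apply: (@Lp_cintegrable _ _ _ m m1 1) => //; first exact: (cmeas_mart pgG).
  apply: le_lt_trans (mart_Lp m1 nX pgG n (lexx _) cf) _.
  rewrite lte_mul_pinfty// /Lpnorm Lnorm1.
  under eq_integral do rewrite abse_EFin ger0_norm ?modulus_ge0//.
  case: f1 => /integrableP[mf1 f1]; case/integrableP: f2 => mf2 f2.
  apply: (@le_lt_trans _ _ (\int[m]_x (`|(complex.Re (f x))%:E| + `|(complex.Im
    (f x))%:E|))%E).
    apply: ge0_le_integral => //.
    - by move=> x _; rewrite lee_fin modulus_ge0.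
    - by apply/measurable_EFinP; apply: measurable_modulus; exact:
      cintegrable_cmeas cf.
    - by apply: emeasurable_funD; apply: measurableT_comp.
    - by move=> x _; rewrite !abse_EFin -EFinD lee_fin modulus_le.
  rewrite ge0_integralD//; try by apply: measurableT_comp.
  exact: lte_add_pinfty.
have cell S' : G n S' -> S `&` S' = set0 \/ S `&` S' = S'.
  move=> GS'; have [[x [Sx S'x]]|nex] := pselect (exists x, S x /\ S' x).
    by right; rewrite setIidr//; exact: (pg_level_sub pgG GS GS' Sx S'x kn).
  by left; apply/seteqP; split=> // x [Sx S'x]; apply: nex; exists x.
have vS' S' : G n S' -> fine (m S') != 0.
  by move=> GS'; rewrite gt_eqF//; exact: (pg_vol_gt0 m1 pgG GS').
split.
  rewrite !(partition_Rintegral n mS SX)//; apply: eq_big_seq => S'.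
  rewrite in_fset_set// => /set_mem GS'.
  have [->|->] := cell S' GS'; first by rewrite !Rintegral_set0.
  rewrite (_ : \int[m]_(x in S') complex.Re (martingale m G f n x) =
    \int[m]_(x in S') complex.Re (mean m f S')); last first.
    by apply: eq_Rintegral => x /set_mem S'x; rewrite (mart_cell pgG _ GS' S'x).
  rewrite Rintegral_cst; last exact: (pg_meas pgG GS').
  by rewrite /mean /= /vol divfK// vS'.
rewrite !(partition_Rintegral n mS SX)//; apply: eq_big_seq => S'.
rewrite in_fset_set// => /set_mem GS'.
have [->|->] := cell S' GS'; first by rewrite !Rintegral_set0.
rewrite (_ : \int[m]_(x in S') complex.Im (martingale m G f n x) =
  \int[m]_(x in S') complex.Im (mean m f S')); last first.
  by apply: eq_Rintegral => x /set_mem S'x; rewrite (mart_cell pgG _ GS' S'x).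
rewrite Rintegral_cst; last exact: (pg_meas pgG GS').
  by rewrite /mean /= /vol divfK// vS'.
Qed.

Hypothesis gen : <<s X, cells G >> = [set A | measurable A /\ A `<=` X].

Lemma Re_sum (I : Type) (s : seq I) (F : I -> R[i]) :
  complex.Re (\sum_(i <- s) F i) = \sum_(i <- s) complex.Re (F i).
Proof. by elim: s => [|i s IH]; rewrite ?big_nil// !big_cons ReD IH. Qed.

Lemma Im_sum (I : Type) (s : seq I) (F : I -> R[i]) :
  complex.Im (\sum_(i <- s) F i) = \sum_(i <- s) complex.Im (F i).
Proof. by elim: s => [|i s IH]; rewrite ?big_nil// !big_cons ImD IH. Qed.

Lemma sum_mdiff_pred (f : T -> R[i]) n x :
  \sum_(0 <= j < n.+1) mdiff m G f j x = martingale m G f n x.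
Proof. by rewrite big_mkord sum_mdiff. Qed.

(** The real and imaginary parts of the increments are absolutely summable in L^1, so [l1_series_ae]
    bounds both errors by tails of moduli; adding them gives the factor 2, and [Lpnorm_series]
    passes to norms. *)
Lemma mdiff_series_Lp p (f : T -> R[i]) : 1 <= p -> cintegrable m f ->
  (\sum_(0 <= k <oo) Lpnorm m p (mdiff m G f k) < +oo)%E -> forall n,
  (Lpnorm m p (fun x => f x - \sum_(0 <= j < n) mdiff m G f j x)%R <=
   2%:E * \sum_(n <= k <oo) Lpnorm m p (mdiff m G f k))%E.
Proof.
move=> p1 cf sumoo n; have [f1 f2] := cf; have cmf := cintegrable_cmeas cf.
have p0 : 0 < p by rewrite (lt_le_trans ltr01).
have cd k : cmeas (mdiff m G f k) by exact: (cmeas_mdiff pgG).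
have mmod k : measurable_fun setT (fun x => (modulus (mdiff m G f k x))%:E).
  by apply/measurable_EFinP; exact: measurable_modulus.
have l1 (u : R[i] -> R) : (forall z, `|u z| <= modulus z) ->
    (forall k, measurable_fun setT (fun x => u (mdiff m G f k x))) ->
    (\int[m]_x (\sum_(0 <= k <oo) `|u (mdiff m G f k x)|%:E) < +oo)%E.
  move=> uz mu.
  rewrite integral_nneseries//; last first.
    by move=> k; apply/measurable_EFinP; apply: measurableT_comp.
  apply: (@le_lt_trans _ _ (\sum_(0 <= k <oo) 4%:E * Lpnorm m p (mdiff m G f
    k))%E).
    apply: lee_nneseries => k _ => [_|]; first by apply: integral_ge0.
    apply: le_trans (L1_le_Lp p1 (cd k)).
    apply: ge0_le_integral => //.
    - by apply/measurable_EFinP; apply: measurableT_comp.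
    - by move=> x _; rewrite lee_fin.
  rewrite nneseriesZl; last by move=> k _; exact: Lpnorm_ge0.
  by rewrite lte_mul_pinfty.
have aRe := @l1_series_ae _ T R m X G (fun k x => complex.Re (mdiff m G f k x))
  (fun x => complex.Re (f x)) pgG gen nX.
have aIm := @l1_series_ae _ T R m X G (fun k x => complex.Im (mdiff m G f k x))
  (fun x => complex.Im (f x)) pgG gen nX.
have {}aRe := aRe (fun k => (cd k).1) f1 (l1 _ (@Re_le_modulus R) (fun k => (cd
  k).1)).
have {}aIm := aIm (fun k => (cd k).2) f2 (l1 _ (@Im_le_modulus R) (fun k => (cd
  k).2)).
have {}aRe := aRe _; have {}aIm := aIm _.
have tow k S n' : G k S -> (k < n')%N ->
    \int[m]_(x in S) (\sum_(0 <= i < n') complex.Re (mdiff m G f i x)) =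
      \int[m]_(x in S) complex.Re (f x) /\
    \int[m]_(x in S) (\sum_(0 <= i < n') complex.Im (mdiff m G f i x)) =
      \int[m]_(x in S) complex.Im (f x).
  case: n' => // n' GS kn; have [<- <-] := mart_tower cf GS kn.
  split; apply: eq_Rintegral => x _; rewrite -sum_mdiff_pred.
    by rewrite Re_sum.
  by rewrite Im_sum.
have {}aRe := aRe (fun k S n' GS kn => (tow k S n' GS kn).1).
have {}aIm := aIm (fun k S n' GS kn => (tow k S n' GS kn).2).
have cdiff : cmeas (fun x => f x - \sum_(0 <= j < n) mdiff m G f j x).
  by apply: cmeasB => //; exact: cmeas_sum.
apply: (@le_trans _ _ (\sum_(0 <= k <oo)
    Lpnorm m p (fun x => 2%:C%C * mdiff m G f (k + n)%N x)%R)%E).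
  apply: Lpnorm_series => //.
    by move=> k; apply: cmeasM => //; exact: cmeas_cst.
  near=> x.
  have aRx := near aRe x _ n; have aIx := near aIm x _ n.
  apply: (@le_trans _ _ (\sum_(n <= k <oo) (modulus (mdiff m G f k x))%:E +
      \sum_(n <= k <oo) (modulus (mdiff m G f k x))%:E)%E).
    apply: (@le_trans _ _ (`|complex.Re (f x - \sum_(0 <= j < n) mdiff m G f j
      x)|%:E +
       `|complex.Im (f x - \sum_(0 <= j < n) mdiff m G f j x)|%:E)%E).
      by rewrite -EFinD lee_fin modulus_le.
    rewrite ReB ImB Re_sum Im_sum; apply: leeD.
      apply: le_trans (aRx _) _ => //.
      apply: lee_nneseries => k _ => [_|]; first by rewrite lee_fin.
      by rewrite lee_fin Re_le_modulus.
    apply: le_trans (aIx _) _ => //.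
    apply: lee_nneseries => k _ => [_|]; first by rewrite lee_fin.
    by rewrite lee_fin Im_le_modulus.
  rewrite -(nneseries_addn n); last by move=> k; rewrite lee_fin modulus_ge0.
  have S0 : (0 <= \sum_(0 <= k <oo) (modulus (mdiff m G f (k + n) x))%:E)%E.
    by apply: nneseries_ge0 => k _ _; rewrite lee_fin modulus_ge0.
  under [leRHS]eq_eseriesr do rewrite modulusM modulus_real ger0_norm// EFinM.
  rewrite nneseriesZl; last by move=> k _; rewrite lee_fin modulus_ge0.
  by rewrite -[in leLHS](mul1e (\sum_(0 <= k <oo) _)%E) -ge0_muleDl// -EFinD.
under eq_eseriesr do rewrite LpnormZ// modulus_real ger0_norm//.
rewrite nneseriesZl; last by move=> k _; exact: Lpnorm_ge0.
rewrite -(@nneseries_addn R (fun k => Lpnorm m p (mdiff m G f k)) n)//.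
by move=> k; exact: Lpnorm_ge0.
Unshelve. all: by end_near.
Qed.

End Convergence.

(** * From martingale differences to expansions *)

Section Expansion.
Context d (T : measurableType d) (R : realType).
Variable m : {measure set T -> \bar R}.
Hypothesis m1 : m setT = 1%E.
Variables (X : set T) (G : nat -> set (set T)).
Hypothesis nX : m.-negligible (~` X).
Hypothesis pgG : partition_grid m X G.
Hypothesis gen : <<s X, cells G >> = [set A | measurable A /\ A `<=` X].
Variables (th2 : R) (ell : nat -> R).
Hypothesis th201 : 0 < th2 < 1.
Hypothesis ell_gt0 : forall k, 0 < ell k.
Hypothesis ellS : forall k, ell k.+1 <= th2 * ell k.
Hypothesis ellE : forall k, ell k = maxvol m G k.
Variables (p s : R) (q : \bar R).
Hypotheses (p1 : 1 <= p) (q1 : (1 <= q)%E) (s0 : 0 < s).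

Let p0 : 0 < p. Proof. by rewrite (lt_le_trans ltr01). Qed.

Lemma ell_le i j : (i <= j)%N -> ell j <= ell i.
Proof.
move=> /subnK <-; elim: (j - i)%N => [//|n IH]; rewrite addSn.
apply: le_trans (ellS _) _; apply: le_trans IH.
by case/andP: th201 => _ h; rewrite ger_pMl ?(ltW h).
Qed.

Lemma geometric_lt (a : nat -> R) (t : R) : 0 < t < 1 -> (forall k, 0 < a k) ->
  (forall k, a k.+1 <= t * a k) -> forall r, 0 < r -> exists k, a k < r.
Proof.
move=> /andP[t0 t1] a0 aS r r0.
have bd k : a k <= a 0%N * t ^+ k.
  elim: k => [|k IH]; first by rewrite expr0 mulr1.
  apply: le_trans (aS k) _; rewrite exprS mulrCA ler_wpM2l// ltW//.
have t01 : 0 < t < 1 by rewrite t0.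
have [k kr] := exp_lt t01 (divr_gt0 r0 (a0 0%N)).
by exists k; apply: le_lt_trans (bd k) _; rewrite mulrC -ltr_pdivlMr.
Qed.

(** Boundedness of the weighted norms gives terms of order [ell k ^ s], and
    [(1 - th2 ^ s) * ell k ^ s] is at most the decrement [ell k ^ s - ell k.+1 ^ s], which
    telescopes. *)
Lemma gt_sum_lty f : gt_besov m G s p q f ->
  (\sum_(0 <= k <oo) Lpnorm m p (mdiff m G f k) < +oo)%E.
Proof.
move=> [_ fq].
have [|C uC] := lqnorm_bounded q1 _ fq.
  by move=> k; rewrite mule_ge0 ?lee_fin ?powR_ge0 ?Lpnorm_ge0.
have C0 : 0 <= C.
  rewrite -lee_fin; apply: le_trans (uC 0%N).
  by rewrite mule_ge0 ?lee_fin ?powR_ge0 ?Lpnorm_ge0.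
pose y := th2 `^ s.
have y1 : y < 1.
  by case/andP: th201 => h h'; rewrite powR_lt1// (ltW h).
apply: (@le_lt_trans _ _ (C * (ell 0%N `^ s / (1 - y)))%:E); last exact: ltry.
apply: nneseries_le_ub => [k|n]; first exact: Lpnorm_ge0.
apply: (@le_trans _ _ (\sum_(0 <= k < n) (C * ell k `^ s)%:E)%E).
  apply: lee_sum => k _; have := uC k; rewrite -ellE powRN.
  by rewrite lee_pdivrMl ?powR_gt0// mulrC EFinM.
rewrite sumEFin lee_fin -mulr_sumr ler_wpM2l// ler_pdivlMr ?subr_gt0//
  mulr_suml.
apply: (@le_trans _ _ (\sum_(0 <= k < n) (ell k `^ s - ell k.+1 `^ s))).
  apply: ler_sum => k _; rewrite mulrBr mulr1 lerB// mulrC /y.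
  case/andP: th201 => h _; have := ellS k => h'.
  rewrite -powRM ?(ltW h) ?(ltW (ell_gt0 _))// ge0_ler_powR ?(ltW s0)// nnegrE.
    exact: ltW.
  by rewrite mulr_ge0 ?(ltW h) ?(ltW (ell_gt0 _)).
have -> : \sum_(0 <= k < n) (ell k `^ s - ell k.+1 `^ s) = ell 0%N `^ s - ell n
  `^ s.
  rewrite -[RHS]opprB -(telescope_sumr (fun k => ell k `^ s))// -sumrN.
  by apply: eq_bigr => i _; rewrite opprB.
by rewrite gerBl powR_ge0.
Qed.

(** The space asks for [f] in L^1 only; the remainder estimate at rank 0, where the partial sum is
    empty, bounds [f] itself. *)
Lemma gt_inLp f : gt_besov m G s p q f -> inLp m p f.
Proof.
move=> gtf; have [fL1 _] := gtf; have cf := inLp_cintegrable m1 (lexx _) fL1.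
have cmf := cintegrable_cmeas cf.
split; [exact: cmf.1|exact: cmf.2|].
have := mdiff_series_Lp m1 nX pgG gen p1 cf (gt_sum_lty gtf) 0.
under eq_fun do rewrite big_nil subr0.
by move=> h; apply: le_lt_trans h _; rewrite lte_mul_pinfty// gt_sum_lty.
Qed.

Variables (W : nat -> set (set T)) (th th' : R) (beta : nat -> R) (z : set T ->
  T).
Variables (phi : set T -> T -> R) (r v1 : R).
Hypothesis finW : forall k, finite_set (W k).
Hypothesis levelW : forall k k' Q, W k Q -> W k' Q -> k = k'.
Hypothesis measW : forall k Q, W k Q -> measurable Q.
Hypothesis subW : forall k Q, W k Q -> Q `<=` X.
Hypothesis regW : m.-negligible (~` regular_points W).
Hypothesis th01 : 0 < th < 1.
Hypothesis th'0 : 0 < th'.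
Hypothesis beta_gt0 : forall k, 0 < beta k.
Hypothesis betaS : forall k, th' * beta k <= beta k.+1 <= th * beta k.
Hypothesis r0 : 0 < r.
Hypothesis v10 : 0 < v1.
Hypothesis volW : forall k Q, W k Q -> v1 * beta k <= vol m Q.
Hypothesis z_in : forall k Q, W k Q -> X (z Q).
(** Makes the increments at scales at least [r * beta k] constant on [Q], hence determined by their
    values at the centre. *)
Hypothesis near_z : forall k Q x j S, (0 < k)%N -> W k Q -> Q x ->
  G j S -> S (z Q) -> r * beta k <= ell j -> S x.
Hypothesis phi_meas : forall k Q, W k Q -> measurable_fun setT (phi Q).
Hypothesis phi_supp : forall k Q x j S, (0 < k)%N -> W k Q -> phi Q x != 0 ->
  G j S -> S (z Q) -> r * beta k <= ell j -> S x.
Hypothesis phi_sum : forall k, (0 < k)%N ->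
  {ae m, forall x, \sum_(Q <- fset_set (W k)) phi Q x = 1}.

Let th_lt1 : th < 1. Proof. by case/andP: th01. Qed.

Let beta_le i j : (i <= j)%N -> beta j <= beta i.
Proof.
move=> /subnK <-; elim: (j - i)%N => [//|n IH]; rewrite addSn.
have /andP[_ h] := betaS (n + i); apply: le_trans h _; apply: le_trans IH.
by rewrite ger_pMl ?(ltW th_lt1).
Qed.

Let ex_coarse k : exists j, ell j < r * beta k.
Proof. by apply: (geometric_lt th201) => //; rewrite mulr_gt0. Qed.

(* The number of generations of [G] coarser than level [k] of [W]. *)
Let idx k := if k is 0 then 0%N else ex_minn (ex_coarse k).

Let idx_coarse k j : (0 < k)%N -> (j < idx k)%N -> r * beta k <= ell j.
Proof.
case: k => // k _; rewrite /idx; case: ex_minnP => n _ nmin jn.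
by rewrite leNgt; apply/negP => /nmin; rewrite leqNgt jn.
Qed.

Let idx_fine k j : (0 < k)%N -> (idx k <= j)%N -> ell j < r * beta k.
Proof.
case: k => // k _; rewrite /idx; case: ex_minnP => n nP _ nj.
exact: le_lt_trans (ell_le nj) nP.
Qed.

Let idx_mono : {homo idx : i j / (i <= j)%N}.
Proof.
move=> i j ij; case: i ij => [//|i] ij; rewrite leqNgt; apply/negP => h.
have := idx_coarse (ltn0Sn i) h; apply/negP; rewrite -ltNge.
apply: (@lt_le_trans _ _ (r * beta j)).
  by apply: idx_fine => //; exact: leq_trans ij.
by rewrite ler_wpM2l ?(ltW r0)// beta_le.
Qed.

Let idx_infty n : exists k, forall k', (k <= k')%N -> (n <= idx k')%N.
Proof.
have [k kP] := geometric_lt th01 beta_gt0 (fun k => (andP (betaS k)).2)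
  (divr_gt0 (ell_gt0 n) r0).
exists k.+1 => k' kk'; rewrite leqNgt; apply/negP => h.
have := idx_fine (leq_ltn_trans (leq0n k) kk') (ltnW h).
apply/negP; rewrite -leNgt mulrC -ler_pdivlMr//.
exact: le_trans (beta_le (ltnW kk')) (ltW kP).
Qed.

Section Function.
Variable f : T -> R[i].
Hypothesis gtf : gt_besov m G s p q f.

Let dif j := mdiff m G f j.
(** Consecutive blocks of increments. As [idx 0 = 0], level 0 receives nothing and level 1 receives
    all the coarse increments. *)
Let g k x := \sum_(idx k.-1 <= j < idx k) dif j x.

Let cdif j : cmeas (dif j). Proof. exact: (cmeas_mdiff pgG). Qed.
Let cg k : cmeas (g k). Proof. exact: cmeas_sum. Qed.

Let g0E x : g 0%N x = 0. Proof. by rewrite /g big_geq. Qed.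

Let g_near k Q x : (0 < k)%N -> W k Q -> (forall j S, G j S -> S (z Q) ->
  r * beta k <= ell j -> S x) -> g k x = g k (z Q).
Proof.
move=> k0 WQ near; apply: eq_big_nat => j /andP[_ jk].
have [S GS Sz] := pg_cover pgG j (z_in WQ).
exact: (mdiff_cell pgG _ GS (near _ _ GS Sz (idx_coarse k0 jk)) Sz).
Qed.

Let sum_g n x : \sum_(0 <= k < n.+1) g k x = \sum_(0 <= j < idx n) dif j x.
Proof.
elim: n => [|n IH]; first by rewrite big_nat1 g0E big_geq.
rewrite big_nat_recr//= IH /g/= -(big_cat_nat (n := idx n))//.
exact: (idx_mono (leqnSn n)).
Qed.

Let lev Q : nat := xget 0%N [set k | W k Q].
(** The powers of the volume in [c] and [b] cancel, so a level function is [g] sampled at the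
    centres and weighted by [phi]. *)
Let c Q : R[i] := g (lev Q) (z Q) * (vol m Q `^ (p^-1 - s))%:C%C.
Let b Q x : R[i] := (vol m Q `^ (s - p^-1) * phi Q x)%:C%C.

Let levE k Q : W k Q -> lev Q = k.
Proof.
move=> WQ; have : W (lev Q) Q by apply: (@xgetPex _ 0%N [set k | W k Q]);
  exists k.
by move=> WQ'; exact: levelW WQ' WQ.
Qed.

Let vol0 k Q : W k Q -> 0 < vol m Q.
Proof. by move=> WQ; apply: lt_le_trans (volW WQ); rewrite mulr_gt0. Qed.

Let level_eq k : {ae m, forall x, level W c b k x = g k x}.
Proof.
case: k => [|k].
  apply: aeW => x; rewrite g0E /level fsbig_finite// big_seq big1// => Q.
  rewrite in_fset_set// => /set_mem WQ.
  by rewrite /c (levE WQ) g0E !mul0r.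
apply: filterS (phi_sum (ltn0Sn k)) => x sumx.
rewrite /level fsbig_finite//.
transitivity (\sum_(Q <- fset_set (W k.+1)) g k.+1 x * (phi Q x)%:C%C); last
  first.
  by rewrite -mulr_sumr -rmorph_sum sumx mulr1.
apply: eq_big_seq => Q; rewrite in_fset_set// => /set_mem WQ.
have [e0|ph0] := eqVneq (phi Q x) 0; first by rewrite /b e0 mulr0 rmorph0
  !mulr0.
rewrite /c (levE WQ) (@g_near k.+1 Q x)//; last first.
  by move=> j S GS Sz h; exact: (phi_supp (ltn0Sn k) WQ ph0 GS Sz h).
rewrite -mulrA; congr (_ * _); rewrite /b -rmorphM mulrA -powRD.
  by rewrite addrA subrK subrr powRr0 mul1r.
by rewrite (gt_eqF (vol0 WQ)) implybT.
Qed.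

Let cb k Q : W k Q -> cmeas (b Q).
Proof.
by move=> WQ; apply: cmeas_real; apply: measurable_funM => //; exact: phi_meas
  WQ.
Qed.

Let clevel k : cmeas (level W c b k).
Proof.
rewrite (_ : level W c b k = fun x => \sum_(Q <- fset_set (W k))
  c Q * (if Q \in fset_set (W k) then b Q else fun=> 0) x); last first.
  by apply/funext => x; rewrite /level fsbig_finite//; apply: eq_big_seq => Q
    ->.
apply: cmeas_sum => Q; apply: cmeasM; first exact: cmeas_cst.
case: ifPn => [|_]; last exact: cmeas_cst.
by rewrite in_fset_set// => /set_mem; exact: cb.
Qed.

Let Lp_level k : Lpnorm m p (level W c b k) = Lpnorm m p (g k).
Proof. by apply: Lpnorm_eq => //; exact: level_eq. Qed.

Let Lp_g k : (Lpnorm m p (g k) <= \sum_(idx k.-1 <= j < idx k) Lpnorm m p (dif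
  j))%E.
Proof. exact: Lpnorm_sum. Qed.

(** As [g k] is constant on [Q], [|c Q|^p] is [vol Q ^ (- s p)] times the integral of [|g k|^p] over
    [Q]; the lower bound on volumes then makes the weight uniform over the level. *)
Let coef k : (0 < k)%N ->
  (((\sum_(Q <- fset_set (W k)) modulus (c Q) `^ p) `^ p^-1)%:E <=
   ((v1 * beta k) `^ (- s))%:E * Lpnorm m p (g k))%E.
Proof.
move=> k0; have S0 : 0 <= \sum_(Q <- fset_set (W k)) modulus (c Q) `^ p.
  by rewrite sumr_ge0// => Q _; exact: powR_ge0.
have vb0 : 0 < v1 * beta k by rewrite mulr_gt0.
have vs0 := powR_ge0 (v1 * beta k) (- s).
rewrite -(lee_poweR p0) ?lee_fin ?powR_ge0 ?mule_ge0 ?Lpnorm_ge0//.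
rewrite poweR_EFin -powRrM mulVf ?gt_eqF// powRr1// poweRM ?lee_fin
  ?Lpnorm_ge0//.
rewrite poweR_EFin (Lpnorm_powE m _ (lt0r_neq0 p0)).
have mgp := measurable_modulusp p (cg k).
rewrite (ae_partition_integral finW measW regW k mgp); last first.
  by move=> x; rewrite lee_fin powR_ge0.
rewrite ge0_sume_distrr; last first.
  by move=> Q _; apply: integral_ge0 => x _; rewrite lee_fin powR_ge0.
rewrite -sumEFin big_seq [leRHS]big_seq; apply: lee_sum => Q.
rewrite in_fset_set// => /set_mem WQ; have mQ := measW WQ.
rewrite (_ : (\int[m]_(x in Q) _)%E =
             \int[m]_(x in Q) cst (modulus (g k (z Q)) `^ p)%:E x)%E; last
               first.
  apply: eq_integral => x /set_mem Qx; rewrite (@g_near k Q x)//.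
  by move=> j S GS Sz h; exact: (near_z k0 WQ Qx GS Sz h).
rewrite integral_cst// (volE m1 mQ) -!EFinM lee_fin /c (levE WQ) modulusM
  modulus_real.
have vQ := vol0 WQ.
rewrite ger0_norm ?powR_ge0// powRM ?modulus_ge0 ?powR_ge0// [leRHS]mulrCA.
rewrite ler_wpM2l ?powR_ge0// -powRrM mulrBl mulVf ?gt_eqF//.
rewrite powRD; last by rewrite (gt_eqF vQ) implybT.
rewrite powRr1 ?(ltW vQ)// mulrC ler_wpM2r ?(ltW vQ)//.
rewrite -mulNr powRrM ge0_ler_powR ?(ltW p0)// ?nnegrE ?powR_ge0//.
rewrite !powRN lef_pV2 ?posrE ?powR_gt0// ge0_ler_powR ?(ltW s0)// ?nnegrE
  ?(ltW vQ) ?(ltW vb0)//.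
exact: volW.
Qed.

Let u j := ((ell j `^ (- s))%:E * Lpnorm m p (dif j))%E.

Let u_lq : (lqnorm q u < +oo)%E.
Proof.
have [_] := gtf; rewrite /u (_ : (fun k => _) = (fun j => (ell j `^ (- s))%:E *
  Lpnorm m p (dif j))%E)//.
by apply/funext => j; rewrite ellE.
Qed.

Let u0 j : (0 <= u j)%E.
Proof. by rewrite mule_ge0 ?lee_fin ?powR_ge0 ?Lpnorm_ge0. Qed.

Let scale_bound : exists2 D : R, 0 < D & forall k j, (0 < k)%N ->
  (idx k.-1 <= j)%N -> ell j <= D * beta k.
Proof.
(* Going back one generation costs [r / th']; the second entry is for [k = 1], where [idx 0 = 0]
   gives no upper bound on the scale. *)
exists (Num.max (r / th') (ell 0%N / beta 1%N)).
  by rewrite lt_max divr_gt0.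
move=> [//|k] j _ /= kj; case: k kj => [|k] kj.
  apply: (@le_trans _ _ (ell 0%N)); first exact: ell_le.
  by rewrite -ler_pdivrMr// le_max lexx orbT.
apply: ltW; apply: (lt_le_trans (idx_fine (ltn0Sn k) kj)).
have /andP[h _] := betaS k.+1.
apply: (@le_trans _ _ (r / th' * beta k.+2)).
  by rewrite -mulrA ler_wpM2l ?(ltW r0)// ler_pdivlMl.
by rewrite ler_wpM2r ?(ltW (beta_gt0 _))// le_max lexx.
Qed.

Let coef_lq : (lqnorm q (fun k =>
  ((\sum_(Q \in W k) modulus (c Q) `^ p) `^ p^-1)%:E) < +oo)%E.
Proof.
have [D D0 DP] := scale_bound.
(* The scales collected at one level are comparable to that of the level, and there the kernel is at
   least [mu]. The second exponent of the kernel, 1, is an arbitrary positive choice. *)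
pose mu := Num.min (r `^ s) (D `^ (- 1)).
have mu0 : 0 < mu by rewrite lt_min !powR_gt0.
pose C := v1 `^ (- s) * D `^ s / mu.
have C0 : 0 <= C by rewrite divr_ge0 ?mulr_ge0 ?powR_ge0 ?(ltW mu0).
apply: (@kern_lq R beta ell th th2 s 1 C q u) => //.
- by move=> k; case/andP: (betaS k).
- by move=> k; rewrite lee_fin powR_ge0.
have t0 k j : (0 <= (C * kern s 1 (beta k) (ell j))%:E * u j)%E.
  by rewrite mule_ge0// lee_fin mulr_ge0// kern_ge0.
case=> [|k].
  rewrite fsbig_finite// big_seq big1 ?powR0 ?invr_neq0 ?gt_eqF//.
    exact: nneseries_ge0.
  move=> Q; rewrite in_fset_set// => /set_mem WQ.
  by rewrite /c (levE WQ) g0E mul0r modulus0 powR0// gt_eqF.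
rewrite fsbig_finite//; apply: le_trans (coef (ltn0Sn k)) _.
apply: (@le_trans _ _ (\sum_(idx k <= j < idx k.+1)
    (C * kern s 1 (beta k.+1) (ell j))%:E * u j)%E); last first.
  apply: le_trans (nneseries_lim_ge (idx k.+1) _); last first.
    by move=> j _ _; exact: t0.
  rewrite [leRHS](big_cat_nat (n := idx k))//=; last exact: (idx_mono (leqnSn
    _)).
  by rewrite leeDr// sume_ge0.
apply: le_trans (_ : _ <= ((v1 * beta k.+1) `^ (- s))%:E *
   \sum_(idx k <= j < idx k.+1) Lpnorm m p (dif j))%E _.
  by rewrite lee_wpmul2l ?lee_fin ?powR_ge0//; exact: Lp_g.
rewrite ge0_sume_distrr; last by move=> j _; exact: Lpnorm_ge0.
rewrite big_nat [leRHS]big_nat; apply: lee_sum => j /andP[kj jk].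
rewrite /u muleA -EFinM lee_wpmul2r ?Lpnorm_ge0// lee_fin.
have b0 := beta_gt0 k.+1; have l0 := ell_gt0 j.
have lD := DP k.+1 j (ltn0Sn k) kj.
have rl := idx_coarse (ltn0Sn k) jk.
have kmu : mu <= kern s 1 (beta k.+1) (ell j).
  rewrite /mu /kern le_min !ge_min; apply/andP; split; apply/orP; [left|right].
    rewrite ge0_ler_powR ?(ltW s0)// ?nnegrE ?(ltW r0) ?divr_ge0 ?(ltW b0)
      ?(ltW l0)//.
    by rewrite ler_pdivlMr.
  rewrite powR_inv1 ?(ltW D0)// powRr1 ?divr_ge0 ?(ltW b0) ?(ltW l0)//.
  by rewrite ler_pdivlMr// ler_pdivrMl.
apply: (@le_trans _ _ (v1 `^ (- s) * D `^ s * ell j `^ (- s))); last first.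
  rewrite ler_wpM2r ?powR_ge0// /C -mulrA ler_peMr ?mulr_ge0 ?powR_ge0//.
  by rewrite mulrC ler_pdivlMr// mul1r.
rewrite powRM ?(ltW v10) ?(ltW b0)// -mulrA ler_wpM2l ?powR_ge0//.
rewrite !powRN -ler_pdivrMr ?invr_gt0 ?powR_gt0// invrK mulrC.
rewrite ler_pdivrMr ?powR_gt0// -powRM ?(ltW D0) ?(ltW b0)//.
by rewrite ge0_ler_powR ?(ltW s0)// ?nnegrE ?mulr_ge0 ?(ltW D0) ?(ltW l0) ?(ltW
  b0).
Qed.

Let cf : cintegrable m f.
Proof. by have [fL1 _] := gtf; exact: (inLp_cintegrable m1 (lexx _) fL1). Qed.

Lemma gt_expands_fun : exists c : set T -> R[i], expands m W p q c b f.
Proof.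
exists c; have cmf := cintegrable_cmeas cf.
split.
- exact: gt_inLp gtf.
- apply: le_lt_trans (gt_sum_lty gtf); apply: nneseries_le_ub => [k|n].
    exact: Lpnorm_ge0.
  apply: (@le_trans _ _ (\sum_(0 <= k < n.+1) Lpnorm m p (g k))%E).
    under eq_bigr do rewrite Lp_level.
    by rewrite [leRHS]big_nat_recr//= leeDl// Lpnorm_ge0.
  apply: (@le_trans _ _ (\sum_(0 <= j < idx n) Lpnorm m p (dif j))%E).
    elim: n => [|n IH].
      by rewrite big_nat1 big_geq// (_ : g 0%N = fun=> 0) ?Lpnorm0//;
        apply/funext => x; rewrite g0E.
    rewrite big_nat_recr//= [leRHS](big_cat_nat (n := idx n))//=; last exact:
      (idx_mono (leqnSn _)).
    by apply: leeD => //; exact: Lp_g.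
  by apply: nneseries_lim_ge => j _ _; exact: Lpnorm_ge0.
- pose tl n := Lpnorm m p (fun x => f x - \sum_(0 <= j < n) dif j x)%R.
  have tl0 : tl n @[n --> \oo] --> (0 : \bar R)%E.
    apply: (@squeeze_cvge _ _ _ _ (cst 0%E) _
      (fun n => 2%:E * \sum_(n <= k <oo) Lpnorm m p (mdiff m G f k))%E).
    + apply: nearW => n; rewrite /tl Lpnorm_ge0/=.
      exact: (mdiff_series_Lp m1 nX pgG gen p1 cf (gt_sum_lty gtf)).
    + exact: cvg_cst.
    + rewrite -[X in _ --> X](mule0 2%:E); apply: cvgeZl => //.
      apply: nneseries_tail_cvg; first exact: gt_sum_lty gtf.
      by move=> k _; exact: Lpnorm_ge0.
  (* The partial sums over levels form a subsequence, indexed by [idx], of the partial sums of the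
     increments; [idx] tends to infinity. *)
  have E n : Lpnorm m p (fun x => f x - \sum_(k < n.+1) level W c b k x)%R = tl
    (idx n).
    apply: Lpnorm_eq => //.
    + apply: cmeasB => //; exact: cmeas_sum.
    + apply: cmeasB => //; exact: cmeas_sum.
    have : {ae m, forall x, forall k, level W c b k x = g k x}.
      by apply: ae_foralln => k; exact: level_eq.
    apply: filterS => x lx; rewrite -sum_g big_mkord; congr (_ - _).
    by apply: eq_bigr => k _; rewrite lx.
  rewrite -(@cvg_shiftS (\bar R)) /=.
  rewrite (_ : (fun n => _) = tl \o idx); last by apply/funext => n; exact: E.
  apply: cvg_comp tl0; apply/cvgnyPge => n.
  by have [k kP] := idx_infty n; exists k.
- exact: coef_lq.
Qed.

End Function.

Lemma gt_expands f : gt_besov m G s p q f ->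
  exists c : set T -> R[i],
    expands m W p q c (fun Q x => (vol m Q `^ (s - p^-1) * phi Q x)%:C%C) f.
Proof. exact: gt_expands_fun. Qed.

End Expansion.

(** * Adapted and recalibrated grids *)

Section Scaled.
Context d (T : measurableType d) (R : realType).
Variable m : {measure set T -> \bar R}.
Hypothesis m1 : m setT = 1%E.
Variables (X : set T) (P : nat -> set (set T)).
Hypothesis nX : m.-negligible (~` X).
Hypothesis pgP : partition_grid m X P.
Variables lam' lam : R.
Hypothesis lam'01 : 0 < lam' < 1.
Hypothesis lam01 : 0 < lam < 1.
Hypothesis ratio : forall k Q Q', P k.+1 Q -> P k Q' -> Q `<=` Q' ->
      lam' <= vol m Q / vol m Q' <= lam.
Notation rho := (grid_dist m P).

(* Common to the adapted grids and, with scale [maxvol m G], to the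
   recalibrations. *)
Record scaled_grid (W : nat -> set (set T)) (z : set T -> T) (beta : nat -> R)
    (th th' r v1 v2 CL eta : R) : Prop := ScaledGrid {
  sg_good : good_grid m X W ;
  sg_ratio : 0 < th < 1 ;
  sg_th' : 0 < th' ;
  sg_r : 0 < r ;
  sg_v1 : 0 < v1 ;
  sg_CL : 0 <= CL ;
  sg_beta : forall k, 0 < beta k ;
  sg_betaS : forall k, th' * beta k <= beta k.+1 <= th * beta k ;
  sg_vol : forall k Q, W k Q -> v1 * beta k <= vol m Q <= v2 * beta k ;
  sg_center : forall k Q, W k Q -> Q (z Q) ;
  sg_ball : forall k Q, (0 < k)%N -> W k Q -> Q `<=` rball X rho (z Q) (r *
    beta k) ;
  sg_layer : forall k Q t, W k Q -> 0 < t ->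
    (m [set x | Q x /\ (rdist rho x (X `\` Q) <= t%:E)%E]
      <= (CL * (t / beta k) `^ eta)%:E * m Q)%E
}.

Lemma good_grid_measureE W k A : good_grid m X W -> measurable A ->
  m A = (\sum_(Q <- fset_set (W k)) m (A `&` Q))%E.
Proof.
move=> gW mA; have mX := pg_meas_space pgP.
have regW := good_grid_regular gW nX mX.
have mi : measurable_fun setT (fun x => (\1_A x)%:E : \bar R).
  by apply/measurable_EFinP; exact: measurable_indic.
have -> : m A = (\int[m]_x (\1_A x)%:E)%E by rewrite integral_indic// setIT.
rewrite (ae_partition_integral (grid_finite gW) (grid_measurable gW) regW k
  mi); last first.
  by move=> x; rewrite lee_fin.
apply: eq_big_seq => Q; rewrite in_fset_set; last exact: (grid_finite gW).
by move=> /set_mem WQ; rewrite integral_indic//; exact: (grid_measurable gW WQ).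
Qed.

(** Leaving [r] free allows it to be matched with the support radius of blocks; strictness of
    [c2 < r] accounts for open balls. At level 0, where [adapted_with] imposes no metric condition,
    volumes are bounded by finiteness and layers are covered, up to null sets, by layers of cells of
    level 1. *)
Lemma adapted_scaled W z th c1 c2 c3 c4 eta r :
  adapted_with m X rho W z th c1 c2 c3 c4 eta -> c2 < r ->
  exists v1 v2 CL, scaled_grid W z (fun k => th ^+ k) th th r v1 v2 CL eta.
Proof.
move=> aW c2r; have gW := adapted_good aW.
have th01 := adapted_lam aW; have /andP[th0 th1] := th01.
have [c10 c20 c30 c40] := adapted_constants aW.
have eta0 := adapted_eta aW.
have r0 : 0 < r by exact: lt_trans c2r.
have mW k Q : W k Q -> measurable Q by exact: (grid_measurable gW).
have WX k Q : W k Q -> Q `<=` X by exact: (grid_sub gW).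
have zW k Q : W k Q -> Q (z Q) by exact: (adapted_center aW).
have thk k : 0 < th ^+ k by exact: exprn_gt0.
have thk1 k : th ^+ k <= 1 by rewrite exprn_ile1 ?(ltW th0) ?(ltW th1).
have ballW k Q : (0 < k)%N -> W k Q -> Q `<=` rball X rho (z Q) (r * th ^+ k).
  move=> k0 WQ x Qx; split; first exact: WX WQ _ Qx.
  apply: (@le_lt_trans _ _ (c2 * th ^+ k)%:E); last by rewrite lte_fin ltr_pM2r.
  apply: le_trans (adapted_outer aW k0 WQ); apply: ereal_sup_ubound.
  by exists (z Q); [exact: zW WQ|exists x].
have [mu mu0 muP] := @finite_lower_bound R _ (W 0%N) (vol m) (grid_finite gW
  0%N)
  (fun Q WQ => vol_gt0 m1 (mW _ _ WQ) (grid_pos gW WQ)).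
have [c c0 cP] := rball_vol_ge m1 pgP lam'01 lam01 ratio c10.
pose C1 := c4 * (c3 `^ eta)^-1.
have C10 : 0 <= C1 by rewrite mulr_ge0 ?(ltW c40) ?invr_ge0 ?powR_ge0.
have layer1 k Q t : (0 < k)%N -> W k Q -> 0 < t ->
    (m [set x | Q x /\ (rdist rho x (X `\` Q) <= t%:E)%E] <=
     (C1 * (t / th ^+ k) `^ eta)%:E * m Q)%E.
  move=> k0 WQ t0; have ct0 : 0 < t / (c3 * th ^+ k) by rewrite divr_gt0
    ?mulr_gt0.
  have := adapted_layer aW k0 WQ ct0.
  rewrite (_ : c3 * (t / (c3 * th ^+ k)) * th ^+ k = t); last first.
    by field; rewrite !gt_eqF.
  move=> /le_trans; apply; rewrite lee_wpmul2r// lee_fin.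
  rewrite le_eqVlt; apply/orP; left; apply/eqP; rewrite /C1 -mulrA; congr (_ *
    _).
  rewrite (_ : t / (c3 * th ^+ k) = c3^-1 * (t / th ^+ k)); last first.
    by field; rewrite !gt_eqF.
  by rewrite powRM ?invr_ge0 ?(ltW c30) ?divr_ge0 ?(ltW t0) ?(ltW (thk _))//
    powRV ?(ltW c30).
pose nW := (size (fset_set (W 1%N)))%:R : R.
(* [nW] counts the cells of level 1, [th^-1] comes from their scale, and [mu] turns an absolute
   bound into a multiple of [m Q]. *)
pose C2 := C1 * th^-1 `^ eta * nW / mu.
have C20 : 0 <= C2.
  by apply: divr_ge0 (ltW mu0); apply: mulr_ge0 => //; rewrite mulr_ge0
    ?powR_ge0.
exists (Num.min mu (c * c1)), (Num.max 1 r), (Num.max C1 C2); split=> //.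
- by rewrite lt_min mu0 mulr_gt0.
- by rewrite le_max C10.
- by move=> k; rewrite exprS !lexx.
- case=> [|k] Q WQ.
    rewrite expr0 !mulr1 ge_min muP//= le_max vol_le1//; exact: mW WQ.
  have zX : X (z Q) by exact: (WX _ _ WQ _ (zW _ _ WQ)).
  have rk0 : 0 < r * th ^+ k.+1 by rewrite mulr_gt0.
  have ck0 : 0 < c1 * th ^+ k.+1 by rewrite mulr_gt0.
  apply/andP; split.
    apply: (@le_trans _ _ (c * (c1 * th ^+ k.+1))).
      by rewrite mulrA ler_wpM2r ?(ltW (thk _))// ge_min lexx orbT.
    apply: le_trans (cP _ _ zX _) _.
      by rewrite ck0/= ler_piMr// ltW.
    apply: vol_le => //; last exact: (adapted_inner aW).
      exact: (rball_meas m1 pgP lam'01 lam01 ratio).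
    exact: mW WQ.
  apply: (@le_trans _ _ (r * th ^+ k.+1)).
    apply: le_trans (rball_vol_le m1 pgP lam'01 lam01 ratio zX rk0).
    apply: vol_le => //; last exact: ballW.
      exact: mW WQ.
    exact: (rball_meas m1 pgP lam'01 lam01 ratio).
  by rewrite ler_wpM2r ?(ltW (thk _))// le_max lexx orbT.
- case=> [|k] Q t WQ t0; last first.
    apply: le_trans (layer1 _ _ _ (ltn0Sn k) WQ t0) _.
    by rewrite lee_wpmul2r// lee_fin ler_wpM2r ?powR_ge0// le_max lexx.
  set L := [set x | _].
  have mL : measurable L by exact: (layer_meas m1 pgP _ _ (mW _ _ WQ)).
  rewrite (good_grid_measureE 1 gW mL).
  apply: (@le_trans _ _ (\sum_(Q' <- fset_set (W 1%N)) (C1 * th^-1 `^ eta * t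
    `^ eta)%:E)%E).
    rewrite big_seq [leRHS]big_seq; apply: lee_sum => Q'.
    rewrite in_fset_set; last exact: (grid_finite gW).
    move=> /set_mem WQ'; have mQ' := mW _ _ WQ'.
    have [Q'' WQ'' Q'Q''] := grid_nested gW WQ'.
    have B0 : (0 <= (C1 * th^-1 `^ eta * t `^ eta)%:E)%E.
      by rewrite lee_fin mulr_ge0 ?powR_ge0// mulr_ge0 ?powR_ge0.
    (* A cell of level 1 whose parent is not [Q] meets [Q] in a null set. *)
    have [QQ''|QQ''] := pselect (Q = Q''); last first.
      apply: le_trans B0; rewrite -(grid_disjoint gW WQ WQ'' QQ'').
      apply: le_measure; rewrite ?inE.
      - exact: measurableI.
      - by apply: measurableI; [exact: mW WQ|exact: mW WQ''].
      - by move=> x [[Qx _] Q'x]; split=> //; exact: Q'Q''.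
    apply: (@le_trans _ _ (m [set x | Q' x /\ (rdist rho x (X `\` Q') <=
      t%:E)%E])).
      apply: le_measure; rewrite ?inE.
      - exact: measurableI.
      - exact: (layer_meas m1 pgP).
      - move=> x [[Qx h] Q'x]; split=> //; apply: le_trans h.
        apply: ereal_inf_le_tmp => _ [y [Xy nQy] <-]; exists y => //; split=>
          //.
        by rewrite QQ'' in nQy => /Q'Q''.
    apply: le_trans (layer1 _ _ _ (ltn0Sn 0) WQ' t0) _.
    rewrite (_ : C1 * (t / th ^+ 1) `^ eta = C1 * th^-1 `^ eta * t `^ eta);
      last first.
      by rewrite expr1 powRM ?invr_ge0 ?(ltW th0) ?(ltW t0)//; ring.
    by rewrite (volE m1 mQ') -EFinM lee_fin ler_piMr ?vol_le1// -lee_fin.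
  rewrite sumEFin big_const_seq count_predT iter_addr addr0 expr0 divr1.
  have mQ := mW _ _ WQ; rewrite (volE m1 mQ) -EFinM lee_fin.
  apply: (@le_trans _ _ (C2 * t `^ eta * mu)).
    rewrite /C2 -[_ *+ _]mulr_natr -/nW.
    rewrite le_eqVlt; apply/orP; left; apply/eqP.
    by field; rewrite gt_eqF.
  apply: ler_pM; [by rewrite mulr_ge0 ?powR_ge0|exact: ltW| |exact: muP].
  by rewrite ler_wpM2r ?powR_ge0// le_max lexx orbT.
Qed.

Section Recal.
Variable G : nat -> set (set T).
Hypothesis rG : recalibration m X P G.

Let gG : good_grid m X G. Proof. by case: rG. Qed.
Let GP : cells G `<=` cells P. Proof. by case: rG. Qed.
Let mG k Q : G k Q -> measurable Q. Proof. exact: (grid_measurable gG). Qed.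

Lemma recal_partition : partition_grid m X G.
Proof. exact: (subgrid_partition m1 pgP lam01 ratio). Qed.

Let XT : exists x, X x.
Proof.
apply/set0P/eqP => X0; have : m setT = 0%E.
  by apply/negligibleP => //; rewrite -setC0 -X0.
by rewrite m1 => /eqP; rewrite onee_eq0.
Qed.

Lemma maxvol_ge k Q : G k Q -> vol m Q <= maxvol m G k.
Proof.
move=> GQ; apply: ub_le_sup; last by exists Q.
by exists 1 => _ [S GS <-]; apply: vol_le1 => //; exact: mG GS.
Qed.

Lemma minvol_le k Q : G k Q -> minvol m G k <= vol m Q.
Proof.
move=> GQ; apply: ge_inf; last by exists Q.
by exists 0 => _ [S GS <-]; exact: vol_ge0.
Qed.

Lemma maxvol_gt0 k : 0 < maxvol m G k.
Proof.
have [x Xx] := XT; have [S GS Sx] := pg_cover recal_partition k Xx.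
by apply: lt_le_trans (maxvol_ge GS); exact: (pg_vol_gt0 m1 recal_partition GS).
Qed.

Lemma recal_scale : exists th1 th2 dl : R,
  [/\ 0 < th1, 0 < th2 < 1, 0 < dl,
      forall k, th1 * maxvol m G k <= maxvol m G k.+1 <= th2 * maxvol m G k &
      forall k S, G k S -> dl * maxvol m G k <= vol m S].
Proof.
case: rG => _ _ _ [th1 [th2 [dl [/andP[th10 _] th201 /andP[dl0 _] H]]]].
exists th1, th2, dl; split=> //.
  move=> k; have [h _] := H k; have l0 := maxvol_gt0 k.
  by move: h; rewrite ler_pdivlMr// ler_pdivrMr.
move=> k S GS; have [_ /andP[h1 h2]] := H k; have l0 := maxvol_gt0 k.
have mv0 : 0 < minvol m G k.
  have h0 : 0 <= minvol m G k.
    apply: lb_le_inf; first by exists (vol m S), S.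
    by move=> _ [S' _ <-]; exact: vol_ge0.
  rewrite lt0r h0 andbT; apply/eqP => e0.
  (* Division by 0 yields 0, so a vanishing [minvol] would contradict the lower bound 1 on the
     quotient. *)
  by move: h1; rewrite e0 invr0 mulr0 ler10.
apply: le_trans (minvol_le GS); move: h2; rewrite ler_pdivrMr// => h2.
by rewrite -ler_pdivlMl.
Qed.

(* Points of a cell [Q] are at distance at least [vol Q] from its complement,
   so the layers are empty below that scale and every exponent is allowed. *)
Lemma recal_scaled eta : 0 < eta -> exists z th th' r v1 v2 CL,
  scaled_grid G z (maxvol m G) th th' r v1 v2 CL eta.
Proof.
move=> eta0; have [th1 [th2 [dl [th10 th201 dl0 lS lV]]]] := recal_scale.
have [x0 _] := XT; have pgG := recal_partition.
(* [r = 2] makes the closed bound by [maxvol] strict; [CL] is chosen so that the right-hand side is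
   at least [m Q] as soon as [t >= dl * maxvol m G k]. *)
exists (fun Q => xget x0 Q), th2, th1, 2, dl, 1, (dl `^ (- eta)); split=> //.
- exact: powR_ge0.
- exact: maxvol_gt0.
- by move=> k Q GQ; rewrite lV//= mul1r maxvol_ge.
- move=> k Q GQ; apply: xgetPex; apply: (cells_nonempty m1 pgG).
  by exists k.
- move=> k Q _ GQ x Qx; split; first exact: (pg_sub pgG GQ).
  have cQ : cells P Q by apply: GP; exists k.
  have Qz : Q (xget x0 Q) by apply: xgetPex; exists x.
  apply: le_lt_trans (rho_le m1 pgP cQ Qz Qx) _.
  rewrite lte_fin; apply: le_lt_trans (maxvol_ge GQ) _.
  by rewrite ltr_pMl ?maxvol_gt0// ltr1n.
- move=> k Q t GQ t0; set L := [set x | _].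
  have mQ := mG GQ; have l0 := maxvol_gt0 k.
  have mL : measurable L by exact: (layer_meas m1 pgP).
  have [tl|lt] := ltP t (vol m Q).
    rewrite (_ : L = set0) ?measure0.
      by rewrite mule_ge0// lee_fin mulr_ge0 ?powR_ge0.
    apply/seteqP; split=> // x [Qx h].
    have cQ : cells P Q by apply: GP; exists k.
    have : ((vol m Q)%:E <= rdist rho x (X `\` Q))%E.
      apply: le_ereal_inf_tmp => _ [y [_ nQy] <-].
      exact: (rho_sep m1 pgP lam01 ratio cQ Qx nQy).
    by move=> /le_trans/(_ h); rewrite lee_fin leNgt tl.
  apply: (@le_trans _ _ (1%:E * m Q)%E).
    by rewrite mul1e; apply: le_measure; rewrite ?inE// => x [].
  rewrite lee_wpmul2r// lee_fin powRN mulrC ler_pdivlMr ?powR_gt0// mul1r.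
  rewrite ge0_ler_powR ?(ltW eta0)// ?nnegrE ?(ltW dl0) ?divr_ge0 ?(ltW t0)
    ?(ltW l0)//.
  by rewrite ler_pdivlMr// (le_trans (lV _ _ GQ)).
Qed.

End Recal.
End Scaled.

(** * Comparison of the spaces *)

Section Comparison.
Context d (T : measurableType d) (R : realType).
Variable m : {measure set T -> \bar R}.
Hypothesis m1 : m setT = 1%E.
Variables (X : set T) (P : nat -> set (set T)).
Hypothesis nX : m.-negligible (~` X).
Hypothesis pgP : partition_grid m X P.
Variables lam' lam : R.
Hypothesis lam'01 : 0 < lam' < 1.
Hypothesis lam01 : 0 < lam < 1.
Hypothesis ratio : forall k Q Q', P k.+1 Q -> P k Q' -> Q `<=` Q' ->
      lam' <= vol m Q / vol m Q' <= lam.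
Notation rho := (grid_dist m P).
Variable G : nat -> set (set T).
Hypothesis rG : recalibration m X P G.
Variables (p s : R) (q : \bar R).
Hypotheses (p1 : 1 <= p) (q1 : (1 <= q)%E) (s0 : 0 < s) (sp1 : s < p^-1).

Let p0 : 0 < p. Proof. by rewrite (lt_le_trans ltr01). Qed.
Let pgG : partition_grid m X G.
Proof. exact: (recal_partition m1 pgP lam01 ratio rG). Qed.
Let gG : good_grid m X G. Proof. by case: rG. Qed.
Let ell_gt0 k : 0 < maxvol m G k.
Proof. exact: (maxvol_gt0 m1 nX pgP lam01 ratio rG). Qed.
Let mX : measurable X. Proof. exact: (pg_meas_space pgP). Qed.
Let cellG k S : G k S -> cells P S.
Proof. by case: rG => _ GP _ _ GS; apply: GP; exists k. Qed.

Let rho_cell k S x y : G k S -> S x -> S y -> (rho x y <= (maxvol m G k)%:E)%E.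
Proof.
move=> GS Sx Sy; apply: le_trans (rho_le m1 pgP (cellG GS) Sx Sy) _.
by rewrite lee_fin (maxvol_ge m1 rG GS).
Qed.

Variables (W : nat -> set (set T)) (z : set T -> T) (beta : nat -> R).
Variables (th th' r v1 v2 CL eta : R).
Hypothesis sW : scaled_grid m X P W z beta th th' r v1 v2 CL eta.

Let gW : good_grid m X W. Proof. exact: (sg_good sW). Qed.
Let finW k : finite_set (W k). Proof. exact: (grid_finite gW). Qed.
Let measW k Q : W k Q -> measurable Q. Proof. exact: (grid_measurable gW). Qed.
Let subW k Q : W k Q -> Q `<=` X. Proof. exact: (grid_sub gW). Qed.
Let regW : m.-negligible (~` regular_points W).
Proof. exact: (good_grid_regular gW nX mX). Qed.
Let r0 : 0 < r. Proof. exact: (sg_r sW). Qed.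
Let v10 : 0 < v1. Proof. exact: (sg_v1 sW). Qed.
Let beta_gt0 k : 0 < beta k. Proof. exact: (sg_beta sW). Qed.
Let rb0 k : 0 < r * beta k. Proof. by rewrite mulr_gt0. Qed.
Let zQ k Q : W k Q -> Q (z Q). Proof. exact: (sg_center sW). Qed.
Let zX k Q : W k Q -> X (z Q). Proof. by move=> WQ; exact: (subW WQ (zQ WQ)).
  Qed.
Let levelW k k' Q : W k Q -> W k' Q -> k = k'.
Proof. exact: (good_grid_level m1 gW). Qed.
Let vol0 k Q : W k Q -> 0 < vol m Q.
Proof. by move=> WQ; exact: (vol_gt0 m1 (measW WQ) (grid_pos gW WQ)). Qed.
Let th01 : 0 < th < 1. Proof. exact: (sg_ratio sW). Qed.

(** Leaving a cell of [G] costs at least its volume, hence at least [dl] times the scale of its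
    level. *)
Let rball_sub_cell k Q x : (0 < k)%N -> W k Q -> rball X rho (z Q) (r * beta k)
  x ->
  forall dl, 0 < dl -> (forall j S, G j S -> dl * maxvol m G j <= vol m S) ->
  forall j S, G j S -> S (z Q) -> r / dl * beta k <= maxvol m G j -> S x.
Proof.
move=> k0 WQ [Xx h] dl dl0 dlP j S GS Sz lj; apply: contrapT => nSx.
have := rho_sep m1 pgP lam01 ratio (cellG GS) Sz nSx.
move=> /le_lt_trans/(_ h); rewrite lte_fin ltNge => /negP; apply.
apply: le_trans (dlP _ _ GS); rewrite -ler_pdivrMl//.
by rewrite mulrA (mulrC _ r).
Qed.

(** Common source of the two expansions: [phi] will be the indicators of the cells for [grid_besov],
    and a partition of unity made of balls for blocks. *)
Lemma gt_phi (phi : set T -> T -> R) f :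
  (forall k Q, W k Q -> measurable_fun setT (phi Q)) ->
  (forall k Q x, (0 < k)%N -> W k Q -> phi Q x != 0 ->
    rball X rho (z Q) (r * beta k) x) ->
  (forall k, (0 < k)%N ->
    {ae m, forall x, \sum_(Q <- fset_set (W k)) phi Q x = 1}) ->
  gt_besov m G s p q f -> exists c : set T -> R[i],
    expands m W p q c (fun Q x => (vol m Q `^ (s - p^-1) * phi Q x)%:C%C) f.
Proof.
move=> phim phis phi1 gtf.
have [th1 [th2 [dl [th10 th201 dl0 lS lV]]]] := recal_scale m1 nX pgP lam01
  ratio rG.
apply: (@gt_expands _ _ _ m m1 X G nX pgG _ th2 (maxvol m G) th201 ell_gt0 _ _
  p s q p1 q1 s0 W th th' beta z phi (r / dl) v1) => //.
- exact: (grid_generates gG).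
- by move=> k; case/andP: (lS k).
- exact: (sg_th' sW).
- exact: (sg_betaS sW).
- by rewrite divr_gt0.
- by move=> k Q WQ; case/andP: (sg_vol sW WQ).
- move=> k Q x j S k0 WQ Qx; apply: (rball_sub_cell k0 WQ _ dl0 lV).
  exact: (sg_ball sW k0 WQ Qx).
- move=> k Q x j S k0 WQ ph; apply: (rball_sub_cell k0 WQ _ dl0 lV).
  exact: phis.
Qed.

Lemma gt_sub_grid : gt_besov m G s p q `<=` grid_besov m W s p q.
Proof.
move=> f gtf; apply: (gt_phi (phi := fun Q => \1_Q)) gtf.
- by move=> k Q WQ; apply: measurable_indic; exact: measW WQ.
- move=> k Q x k0 WQ; rewrite indicE pnatr_eq0 eqb0 negbK => /set_mem Qx.
  exact: (sg_ball sW k0 WQ Qx).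
- move=> k k0; apply: filterS (regular_ae regW) => x rx.
  have [Q [[WQ Qx] _]] := rx k.
  rewrite (regular_sum finW rx WQ Qx); first by rewrite indicE mem_set.
  by move=> Q' _ Q'x; rewrite indicE memNset.
Qed.

(* The supports of level [k]; at level [0] only the trivial one is available. *)
Let B Q : set T := [set x | X x /\
  forall k, (0 < k)%N -> W k Q -> rball X rho (z Q) (r * beta k) x].

Let B_pos k Q : (0 < k)%N -> W k Q -> B Q = rball X rho (z Q) (r * beta k).
Proof.
move=> k0 WQ; apply/seteqP; split=> x; first by move=> [_]; exact.
move=> h; split; first by case: h.
by move=> k' k'0 WQ'; rewrite -(levelW WQ WQ').
Qed.

Let B_zero Q : W 0%N Q -> B Q = X.
Proof.
move=> WQ; apply/seteqP; split=> x; first by case.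
by move=> Xx; split=> // k k0 WQ'; move: k0; rewrite -(levelW WQ WQ').
Qed.

Let B_meas k Q : W k Q -> measurable (B Q).
Proof.
case: k => [|k] WQ; first by rewrite B_zero.
rewrite (B_pos (ltn0Sn k) WQ).
exact: (rball_meas m1 pgP lam'01 lam01 ratio (zX WQ)).
Qed.

Let B_vol : exists2 CB : R, 0 <= CB & forall k Q, W k Q -> vol m (B Q) <= CB *
  beta k.
Proof.
exists (Num.max r (beta 0%N)^-1); first by rewrite le_max ltW.
case=> [|k] Q WQ.
  apply: (@le_trans _ _ 1); first by rewrite vol_le1//; exact: B_meas WQ.
  by rewrite -ler_pdivrMr// div1r le_max lexx orbT.
rewrite (B_pos (ltn0Sn k) WQ).
apply: le_trans (rball_vol_le m1 pgP lam'01 lam01 ratio (zX WQ) (rb0 _)) _.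
by rewrite ler_wpM2r ?(ltW (beta_gt0 _))// le_max lexx.
Qed.

(** If [x] lies in [B Q] at a positive level, [B Q] is the ball about [x]. The cells counted are
    thus essentially disjoint subsets of one ball of volume at most [r * beta j], each of volume at
    least [v1 * beta j]. At level 0 all cells are counted. *)
Let B_overlap : exists2 N : R, 0 <= N & forall j x, X x ->
  \sum_(Q <- fset_set (W j)) (`[< B Q x >])%:R <= N.
Proof.
exists (Num.max (r / v1) (size (fset_set (W 0%N)))%:R).
  by rewrite le_max divr_ge0 ?(ltW r0) ?(ltW v10).
case=> [|j] x Xx.
  rewrite le_max; apply/orP; right.
  apply: (@le_trans _ _ (\sum_(Q <- fset_set (W 0%N)) 1)).
    by apply: ler_sum => Q _; case: (asbool _); rewrite /= ?lexx ?ler01.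
  by rewrite big_const_seq count_predT iter_addr addr0.
rewrite le_max; apply/orP; left.
rewrite ler_pdivlMr// -(ler_pM2r (beta_gt0 j.+1)) -mulrA.
have mB : measurable (rball X rho x (r * beta j.+1)).
  exact: (rball_meas m1 pgP lam'01 lam01 ratio).
apply: le_trans (rball_vol_le m1 pgP lam'01 lam01 ratio Xx (rb0 _)).
rewrite -lee_fin -(volE m1 mB) (good_grid_measureE nX pgP j.+1 gW mB).
rewrite mulr_suml -sumEFin big_seq [leRHS]big_seq; apply: lee_sum => Q.
rewrite in_fset_set// => /set_mem WQ.
case: (asboolP (B Q x)) => [|_]; last by rewrite mul0r.
rewrite (B_pos (ltn0Sn j) WQ) => Bx.
rewrite (rball_eq m1 pgP (zX WQ) Bx) setIidr; last exact: (sg_ball sW (ltn0Sn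
  j) WQ).
rewrite (volE m1 (measW WQ)) lee_fin mul1r.
by case/andP: (sg_vol sW WQ).
Qed.

(** The factor 1/2 keeps the diameter of [S] strictly below the radius of the open ball;
    ultrametricity does the rest. *)
Let B_saturated j k Q S : W j Q -> maxvol m G k <= r / 2 * beta j ->
  G k S -> (exists x, S x /\ B Q x) -> S `<=` B Q.
Proof.
case: j => [|j] WQ kj GS [x [Sx Bx]].
  by rewrite (B_zero WQ); exact: (pg_sub pgG GS).
move: Bx; rewrite (B_pos (ltn0Sn j) WQ) => Bx y Sy.
apply: (rball_trans m1 pgP Bx); split; first exact: (pg_sub pgG GS).
apply: le_lt_trans (rho_cell GS Sx Sy) _; rewrite lte_fin.
apply: (le_lt_trans kj); rewrite -mulrA mulrCA gtr_pMl ?invf_lt1 ?ltr1n//.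
Qed.

Lemma molecules_sub (e C : R) (b : set T -> T -> R[i]) c f : 0 < e -> 0 <= C ->
  (forall j Q, W j Q -> cmeas (b Q)) ->
  (forall j Q, W j Q -> (Lpnorm m p (b Q) <= (C * beta j `^ s)%:E)%E) ->
  (forall j k Q, W j Q -> maxvol m G k <= r / 2 * beta j ->
    (Lpnorm m p (mdiff m G (b Q) k.+1) <=
     (C * beta j `^ s * (maxvol m G k / beta j) `^ (s + e))%:E)%E) ->
  (forall j Q x, W j Q -> X x -> ~ B Q x -> b Q x = 0) ->
  expands m W p q c b f -> gt_besov m G s p q f.
Proof.
move=> e0 C0 bm bn bd bs.
have [th1 [th2 [dl [th10 th201 dl0 lS lV]]]] := recal_scale m1 nX pgP lam01
  ratio rG.
have [N N0 NP] := B_overlap.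
apply: (@molecules_gt _ _ _ m m1 X G nX pgG th1 th2 (maxvol m G) th10 th201
  ell_gt0
  lS W th beta finW th01 beta_gt0 _ p s e q p1 q1 s0 e0 b B C N (r / 2)) => //.
- by move=> k; case/andP: (sg_betaS sW k).
- by rewrite divr_gt0.
Qed.

Let Lp_indic (a : R) A : measurable A -> 0 <= a ->
  Lpnorm m p (fun x => (a * \1_A x)%:C%C) = (a * vol m A `^ p^-1)%:E.
Proof.
move=> mA a0; have pn0 := lt0r_neq0 p0.
have av0 : (0 <= (a * vol m A `^ p^-1)%:E)%E by rewrite lee_fin mulr_ge0
  ?powR_ge0.
suff E : (Lpnorm m p (fun x => (a * \1_A x)%:C%C) `^ p = (a * vol m A `^
  p^-1)%:E `^ p)%E.
  apply/eqP; rewrite eq_le -(lee_poweR p0) ?Lpnorm_ge0// E lexx/=.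
  by rewrite -(lee_poweR p0) ?Lpnorm_ge0// E.
rewrite (Lpnorm_powE m _ pn0) poweR_EFin powRM ?powR_ge0// -powRrM mulVf//.
rewrite powRr1 ?vol_ge0// EFinM -(volE m1 mA).
rewrite (_ : (\int[m]_x _)%E = (\int[m]_x ((a `^ p)%:E * (\1_A x)%:E))%E).
  rewrite ge0_integralZl_EFin ?powR_ge0// ?integral_indic ?setIT//.
  by apply/measurable_EFinP; exact: measurable_indic.
apply: eq_integral => x _; rewrite modulus_real normrM (ger0_norm a0).
rewrite (@ger0_norm _ (\1_A x))// powRM// EFinM indicE; congr (_ * _%:E)%E.
by case: (x \in A); rewrite ?powR1 ?powR0.
Qed.

Let vol_pow_le k Q a : W k Q -> 0 <= a -> vol m Q `^ a <= v2 `^ a * beta k `^ a.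
Proof.
move=> WQ a0; have /andP[_ h] := sg_vol sW WQ.
have v20 : 0 < v2.
  by rewrite -(pmulr_lgt0 _ (beta_gt0 k)); apply: lt_le_trans h; exact: vol0 WQ.
by rewrite -powRM ?(ltW v20) ?(ltW (beta_gt0 _))// ge0_ler_powR// nnegrE
  ?vol_ge0// mulr_ge0 ?(ltW v20) ?(ltW (beta_gt0 _)).
Qed.

(** The definition of a block does not include measurability. A function that is Lipschitz for [rho]
    is the uniform limit of its samples on the cells of [P n], whose diameters are at most
    [lam ^ n]. *)
Lemma lipschitz_cmeas (K : R) (a : T -> R[i]) : 0 <= K -> (forall x, ~ X x -> a
  x = 0) ->
  (forall x y, X x -> X y -> ((modulus (a x - a y))%:E <= K%:E * rho x y)%E) ->
  cmeas a.
Proof.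
move=> K0 aX aK; have [Xe|nXe] := pselect (exists x0, X x0); last first.
  rewrite (_ : a = fun=> 0); first exact: cmeas_cst.
  by apply/funext => x; apply: aX => Xx; apply: nXe; exists x.
have [x0 _] := Xe; have lam0 : 0 < lam by case/andP: lam01.
have finP k : finite_set (P k) by exact: (pg_finite pgP).
pose an n x : R[i] := \sum_(C <- fset_set (P n))
  a (xget x0 C) * (\1_(if C \in fset_set (P n) then C else set0) x)%:C%C.
have can n : cmeas (an n).
  apply: cmeas_sum => C; apply: cmeasM; first exact: cmeas_cst.
  apply: cmeas_real; apply: measurable_indic; case: ifPn => //.
  by rewrite in_fset_set// => /set_mem; exact: (pg_meas pgP).
have anE n x C : P n C -> C x -> an n x = a (xget x0 C).
  move=> PC Cx; have Xx := pg_sub pgP PC Cx.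
  rewrite /an (regular_sum finP (pg_regular pgP Xx) PC Cx).
    by rewrite in_fset_set// (mem_set PC) indicE mem_set// mulr1.
  by move=> C' PC' C'x; rewrite in_fset_set// (mem_set PC') indicE memNset//
    mulr0.
have an0 n x : ~ X x -> an n x = 0.
  move=> nXx; rewrite /an big_seq big1// => C CP; rewrite CP indicE memNset
    ?mulr0//.
  move: CP; rewrite in_fset_set// => /set_mem PC Cx.
  exact/nXx/(pg_sub pgP PC Cx).
have bd n x : modulus (an n x - a x) <= K * lam ^+ n.
  have [Xx|nXx] := pselect (X x); last first.
    by rewrite an0// aX// subrr modulus0 mulr_ge0// exprn_ge0// ltW.
  have [C PC Cx] := pg_cover pgP n Xx; rewrite (anE _ _ _ PC Cx).
  have Cg : C (xget x0 C) by apply: xgetPex; exists x.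
  have cC : cells P C by exists n.
  rewrite -lee_fin; apply: le_trans (aK _ _ (pg_sub pgP PC Cg) Xx) _.
  rewrite EFinM lee_wpmul2l ?lee_fin//.
  apply: le_trans (rho_le m1 pgP cC Cg Cx) _.
  by rewrite lee_fin (pg_vol_exp m1 pgP lam01 ratio PC).
have lim (u : R[i] -> R) x : (forall v, `|u v| <= modulus v) ->
    (forall v w, u (v - w) = u v - u w) -> u (an n x) @[n --> \oo] --> u (a x).
  move=> um ud; apply/cvgrPdist_le => eps eps0.
  have [n nP] : exists n, K * lam ^+ n <= eps.
    have K1 : 0 < K + 1 by rewrite ltr_wpDl.
    have [n nP] := exp_lt lam01 (divr_gt0 eps0 K1).
    exists n; apply: (@le_trans _ _ ((K + 1) * lam ^+ n)).
      by rewrite ler_wpM2r ?exprn_ge0 ?(ltW lam0)// lerDl.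
    by rewrite mulrC -ler_pdivlMr// ltW.
  exists n => // k /= nk; rewrite distrC -ud (le_trans (um _))// (le_trans (bd
    _ _))//.
  apply: le_trans nP; rewrite ler_wpM2l//.
  by rewrite ler_wiXn2l ?(ltW lam0)//; case/andP: lam01 => _ /ltW.
split.
  apply: (@measurable_fun_cvg _ T R setT (fun n x => complex.Re (an n x))).
    by move=> n; exact: (can n).1.
  by move=> x _; apply: (lim (@complex.Re R)); [exact: Re_le_modulus|exact:
    ReB].
apply: (@measurable_fun_cvg _ T R setT (fun n x => complex.Im (an n x))).
  by move=> n; exact: (can n).2.
by move=> x _; apply: (lim (@complex.Im R)); [exact: Im_le_modulus|exact: ImB].
Qed.

Let s1 : s < 1.
Proof. by apply: (lt_le_trans sp1); rewrite invf_le1. Qed.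

Let vol_negpow_le k Q a : W k Q -> 0 <= a ->
  vol m Q `^ (- a) <= v1 `^ (- a) * beta k `^ (- a).
Proof.
move=> WQ a0; have /andP[h _] := sg_vol sW WQ; have vb0 : 0 < v1 * beta k by
  rewrite mulr_gt0.
rewrite -powRM ?(ltW v10) ?(ltW (beta_gt0 _))// !powRN lef_pV2 ?posrE
  ?powR_gt0//.
  by rewrite ge0_ler_powR// nnegrE ?vol_ge0// ltW.
exact: vol0 WQ.
Qed.

Let Lp_supp (a : T -> R[i]) (A : R) k Q : W k Q -> cmeas a -> 0 <= A ->
  (forall x, X x -> modulus (a x) <= A * \1_(B Q) x) ->
  (Lpnorm m p a <= (A * vol m (B Q) `^ p^-1)%:E)%E.
Proof.
move=> WQ ca A0 aA; rewrite -Lp_indic//; last exact: B_meas WQ.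
apply: Lpnorm_le => //.
  apply: cmeas_real; apply: measurable_funM; first exact: measurable_cst.
  by apply: measurable_indic; exact: B_meas WQ.
apply: filterS (pg_ae nX) => x Xx; apply: le_trans (aA _ Xx) _.
by rewrite modulus_real ler_norm.
Qed.

(** On a cell of level [j] of [G] a block oscillates by at most its Lipschitz constant times
    [maxvol m G j]. This is the power 1 of the scale, so [s + e = 1]; volumes of [Q] and [B Q] are
    then exchanged for powers of [beta k]. *)
Lemma blocks_sub c (a : set T -> T -> R[i]) f :
  (forall k Q, W k Q -> block m X rho s p (r * beta k) Q (z Q) (a Q)) ->
  expands m W p q c a f -> gt_besov m G s p q f.
Proof.
move=> aB fE; have [CB CB0 CBP] := B_vol.
have e0 : 0 < 1 - s by rewrite subr_gt0.
have a_out k Q x : W k Q -> ~ X x -> a Q x = 0.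
  move=> WQ nXx; have [h _ _] := aB k Q WQ; apply: contrapT => /h[Xx _].
  exact: nXx.
have a_supp k Q x : W k Q -> ~ B Q x -> a Q x = 0.
  move=> WQ nB; have [h _ _] := aB k Q WQ; apply: contrapT => /h ax; apply: nB.
  split; first by case: ax.
  by move=> k' _ WQ'; rewrite -(levelW WQ WQ').
have am k Q : W k Q -> cmeas (a Q).
  move=> WQ; have [_ _ h] := aB k Q WQ; apply: lipschitz_cmeas h.
    exact: powR_ge0.
  by move=> x; exact: a_out WQ.
have t0 : 0 <= p^-1 - s by rewrite subr_ge0 ltW.
have t1 : 0 <= p^-1 - s + 1 by rewrite addr_ge0.
(* The first term serves the size bound and the second the oscillation bound, with the 4 of
   [mdiff_osc]; [CB] bounds the volume of the supports. *)
pose C := (v1 `^ (- (p^-1 - s)) + 4 * v1 `^ (- (p^-1 - s + 1))) * CB `^ p^-1.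
have C0 : 0 <= C by rewrite mulr_ge0 ?addr_ge0 ?mulr_ge0 ?powR_ge0.
have Bp k Q : W k Q -> vol m (B Q) `^ p^-1 <= CB `^ p^-1 * beta k `^ p^-1.
  move=> WQ; rewrite -powRM ?(ltW (beta_gt0 _))//.
  rewrite ge0_ler_powR ?invr_ge0 ?(ltW p0)// ?nnegrE ?vol_ge0 ?mulr_ge0 ?(ltW
    (beta_gt0 _))//.
  exact: CBP.
apply: (molecules_sub e0 C0 am _ _ _ fE).
- move=> k Q WQ; have [_ h _] := aB k Q WQ; have b0 := beta_gt0 k.
  rewrite -opprB in h.
  apply: (le_trans (Lp_supp WQ (am _ _ WQ) (powR_ge0 (vol m Q) (- (p^-1 - s)))
    _)).
    move=> x Xx; rewrite indicE; case: (asboolP (B Q x)) => Bx.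
      by rewrite mem_set// mulr1 h.
    by rewrite memNset// mulr0 (a_supp _ _ _ WQ Bx) modulus0.
  rewrite lee_fin.
  apply: (@le_trans _ _ ((v1 `^ (- (p^-1 - s)) * beta k `^ (- (p^-1 - s))) *
      (CB `^ p^-1 * beta k `^ p^-1))).
    apply: ler_pM; [exact: powR_ge0|exact: powR_ge0| |exact: (Bp _ _ WQ)].
    exact: (vol_negpow_le WQ t0).
  have bs : beta k `^ (- (p^-1 - s)) * beta k `^ p^-1 = beta k `^ s.
    rewrite -powRD; last by rewrite (gt_eqF b0) implybT.
    by rewrite opprB subrK.
  rewrite mulrACA bs ler_wpM2r ?powR_ge0// /C ler_wpM2r ?powR_ge0// lerDl.
  by rewrite mulr_ge0 ?powR_ge0.
- move=> k j Q WQ kj; have [_ _ h] := aB k Q WQ; have b0 := beta_gt0 k.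
  have l0 := ell_gt0 j.
  have ci : cintegrable m (a Q).
    have [_ h' _] := aB k Q WQ; apply: (Lp_cintegrable m1 p1 (am _ _ WQ)).
    apply: le_lt_trans (Lp_supp (A := vol m Q `^ (s - p^-1)) WQ (am _ _ WQ) _
      _) (ltry _).
      exact: powR_ge0.
    move=> x Xx; rewrite indicE; case: (asboolP (B Q x)) => Bx.
      by rewrite mem_set// mulr1 h'.
    by rewrite memNset// mulr0 (a_supp _ _ _ WQ Bx) modulus0.
  rewrite (_ : s - p^-1 - 1 = - (p^-1 - s + 1)) in h; last by ring.
  pose D := 4 * (vol m Q `^ (- (p^-1 - s + 1)) * maxvol m G j).
  have D0 : 0 <= D by rewrite !mulr_ge0 ?powR_ge0 ?(ltW l0).
  apply: (le_trans (Lp_supp (A := D) WQ (cmeas_mdiff pgG _ _) D0 _)).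
    move=> x Xx; have [S GS Sx] := pg_cover pgG j Xx.
    rewrite indicE; case: (asboolP (B Q x)) => Bx.
      rewrite mem_set// mulr1; apply: (mdiff_osc m1 pgG ci GS Sx) => y y' Sy
        Sy'.
      rewrite -lee_fin; apply: le_trans (h _ _ (pg_sub pgG GS Sy) (pg_sub pgG
        GS Sy')) _.
      by rewrite EFinM lee_wpmul2l ?lee_fin ?powR_ge0// (rho_cell GS Sy Sy').
    rewrite memNset// mulr0 -(mulr0 4); apply: (mdiff_osc m1 pgG ci GS Sx) => y
      y' Sy Sy'.
    have az w : S w -> a Q w = 0.
      move=> Sw; apply: (a_supp _ _ _ WQ) => Bw; apply: Bx.
      by apply: (B_saturated WQ kj GS) Sx; exists w.
    by rewrite !az// subrr modulus0.
  rewrite lee_fin subrKC powRr1 ?divr_ge0 ?(ltW l0) ?(ltW b0)//.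
  apply: (@le_trans _ _ ((4 * (v1 `^ (- (p^-1 - s + 1)) * beta k `^ (- (p^-1 -
    s + 1)) *
      maxvol m G j)) * (CB `^ p^-1 * beta k `^ p^-1))).
    apply: ler_pM => //; [exact: powR_ge0| |exact: (Bp _ _ WQ)].
    by rewrite /D ler_wpM2l// ler_wpM2r ?(ltW l0)// (vol_negpow_le WQ t1).
  have bs : beta k `^ (- (p^-1 - s + 1)) * beta k `^ p^-1 = beta k `^ s / beta
    k.
    rewrite -powRD; last by rewrite (gt_eqF b0) implybT.
    rewrite -[(beta k)^-1]powR_inv1 ?(ltW b0)// -powRD; last by rewrite (gt_eqF
      b0) implybT.
    by congr (_ `^ _); ring.
  rewrite [leLHS](_ : _ = 4 * v1 `^ (- (p^-1 - s + 1)) * CB `^ p^-1 * maxvol m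
    G j *
     (beta k `^ (- (p^-1 - s + 1)) * beta k `^ p^-1)); last by ring.
  rewrite bs [leRHS](_ : _ = C * maxvol m G j * (beta k `^ s / beta k)); last
    by ring.
  rewrite ler_wpM2r ?mulr_ge0 ?powR_ge0 ?invr_ge0 ?(ltW b0)// ler_wpM2r ?(ltW
    l0)//.
  by rewrite /C ler_wpM2r ?powR_ge0// lerDr powR_ge0.
- by move=> k Q x WQ _ nB; exact: a_supp WQ nB.
Qed.

Let lev Q : nat := xget 0%N [set k | W k Q].

Let levE k Q : W k Q -> lev Q = k.
Proof.
move=> WQ; have : W (lev Q) Q by apply: (@xgetPex _ 0%N [set k | W k Q]);
  exists k.
by move=> WQ'; exact: levelW WQ' WQ.
Qed.

(* The balls of one level are equal or disjoint, so dividing by the number of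
   cells sharing a ball gives a partition of unity. *)
Let nu k y : R := \sum_(Q <- fset_set (W k)) \1_(B Q) y.
Let phi Q x : R := if lev Q is 0 then 0 else \1_(B Q) x / nu (lev Q) (z Q).

Let phiE k Q x : (0 < k)%N -> W k Q -> phi Q x = \1_(B Q) x / nu k (z Q).
Proof. by move=> k0 WQ; rewrite /phi (levE WQ); case: k k0 WQ. Qed.

Let nu_ge1 k Q y : W k Q -> B Q y -> 1 <= nu k y.
Proof.
move=> WQ By; rewrite /nu (big_rem Q)/=; last by rewrite in_fset_set//;
  exact/mem_set.
by rewrite indicE mem_set// lerDl sumr_ge0.
Qed.

Let B_center k Q : W k Q -> B Q (z Q).
Proof.
move=> WQ; split; first exact: zX WQ.
move=> k' k'0 WQ'; apply: (rball_refl m1 pgP lam01 ratio) => //.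
exact: zX WQ.
Qed.

(** Balls of equal radius do not separate two points of one of them. *)
Let nu_ball k Q x : (0 < k)%N -> W k Q -> B Q x -> nu k (z Q) = nu k x.
Proof.
move=> k0 WQ Bx; apply: eq_big_seq => Q'; rewrite in_fset_set// => /set_mem WQ'.
rewrite !indicE; suff E : (z Q \in B Q') = (x \in B Q') by rewrite E.
move: Bx; rewrite (B_pos k0 WQ) (B_pos k0 WQ') => Bx.
apply/idP/idP => /set_mem h; apply/mem_set.
  exact: (rball_trans m1 pgP h).
apply: (rball_trans m1 pgP h); exact: (rball_sym m1 pgP (zX WQ) Bx).
Qed.

Let phi_itv k Q x : W k Q -> 0 <= phi Q x <= 1.
Proof.
move=> WQ; rewrite /phi (levE WQ); case: k WQ => [|k] WQ; first by rewrite lexx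
  ler01.
have n1 := nu_ge1 WQ (B_center WQ); have n0 := lt_le_trans ltr01 n1.
rewrite indicE; case: (x \in B Q); last by rewrite mul0r lexx ler01.
by rewrite mul1r invr_ge0 (ltW n0)/= invf_le1.
Qed.

(** At positive levels [phi Q] is constant on balls of radius [r * beta k], so points where it
    differs are at distance at least [r * beta k >= vol m Q]; there the Lipschitz condition follows
    from [phi] taking values in [[0, 1]]. *)
Lemma gt_blocks f : gt_besov m G s p q f -> exists c (a : set T -> T -> R[i]),
  (forall k Q, W k Q -> block m X rho s p (r * beta k) Q (z Q) (a Q)) /\
  expands m W p q c a f.
Proof.
move=> gtf; pose a Q x : R[i] := (vol m Q `^ (s - p^-1) * phi Q x)%:C%C.
have phisupp k Q x : (0 < k)%N -> W k Q -> phi Q x != 0 -> B Q x.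
  move=> k0 WQ; rewrite (phiE _ k0 WQ) indicE; case: (asboolP (B Q x)) => //.
  by move=> nB; rewrite memNset// mul0r eqxx.
have [c cE] : exists c : set T -> R[i], expands m W p q c a f.
  apply: gt_phi gtf.
  - case=> [|k] Q WQ.
      rewrite (_ : phi Q = fun=> 0); first exact: measurable_cst.
      by apply/funext => x; rewrite /phi (levE WQ).
    rewrite (_ : phi Q = fun x => \1_(B Q) x / nu k.+1 (z Q)); last first.
      by apply/funext => x; rewrite (phiE _ (ltn0Sn k) WQ).
    apply: measurable_funM; last exact: measurable_cst.
    by apply: measurable_indic; exact: B_meas WQ.
  - by move=> k Q x k0 WQ ph; rewrite -(B_pos k0 WQ); exact: phisupp k0 WQ ph.
  - move=> k k0; apply: filterS (regular_ae regW) => x rx.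
    have [Q0 [[WQ0 Q0x] _]] := rx k.
    have BQ0 : B Q0 x by rewrite (B_pos k0 WQ0); exact: (sg_ball sW k0 WQ0 Q0x).
    have n0 : 0 < nu k x := lt_le_trans ltr01 (nu_ge1 WQ0 BQ0).
    transitivity (\sum_(Q <- fset_set (W k)) \1_(B Q) x / nu k x); last first.
      by rewrite -mulr_suml -/(nu k x) mulfV// gt_eqF.
    apply: eq_big_seq => Q; rewrite in_fset_set// => /set_mem WQ.
    rewrite (phiE _ k0 WQ) indicE; case: (asboolP (B Q x)) => Bx.
      by rewrite (nu_ball k0 WQ Bx).
    by rewrite memNset// !mul0r.
exists c, a; split=> // k Q WQ; have V0 := powR_ge0 (vol m Q) (s - p^-1).
(* At level 0 [phi] is 0 by definition, so the blocks vanish. *)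
case: k WQ => [|k] WQ.
  have a0 x : a Q x = 0 by rewrite /a /phi (levE WQ) mulr0.
  split=> [x|x Xx|x y Xx Xy]; rewrite !a0 ?modulus0//.
  by rewrite subrr modulus0 mule_ge0 ?lee_fin ?powR_ge0// (rho_ge0 m).
split.
- move=> x; rewrite -(B_pos (ltn0Sn k) WQ) => ax; apply: (phisupp _ _ _ (ltn0Sn
  k) WQ).
  by apply/eqP => ph; apply: ax; rewrite /a ph mulr0.
- move=> x _; have /andP[h1 h2] := phi_itv x WQ.
  by rewrite modulus_real ger0_norm ?mulr_ge0// ler_piMr.
move=> x y Xx Xy.
rewrite /a -rmorphB modulus_real -mulrBr normrM (ger0_norm V0).
have rho0 := rho_ge0 m P x y.
have [->|phxy] := eqVneq (phi Q x) (phi Q y).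
  by rewrite subrr normr0 mulr0 mule_ge0// lee_fin powR_ge0.
have d1 : `|phi Q x - phi Q y| <= 1.
  have /andP[h1 h2] := phi_itv x WQ; have /andP[h3 h4] := phi_itv y WQ.
  by rewrite ler_norml; apply/andP; split; lra.
have sep : ((r * beta k.+1)%:E <= rho x y)%E.
  rewrite leNgt; apply/negP => h; move/eqP: phxy; apply.
  rewrite !(phiE _ (ltn0Sn k) WQ) !indicE.
  suff E : (x \in B Q) = (y \in B Q) by rewrite E.
  have xy : rball X rho x (r * beta k.+1) y by split.
  rewrite (B_pos (ltn0Sn k) WQ); apply/idP/idP => /set_mem b; apply/mem_set.
    exact: (rball_trans m1 pgP b xy).
  exact: (rball_trans m1 pgP b (rball_sym m1 pgP Xx xy)).
have vQ := vol0 WQ.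
have vr : vol m Q <= r * beta k.+1.
  apply: le_trans (rball_vol_le m1 pgP lam'01 lam01 ratio (zX WQ) (rb0 _)).
  apply: vol_le => //; [exact: measW WQ| |exact: (sg_ball sW)].
  by rewrite -(B_pos (ltn0Sn k) WQ); exact: B_meas WQ.
apply: (@le_trans _ _ ((vol m Q `^ (s - p^-1 - 1))%:E * (vol m Q)%:E)%E).
  rewrite -EFinM lee_fin -[X in _ <= _ * X](powRr1 (ltW vQ)) -powRD; last first.
    by rewrite (gt_eqF vQ) implybT.
  by rewrite subrK ler_piMr.
rewrite lee_wpmul2l ?lee_fin ?powR_ge0//.
by apply: le_trans sep; rewrite lee_fin.
Qed.

Hypothesis eta_sp : s * p < eta.

(** Let [L] be the layer of [Q] of width [maxvol m G k]. The rest of [Q] is a union of cells of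
    level [k] of [G], so the increment of level [k.+1] sees only the indicator of [L]. The measure
    of [L] gives the power [eta / p] of the ratio of scales, and [eta_sp] makes [e] positive. *)
Lemma grid_sub_gt : grid_besov m W s p q `<=` gt_besov m G s p q.
Proof.
move=> f [c fE]; pose e := eta / p - s.
have e0 : 0 < e by rewrite subr_gt0 ltr_pdivlMr.
have se : s + e = eta / p by rewrite /e addrC subrK.
have eta0 : 0 < eta by apply: le_lt_trans eta_sp; rewrite mulr_ge0 ?(ltW s0)
  ?(ltW p0).
pose C := v2 `^ s * (1 + 8 * CL `^ p^-1).
have C0 : 0 <= C by rewrite mulr_ge0 ?powR_ge0 ?addr_ge0 ?mulr_ge0 ?powR_ge0.
have vsp Q : 0 < vol m Q -> vol m Q `^ (s - p^-1) * vol m Q `^ p^-1 = vol m Q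
  `^ s.
  by move=> v0; rewrite -powRD ?subrK// (gt_eqF v0) implybT.
apply: (molecules_sub e0 C0 _ _ _ _ fE).
- move=> j Q WQ; apply: cmeas_real; apply: measurable_funM => //.
  by apply: measurable_indic; exact: measW WQ.
- move=> j Q WQ; rewrite /atom Lp_indic ?powR_ge0//; last exact: measW WQ.
  rewrite lee_fin vsp; last exact: vol0 WQ.
  apply: le_trans (vol_pow_le WQ (ltW s0)) _; rewrite ler_wpM2r ?powR_ge0//.
  by rewrite /C ler_peMr ?powR_ge0// lerDl mulr_ge0 ?powR_ge0.
- move=> j k Q WQ _; have mQ := measW WQ.
  set L := [set x | Q x /\ (rdist rho x (X `\` Q) <= (maxvol m G k)%:E)%E].
  have mL : measurable L by exact: (layer_meas m1 pgP).
  pose a := vol m Q `^ (s - p^-1).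
  have a0 : 0 <= a by exact: powR_ge0.
  pose h x : R[i] := (a * \1_L x)%:C%C.
  have ci A : measurable A -> cintegrable m (fun x => (a * \1_A x)%:C%C : R[i]).
    move=> mA; apply: (Lp_cintegrable m1 p1); last by rewrite Lp_indic// ltry.
    apply: cmeas_real; apply: measurable_funM; first exact: measurable_cst.
    exact: measurable_indic.
  have mQL : measurable (Q `\` L) by exact: measurableD.
  have aE : atom m s p Q = fun x => h x + (a * \1_(Q `\` L) x)%:C%C.
    apply/funext => x; rewrite /atom /h -/a -rmorphD -mulrDr; congr (_ *
      _)%:C%C.
    rewrite !indicE in_setD.
    have [Lx|Lx] := boolP (x \in L); last by rewrite add0r andbT.
    by rewrite andbF addr0; case: (set_mem Lx) => Qx _; rewrite mem_set.
  rewrite aE (mdiffD pgG); [|exact: ci|exact: ci].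
  apply: (@le_trans _ _ (Lpnorm m p (mdiff m G h k.+1))).
    apply: Lpnorm_le => //; last 1 first.
    + apply: filterS (pg_ae nX) => x Xx.
      rewrite (mdiff_saturated m1 pgG (f := fun x => (a * \1_(Q `\` L)
        x)%:C%C))//.
        by rewrite addr0.
      move=> S y y' GS Sy Sy'; rewrite !indicE.
      suff yy' : (y \in Q `\` L) = (y' \in Q `\` L) by rewrite yy'.
      have sat u v : S u -> S v -> (Q `\` L) u -> (Q `\` L) v.
        move=> Su Sv [Qu nLu].
        have Qv : Q v.
          apply: contrapT => nQv; apply: nLu; split=> //.
          apply: le_trans (rho_cell GS Su Sv); apply: ereal_inf_lbound.
          by exists v => //; split=> //; exact: (pg_sub pgG GS).
        split=> // -[_ /(rdist_leP m1 pgP) H]; apply: nLu; split=> //.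
        apply/(rdist_leP m1 pgP) => eps eps0.
        have [D [cD Dv vD [w [Dw Aw]]]] := H _ eps0.
        (* Either the cell joining [v] to the complement of [Q] contains [u] as well, or the whole
           of [S], whose volume is at most the width of the layer, meets that complement. *)
        have [SD|DS] := cells_nested pgP (cellG GS) cD Sv Dv.
          by exists D; split=> //; [exact: SD|exists w].
        exists S; split=> //; first exact: cellG GS.
          by apply: (le_lt_trans (maxvol_ge m1 rG GS)); rewrite ltrDl.
        by exists w; split=> //; exact: DS.
      apply/idP/idP => /set_mem u; apply/mem_set.
        exact: sat Sy Sy' u.
      exact: sat Sy' Sy u.
    + apply: cmeasD; exact: (cmeas_mdiff pgG).
    + exact: (cmeas_mdiff pgG).
  apply: le_trans (mdiff_Lp m1 nX pgG _ p1 (ci _ mL)) _.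
  rewrite Lp_indic// -EFinM lee_fin.
  have bk0 := beta_gt0 j; have lk0 := ell_gt0 k.
  have vQ0 := vol0 WQ.
  have lb0 : 0 <= maxvol m G k / beta j by rewrite divr_ge0 ?ltW.
  have CL0 := sg_CL sW.
  have layer : vol m L <= CL * (maxvol m G k / beta j) `^ eta * vol m Q.
    have := sg_layer sW WQ lk0; rewrite -/L (volE m1 mL) (volE m1 mQ).
    by rewrite -EFinM lee_fin.
  have {}layer : vol m L `^ p^-1 <=
      CL `^ p^-1 * (maxvol m G k / beta j) `^ (eta / p) * vol m Q `^ p^-1.
    rewrite powRrM -!powRM ?mulr_ge0 ?powR_ge0 ?vol_ge0//.
    by rewrite ge0_ler_powR ?invr_ge0 ?(ltW p0)// ?nnegrE ?vol_ge0// ?mulr_ge0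
      ?powR_ge0 ?vol_ge0.
  rewrite se; set E := (_ / _) `^ (eta / p) in layer *.
  have E0 : 0 <= E by exact: powR_ge0.
  apply: (@le_trans _ _ (8 * CL `^ p^-1 * E * vol m Q `^ s)).
    rewrite -(vsp _ vQ0) -/a.
    rewrite [leRHS](_ : _ = 8 * (a * (CL `^ p^-1 * E * vol m Q `^ p^-1))); last
      by ring.
    by rewrite ler_wpM2l// ler_wpM2l.
  apply: (@le_trans _ _ (8 * CL `^ p^-1 * E * (v2 `^ s * beta j `^ s))).
    by rewrite ler_wpM2l ?mulr_ge0 ?powR_ge0// vol_pow_le// ltW.
  rewrite /C [leRHS](_ : _ = (1 + 8 * CL `^ p^-1) * (E * (v2 `^ s * beta j `^
    s))); last by ring.
  rewrite -mulrA ler_wpM2r ?mulr_ge0 ?powR_ge0//.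
  by rewrite lerDr.
- move=> j Q x WQ Xx nB; rewrite /atom indicE memNset ?mulr0// => Qx; apply: nB.
  by split=> // k k0 WQ'; exact: (sg_ball sW k0 WQ' Qx).
Qed.

End Comparison.

(** * Existence of recalibrations and adapted grids *)

Section Existence.
Context d (T : measurableType d) (R : realType).
Variable m : {measure set T -> \bar R}.
Hypothesis m1 : m setT = 1%E.
Variables (X : set T) (P : nat -> set (set T)).
Hypothesis nX : m.-negligible (~` X).
Hypothesis pgP : partition_grid m X P.
Hypothesis gen : <<s X, cells P >> = [set A | measurable A /\ A `<=` X].
Variables lam' lam : R.
Hypothesis lam'01 : 0 < lam' < 1.
Hypothesis lam01 : 0 < lam < 1.
Hypothesis ratio : forall k Q Q', P k.+1 Q -> P k Q' -> Q `<=` Q' ->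
      lam' <= vol m Q / vol m Q' <= lam.
Notation rho := (grid_dist m P).

Let lam'0 : 0 < lam'. Proof. by case/andP: lam'01. Qed.
Let lam'1 : lam' < 1. Proof. by case/andP: lam'01. Qed.

Variable r0 : R.
Hypothesis r0_gt0 : 0 < r0.
Hypothesis r0_le : forall C, P 0%N C -> r0 <= vol m C.

(** Volumes at level [k] will lie between [lam' * rad k] and [rad k]. Taking [w < lam'] separates
    the ranges of successive levels: [maxvol] decreases strictly and ratios of consecutive levels
    are at most 1/2. *)
Let w := lam' / 2.
Let w0 : 0 < w. Proof. by rewrite divr_gt0. Qed.
Let w_lt : w < lam'. Proof. by rewrite /w ltr_pdivrMr// ltr_pMr// ltr1n. Qed.
Let w1 : w < 1. Proof. exact: lt_trans lam'1. Qed.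
Let rad k := r0 * w ^+ k.
Let rad0 k : 0 < rad k. Proof. by rewrite mulr_gt0// exprn_gt0. Qed.
Let radS k : rad k.+1 = w * rad k. Proof. by rewrite /rad exprS mulrCA. Qed.
Let radS_half k : rad k.+1 = 2^-1 * (lam' * rad k).
Proof. by rewrite radS /w; ring. Qed.
Let rad_le k : rad k.+1 <= rad k.
Proof. by rewrite radS ger_pMl// ltW. Qed.

(** A stopping time: along the chain of cells through a point, the first one of volume at most
    [rad k], expressed by maximality for inclusion. *)
Definition stopping_grid (k : nat) : set (set T) :=
  [set Q | [/\ cells P Q, vol m Q <= rad k &
    forall C, cells P C -> Q `<=` C -> vol m C <= rad k -> C `<=` Q]].
Let G := stopping_grid.

Let cellG k Q : G k Q -> cells P Q. Proof. by case. Qed.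
Let volG k Q : G k Q -> vol m Q <= rad k. Proof. by case. Qed.

(** By maximality the parent has volume above [rad k], and the ratio condition applies. A cell of
    level 0 has no parent; there its volume is at least [r0 >= rad k]. *)
Let volG_ge k Q : G k Q -> lam' * rad k <= vol m Q.
Proof.
move=> [[[|n] _ PQ] vQ max].
  apply: le_trans (r0_le PQ); apply: (@le_trans _ _ (rad k)).
    by rewrite ger_pMl// ltW.
  by rewrite /rad ger_pMr// exprn_ile1 ?ltW.
have [D PD QD] := pg_nested pgP PQ.
have /andP[h _] := pg_child m1 pgP ratio PQ PD QD; apply: le_trans h.
rewrite ler_wpM2l ?(ltW lam'0)// leNgt; apply/negP => vD.
have DQ : D `<=` Q by apply: max => //; [exists n|exact: ltW].
have := pg_vol_lt m1 pgP lam01 ratio PD PQ QD (ltnSn n).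
by rewrite ltNge (vol_le m1 (pg_meas pgP PD) (pg_meas pgP PQ) DQ).
Qed.

Let coverG k x : X x -> exists2 Q, G k Q & Q x.
Proof.
move=> Xx.
pose has n := `[< exists C, [/\ P n C, C x & vol m C <= rad k] >].
have ex : exists n, has n.
  have [C [[n _ PC] Cx vC]] := small_cell m1 pgP lam01 ratio Xx (rad0 k).
  by exists n; apply/asboolP; exists C; split=> //; exact: ltW.
case: (ex_minnP ex) => n /asboolP[C [PC Cx vC]] nmin.
exists C => //; split=> //; first by exists n.
move=> D [j _ PD] CD vD; apply: (pg_level_sub pgP PC PD Cx (CD _ Cx)).
by apply: nmin; apply/asboolP; exists D; split=> //; exact: CD.
Qed.

Let disjG k Q Q' x : G k Q -> G k Q' -> Q x -> Q' x -> Q = Q'.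
Proof.
move=> [cQ vQ mQ] [cQ' vQ' mQ'] Qx Q'x; apply/seteqP.
have [h|h] := cells_nested pgP cQ cQ' Qx Q'x; split=> //.
  exact: mQ.
exact: mQ'.
Qed.

(** The lower bound on volumes confines these cells to finitely many levels of [P]. *)
Let finG k : finite_set (G k).
Proof.
have [N NP] := exp_lt lam01 (mulr_gt0 lam'0 (rad0 k)).
apply: (@sub_finite_set _ _ (\bigcup_(n in `I_N) P n)); last first.
  by apply: bigcup_finite => [|n _]; [exact: finite_II|exact: (pg_finite pgP)].
move=> Q GQ; have [n _ PQ] := cellG GQ; exists n => //=.
rewrite ltnNge; apply/negP => Nn.
have := le_trans (volG_ge GQ) (pg_vol_exp m1 pgP lam01 ratio PQ).
apply/negP; rewrite -ltNge; apply: le_lt_trans NP.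
by case/andP: lam01 => h h'; rewrite ler_wiXn2l// ltW.
Qed.

Let nestG k Q : G k.+1 Q -> exists2 Q', G k Q' & Q `<=` Q'.
Proof.
move=> GQ; have [x Qx] := cells_nonempty m1 pgP (cellG GQ).
have [Q' GQ' Q'x] := coverG k (cells_sub pgP (cellG GQ) Qx).
exists Q' => //; have [//|h] := cells_nested pgP (cellG GQ) (cellG GQ') Qx Q'x.
case: GQ' => cQ' _; apply; [exact: cellG GQ|exact: h|].
exact: le_trans (volG GQ) (rad_le k).
Qed.

Let measG k Q : G k Q -> measurable Q.
Proof. by move=> GQ; exact: (cells_meas pgP (cellG GQ)). Qed.

Let ratioG k Q Q' : G k.+1 Q -> G k Q' -> lam' * w <= vol m Q / vol m Q' <=
  2^-1.
Proof.
move=> GQ GQ'; have v0 := cells_vol_gt0 m1 pgP (cellG GQ').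
rewrite ler_pdivlMr// ler_pdivrMr//; apply/andP; split.
  apply: le_trans (volG_ge GQ); rewrite radS -mulrA ler_wpM2l ?(ltW lam'0)//.
  by rewrite ler_wpM2l ?(ltW w0)// volG.
by apply: (le_trans (volG GQ)); rewrite radS_half ler_wpM2l// volG_ge.
Qed.

Let lw01 : 0 < lam' * w < 1.
Proof.
rewrite mulr_gt0//=; apply: (@lt_trans _ _ w) => //.
by rewrite gtr_pMl.
Qed.

Let half01 : 0 < (2^-1 : R) < 1.
Proof. by rewrite invr_gt0 ltr0n invf_lt1 ?ltr1n. Qed.

Let sigmaU (H : set (set T)) (A B : set T) :
  <<s X, H >> A -> <<s X, H >> B -> <<s X, H >> (A `|` B).
Proof.
move=> HA HB; rewrite -bigcup2E; apply: sigma_algebra_bigcup => -[|[|n]] //=.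
exact: sigma_algebra0.
Qed.

(** Once [rad k <= vol m C], each cell of [G k] that meets [C] is contained in it, so [C] is a
    finite union of cells of [G k]. *)
Let cell_gen C : cells P C -> <<s X, cells G >> C.
Proof.
move=> cC; have vC := cells_vol_gt0 m1 pgP cC.
have w01 : 0 < w < 1 by rewrite w0.
have [k kP] := exp_lt w01 (divr_gt0 vC r0_gt0).
have radC : rad k <= vol m C by rewrite /rad mulrC -ler_pdivlMr// ltW.
have -> : C = \bigcup_(Q in [set Q | G k Q /\ Q `<=` C]) Q.
  apply/seteqP; split=> [x Cx|x [Q [_ QC] Qx]]; last exact: QC.
  have [Q GQ Qx] := coverG k (cells_sub pgP cC Cx); exists Q => //; split=> //.
  apply: (cells_vol_sub m1 pgP lam01 ratio (cellG GQ) cC Qx Cx).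
  exact: le_trans (volG GQ) radC.
have fD : finite_set [set Q | G k Q /\ Q `<=` C].
  by apply: sub_finite_set (finG k) => Q [].
have : forall Q, [set Q | G k Q /\ Q `<=` C] Q -> <<s X, cells G >> Q.
  by move=> Q [GQ _]; apply: sub_sigma_algebra; exists k.
have /finite_seqP[l ->] := fD; elim: l => [|Q l IH] lP.
  rewrite (_ : \bigcup_(_ in _) _ = set0); first exact: sigma_algebra0.
  by apply/seteqP; split=> // x [].
rewrite (_ : \bigcup_(_ in _) _ = Q `|` \bigcup_(Q' in [set` l]) Q').
  apply: sigmaU; first by apply: lP; rewrite /= mem_head.
  by apply: IH => Q' Q'l; apply: lP; rewrite /= in_cons; apply/orP; right.
apply/seteqP; split=> x.
  move=> [Q' /=]; rewrite in_cons => /orP[/eqP->|Q'l] Q'x; first by left.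
  by right; exists Q'.
move=> [Qx|[Q' /= Q'l Q'x]]; first by exists Q; rewrite //= mem_head.
by exists Q' => //=; rewrite in_cons Q'l orbT.
Qed.

Lemma stopping_good : good_grid m X G.
Proof.
split.
- exact: finG.
- exact: measG.
- by move=> k Q GQ; exact: (cells_sub pgP (cellG GQ)).
- by move=> k Q /cellG[n _ PQ]; exact: (pg_pos pgP PQ).
- move=> k; rewrite (_ : _ `\` _ = set0) ?measure0//.
  apply/seteqP; split=> // x [Xx nx]; apply: nx.
  by have [Q GQ Qx] := coverG k Xx; exists Q.
- move=> k Q Q' GQ GQ' QQ'; rewrite (_ : _ `&` _ = set0) ?measure0//.
  apply/seteqP; split=> // x [Qx Q'x]; apply: QQ'.
  exact: disjG GQ GQ' Qx Q'x.
- exact: nestG.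
- apply/seteqP; split; rewrite -gen.
    apply: sub_sigma_algebra2 => Q [k _ GQ]; exact: cellG GQ.
  apply: smallest_sub; first exact: smallest_sigma_algebra.
  exact: cell_gen.
- exists (lam' * w), 2^-1; split=> //.
  by move=> k Q Q' GQ GQ' _; exact: (ratioG GQ GQ').
Qed.

Let XT : exists x, X x.
Proof.
apply/set0P/eqP => X0; have : m setT = 0%E.
  by apply/negligibleP => //; rewrite -setC0 -X0.
by rewrite m1 => /eqP; rewrite onee_eq0.
Qed.

Let volset0 k : [set vol m Q | Q in G k] !=set0.
Proof. by have [x /(coverG k)[Q GQ _]] := XT; exists (vol m Q), Q. Qed.

Let maxvol_le k : maxvol m G k <= rad k.
Proof. by apply: ge_sup => // _ [Q GQ <-]; exact: volG. Qed.

Let minvol_ge k : lam' * rad k <= minvol m G k.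
Proof. by apply: lb_le_inf => // _ [Q GQ <-]; exact: volG_ge. Qed.

Let min_le_max k : minvol m G k <= maxvol m G k.
Proof.
have [_ [Q GQ _]] := volset0 k; apply: (@le_trans _ _ (vol m Q)).
  by apply: ge_inf; [exists 0 => _ [S _ <-]; exact: vol_ge0|exists Q].
by apply: ub_le_sup; [exists (rad k) => _ [S GS <-]; exact: volG|exists Q].
Qed.

Lemma stopping_recalibration : recalibration m X P G.
Proof.
have lr0 k : 0 < lam' * rad k by rewrite mulr_gt0.
have min0 k : 0 < minvol m G k by exact: lt_le_trans (minvol_ge k).
have max0 k : 0 < maxvol m G k by exact: lt_le_trans (min_le_max k).
have max_ge k : lam' * rad k <= maxvol m G k by exact: le_trans (min_le_max k).
split.
- exact: stopping_good.
- by move=> Q [k _ GQ]; exact: cellG GQ.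
- move=> k; apply: le_lt_trans (maxvol_le _) _; apply: lt_le_trans (max_ge k).
  by rewrite radS ltr_pM2r.
exists (lam' * w), 2^-1, lam'; split=> // k; split.
  rewrite ler_pdivlMr// ler_pdivrMr//; apply/andP; split.
    apply: le_trans (max_ge _); rewrite radS -mulrA ler_wpM2l ?(ltW lam'0)//.
    by rewrite ler_wpM2l ?(ltW w0).
  by apply: le_trans (maxvol_le _) _; rewrite radS_half ler_wpM2l.
rewrite ler_pdivlMr// mul1r min_le_max/= ler_pdivrMr//.
rewrite -[leLHS]mul1r -(mulVf (lt0r_neq0 lam'0)) -mulrA ler_wpM2l ?invr_ge0
  ?(ltW lam'0)//.
apply: le_trans (minvol_ge k); rewrite ler_wpM2l ?(ltW lam'0)//.
Qed.

(** Layers of width below the volume of the cell are empty, and for [t >= 1] the factor [t ^ eta] is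
    at least 1, so every positive exponent works. *)
Lemma stopping_adapted eta : 0 < eta -> adapted m X rho G eta.
Proof.
move=> eta0; have [x0 _] := XT; have w01 : 0 < w < 1 by rewrite w0.
have zG k Q : G k Q -> Q (xget x0 Q).
  move=> GQ; apply: xgetPex; exact: (cells_nonempty m1 pgP (cellG GQ)).
(* [c1] and [c3] come from the lower bound [lam' * rad k] on volumes, through [rho_sep], and [c2]
   from the upper bound [rad k]. *)
exists (fun Q => xget x0 Q), w, (lam' * r0), r0, (lam' * r0), 1; split=> //.
- exact: stopping_good.
- by split=> //; rewrite mulr_gt0.
- move=> k Q _ GQ y [Xy h]; apply: contrapT => nQy.
  have := rho_sep m1 pgP lam01 ratio (cellG GQ) (zG _ _ GQ) nQy.
  move=> /le_lt_trans/(_ h); rewrite lte_fin ltNge => /negP; apply.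
  by rewrite -mulrA; exact: volG_ge.
- move=> k Q _ GQ; apply: ge_ereal_sup => _ [x Qx [y Qy <-]].
  apply: le_trans (rho_le m1 pgP (cellG GQ) Qx Qy) _.
  by rewrite lee_fin volG.
- move=> k Q t _ GQ t0; rewrite mul1r; have mQ := measG GQ.
  set L := [set x | _].
  have mL : measurable L by exact: (layer_meas m1 pgP).
  have [t1|t1] := ltP t 1.
    rewrite (_ : L = set0) ?measure0; first by rewrite mule_ge0// lee_fin
      powR_ge0.
    apply/seteqP; split=> // x [Qx h].
    have : ((vol m Q)%:E <= rdist rho x (X `\` Q))%E.
      apply: le_ereal_inf_tmp => _ [y [_ nQy] <-].
      exact: (rho_sep m1 pgP lam01 ratio (cellG GQ) Qx nQy).
    move=> /le_trans/(_ h); rewrite lee_fin leNgt => /negP; apply.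
    apply: lt_le_trans (volG_ge GQ).
    rewrite (_ : lam' * r0 * t * w ^+ k = lam' * rad k * t); last by rewrite
      /rad; ring.
    by rewrite gtr_pMr// mulr_gt0.
  apply: (@le_trans _ _ (1%:E * m Q)%E).
    by rewrite mul1e; apply: le_measure; rewrite ?inE// => x [].
  rewrite lee_wpmul2r// lee_fin (_ : 1 = 1 `^ eta); last by rewrite powR1.
  by rewrite ge0_ler_powR ?(ltW eta0)// nnegrE ltW.
Qed.

End Existence.

(** * Equality of the spaces *)

Theorem theorem3p2 (R : realType) (I : ptopologicalType)
    (I_compact : compact [set: I]) (I_hausdorff : hausdorff_space I)
    (m : {measure set (borelType I) -> \bar R})
    (m_mass1 : m [set: borelType I] = 1%E)
    (P0 : nat -> set (set (borelType I)))
    (P0_good : good_grid m [set: borelType I] P0) :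
  let X := regular_points P0 in
  let P := trace_grid X P0 in
  let rho := grid_dist m P in
  forall (p : R) (q : \bar R), 1 <= p -> (1 <= q)%E ->
  exists2 s0 : R, 0 < s0 <= p^-1 &
  forall s : R, 0 < s < s0 ->
  [/\ exists G, recalibration m X P G,
      exists W eta, adapted m X rho W eta /\ s * p < eta,
      forall G1 G2, recalibration m X P G1 -> recalibration m X P G2 ->
        gt_besov m G1 s p q = gt_besov m G2 s p q &
      forall G, recalibration m X P G ->
      forall W z lam c1 c2 c3 c4 eta,
        adapted_with m X rho W z lam c1 c2 c3 c4 eta -> s * p < eta ->
      forall Crho : R, 1 <= Crho -> quasi_triangle X rho Crho ->
        [/\ gt_besov m G s p q = grid_besov m G s p q,
            grid_besov m G s p q = grid_besov m W s p q &
            grid_besov m W s p q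
              = hly_besov m X rho W z lam c2 Crho s p q]].
Proof.
move=> X P rho p q p1 q1; have p0 : 0 < p by rewrite (lt_le_trans ltr01).
exists p^-1; first by rewrite invr_gt0 p0 lexx.
move=> s /andP[s0 sp].
have nX : m.-negligible (~` X) := trace_space_negligible P0_good.
have pgP : partition_grid m X P := trace_partition P0_good.
have gen := trace_generates P0_good.
have [lam' [lam [lam'01 lam01 ratio]]] := trace_ratio m_mass1 P0_good.
have [r0 r00 r0P] := @finite_lower_bound R _ (P 0%N) (vol m) (pg_finite pgP 0%N)
  (fun C => pg_vol_gt0 m_mass1 pgP (k := 0%N) (Q := C)).
(* [s * p + 1] is one exponent above the threshold [s * p]; the stopping grid and the recalibrations
   admit every positive exponent. *)
have sp0 : 0 < s * p + 1 by rewrite addr_gt0// mulr_gt0.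
have rec := stopping_recalibration m_mass1 nX pgP gen lam'01 lam01 ratio r00
  r0P.
have ada := stopping_adapted m_mass1 nX pgP gen lam'01 lam01 ratio r00 r0P sp0.
have scaled G W z beta th th' r v1 v2 CL eta : recalibration m X P G ->
    scaled_grid m X P W z beta th th' r v1 v2 CL eta -> s * p < eta ->
    gt_besov m G s p q = grid_besov m W s p q.
  move=> rG sW eta_sp; apply/seteqP; split.
    exact: (gt_sub_grid m_mass1 nX pgP lam01 ratio rG p1 q1 s0 sW).
  exact: (grid_sub_gt m_mass1 nX pgP lam'01 lam01 ratio rG p1 q1 s0 sW eta_sp).
have gt_adapted G W z th c1 c2 c3 c4 eta : recalibration m X P G ->
    adapted_with m X rho W z th c1 c2 c3 c4 eta -> s * p < eta ->
    gt_besov m G s p q = grid_besov m W s p q.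
  move=> rG aW eta_sp; have c20 : 0 < c2 by case: (adapted_constants aW).
  have c22 : c2 < 2 * c2 by rewrite ltr_pMl// ltr1n.
  have [v1 [v2 [CL sW]]] := adapted_scaled m_mass1 nX pgP lam'01 lam01 ratio aW
    c22.
  exact: scaled rG sW eta_sp.
split.
- by eexists; exact: rec.
- by eexists; exists (s * p + 1); split; [exact: ada|rewrite ltrDl].
(* Both spaces are identified with the grid space of the stopping grid. *)
- move=> G1 G2 rG1 rG2.
  have [z [th [c1 [c2 [c3 [c4 aW]]]]]] := ada.
  have lt1 : s * p < s * p + 1 by rewrite ltrDl.
  by rewrite (gt_adapted _ _ _ _ _ _ _ _ _ rG1 aW lt1) (gt_adapted _ _ _ _ _ _
    _ _ _ rG2 aW lt1).
move=> G rG W z th c1 c2 c3 c4 eta aW eta_sp Crho Crho1 _.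
have gtW := gt_adapted _ _ _ _ _ _ _ _ _ rG aW eta_sp.
have gtG : gt_besov m G s p q = grid_besov m G s p q.
  have lt1 : s * p < s * p + 1 by rewrite ltrDl.
  have [z' [th1 [th2 [r [v1 [v2 [CL sG]]]]]]] :=
    recal_scaled m_mass1 nX pgP lam01 ratio rG sp0.
  exact: scaled rG sG lt1.
split; [exact: gtG|by rewrite -gtG|rewrite -gtW].
have c20 : 0 < c2 by case: (adapted_constants aW).
(* With [r = 3 * Crho * c2] the radius [r * beta k] is the support radius in [hly_besov]; it exceeds
   the diameter bound because [Crho >= 1]. *)
have c2r : c2 < 3 * Crho * c2.
  by rewrite ltr_pMl//; lra.
have [v1 [v2 [CL sW]]] := adapted_scaled m_mass1 nX pgP lam'01 lam01 ratio aW
  c2r.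
apply/seteqP; split=> f.
  exact: (gt_blocks m_mass1 nX pgP lam'01 lam01 ratio rG p1 q1 s0 sW).
move=> [c [a [aB fE]]].
exact: (blocks_sub m_mass1 nX pgP lam'01 lam01 ratio rG p1 q1 s0 sp sW aB fE).
Qed.
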